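(* Fix a closed interval $[\underline b,\overline b]\subset\mathcal I_0$ with $0<\underline b<\overline b$, and fix $\tilde s_0>0$. Then there exists $0<a^*<1$ such that the following holds. Let $a_1,a_2>0$ with $\frac{a_2}{a_1}\le a^*$. Consider any Oleinik shock $(u_L,u_R)$ with $u_L,u_R\in[\underline b,\overline b]$ and $|u_L-u_R|\ge\tilde s_0$, any $u\in\mathcal S_{\text{weak}}$, any $\overline t\in[0,\infty)$ and any $x_0\in\mathbb R$. Then there exists a Lipschitz path $h:[\overline t,\infty)\to\mathbb R$ with $h(\overline t)=x_0$ such that, writing $u_\pm(t)=u(t,h(t)\pm)$, $$a_1\bigl(\dot h(t)\,\eta(u_-(t)|u_L)-q(u_-(t);u_L)\bigr)-a_2\bigl(\dot h(t)\,\eta(u_+(t)|u_R)-q(u_+(t);u_R)\bigr)\le 0$$ for almost every $t\in[\overline t,\infty)$. Here $a^*$ depends only on the system, $\underline b,\overline b$ and $\tilde s_0$. Moreover, there is a maximal shock speed: a constant $\hat\lambda_1$ such that these paths satisfy $|\dot h(t)|\le\hat\lambda_1$ for almost every $t\in[\overline t,\infty)$.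
   Context: Setting. Fix $M>0$ and the state space $\mathcal I_0=[-M,M]$. The flux $f:\mathbb R\to\mathbb R$ is of class $C^4$ and concave-convex: $uf''(u)>0$ for $u\ne0$, $f'''(0)\neq0$, and $f'(u)\to+\infty$ as $|u|\to+\infty$. Consider the scalar conservation law $u_t+(f(u))_x=0$, $t>0$, $x\in\mathbb R$, with $u$ valued in $\mathcal I_0$. Fix a strictly convex entropy $\eta\in C^3$ ($\eta''>0$) with entropy flux $q$, $q'=\eta'f'$. For $k\in\mathbb R$ the Kruzkov entropy is $\eta_k(u)=|u-k|$ with flux $q_k(u)=\mathrm{sgn}(u-k)(f(u)-f(k))$. A weak solution $u\in L^\infty(\mathbb R^+\times\mathbb R;\mathcal I_0)$ is $\eta$-entropic (resp. $\eta_k$-entropic) if $(\eta(u))_t+(q(u))_x\le0$ (resp. with $\eta_k,q_k$) in the sense of distributions on $(0,\infty)\times\mathbb R$. The initial value of a weak solution is denoted $u_0=u(0,\cdot)$. ''Dependence on the system'' means dependence on $f,\eta,M$. Relative quantities: $\eta(a|b)=\eta(a)-\eta(b)-\eta'(b)(a-b)$ and $q(a;b)=q(a)-q(b)-\eta'(b)(f(a)-f(b))$. Strong Trace property: $u\in L^\infty(\mathbb R^+\times\mathbb R)$ has it if for every Lipschitz curve $t\mapsto h(t)$ there are bounded functions $u_-,u_+$ of $t$ such that for every $T>0$, $\lim_{n\to\infty}\int_0^T\sup_{y\in(0,1/n)}|u(t,h(t)+y)-u_+(t)|\,dt=\lim_{n\to\infty}\int_0^T\sup_{y\in(-1/n,0)}|u(t,h(t)+y)-u_-(t)|\,dt=0$.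 One writes $u_\pm(t)=u(t,h(t)\pm)$. An Oleinik shock is a pair $(u_L,u_R)$, $u_L\ne u_R$, with $\frac{f(v)-f(u_L)}{v-u_L}\ge\frac{f(u_R)-f(u_L)}{u_R-u_L}$ for all $v$ strictly between $u_L$ and $u_R$. For $u\neq0$, $\phi^\natural(u)$ is the unique $v\ne u$ with $f'(v)=\frac{f(u)-f(v)}{u-v}$; $\phi^\natural(0)=0$. Class of solutions (depending on $\underline b$): $\mathcal S_{\text{weak}}$ is the set of $u\in L^\infty(\mathbb R^+\times\mathbb R;\mathcal I_0)$ that are weak solutions of $u_t+(f(u))_x=0$, are $\eta$-entropic and $\eta_{\phi^\natural(\underline b)}$-entropic, have the Strong Trace property, and whose initial value satisfies $u_0\ge\phi^\natural(\underline b)$. *)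

(* Defs.v *)
From HB Require Import structures.
From mathcomp Require Import all_boot all_order all_algebra.
From mathcomp Require Import all_classical all_reals all_analysis.
From mathcomp Require Import ess_sup_inf.
Set Implicit Arguments.
Unset Strict Implicit.
Unset Printing Implicit Defensive.
Import Order.TTheory GRing.Theory Num.Theory.
Import numFieldNormedType.Exports.
Local Open Scope classical_set_scope.
Local Open Scope ring_scope.

Section Defs.
Context {R : realType}.

Local Notation mu := (@lebesgue_measure R).
Local Notation mu2 := (mu \x mu)%E.

Implicit Types (f eta q : R -> R).

Definition class_C (n : nat) (g : R -> R) : Prop :=
  (forall k, (k < n)%N -> forall x, derivable (derive1n k g) x 1) /\
  continuous (derive1n n g).

Definition concave_convex_flux f : Prop :=
  [/\ class_C 4 f,
      forall u : R, u != 0 -> 0 < u * derive1n 2 f u,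
      derive1n 3 f 0 != 0,
      derive1 f x @[x --> +oo] --> +oo &
      derive1 f x @[x --> -oo] --> +oo].

Definition convex_entropy_pair f eta q : Prop :=
  [/\ class_C 3 eta,
      forall u : R, 0 < derive1n 2 eta u &
      forall u : R, is_derive u 1 q (derive1 eta u * derive1 f u)].

Definition kruzkov_entropy (k u : R) : R := `|u - k|.
Definition kruzkov_flux f (k u : R) : R := Num.sg (u - k) * (f u - f k).

Definition rel_entropy eta (a b : R) : R :=
  eta a - eta b - derive1 eta b * (a - b).
Definition rel_flux f eta q (a b : R) : R :=
  q a - q b - derive1 eta b * (f a - f b).

Definition oleinik_shock f (uL uR : R) : Prop :=
  uL != uR /\
  forall v, Num.min uL uR < v < Num.max uL uR ->
    (f uR - f uL) / (uR - uL) <= (f v - f uL) / (v - uL).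

Definition phi_nat f (u : R) : R :=
  if u == 0 then 0
  else xget 0 [set v | v != u /\ derive1 f v = (f u - f v) / (u - v)].

(* A point of space-time is a pair (t, x). Elements of L^oo are represented
   by total functions that are Borel on the half-plane t > 0; only their values
   there, up to a null set, are ever used. *)
Definition half_plane : set (R * R) := [set p | 0 < p.1].

Definition d_t (phi : R * R -> R) (p : R * R) : R := 'D_((1, 0) : R * R) phi p.
Definition d_x (phi : R * R -> R) (p : R * R) : R := 'D_((0, 1) : R * R) phi p.

(* Every iterated partial derivative is (Frechet) differentiable, hence
   continuous: this is C^oo. *)
Definition smooth (phi : R * R -> R) : Prop :=
  forall (s : seq bool) (p : R * R),
    differentiable (foldr (fun b => if b then d_t else d_x) phi s) p.

Definition test_function (phi : R * R -> R) : Prop :=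
  smooth phi /\
  exists K : set (R * R),
    [/\ compact K, K `<=` half_plane & forall p, ~ K p -> phi p = 0].

(* The pairing of the distribution - (A(u)_t + B(u)_x) with phi. *)
Definition weak_pairing (A B : R -> R) (u phi : R * R -> R) : R :=
  \int[mu2]_(p in half_plane) (A (u p) * d_t phi p + B (u p) * d_x phi p).

Definition weak_solution f (u : R * R -> R) : Prop :=
  forall phi, test_function phi -> weak_pairing id f u phi = 0.

Definition entropic eta q (u : R * R -> R) : Prop :=
  forall phi, test_function phi -> (forall p, 0 <= phi p) ->
    0 <= weak_pairing eta q u phi.

Definition Linfty_valued (M : R) (u : R * R -> R) : Prop :=
  measurable_fun half_plane u /\
  {ae mu2, forall p, half_plane p -> - M <= u p <= M}.

(* u(0, .) = u0 in Kruzkov's sense: ess lim_(t -> 0+) u(t, .) = u0 in L^1_loc *)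
Definition initial_value (u : R * R -> R) (u0 : R -> R) : Prop :=
  measurable_fun setT u0 /\
  forall r e : R, 0 < r -> 0 < e -> exists2 d : R, 0 < d &
    {ae mu, forall t, 0 < t < d ->
      (\int[mu]_(x in `[(- r)%R, r]) (`|u (t, x) - u0 x|)%:E <= e%:E)%E}.

(* ess sup over y in I of |g y|; extending |g| by 0 outside I does not change
   it, since 0 <= |g| and I is not null where this is used. *)
Definition esssup_abs_on (I : set R) (g : R -> R) : \bar R :=
  ess_sup mu ((fun y => (`|g y|)%:E) \_ I).

(* I n is ]0, 1/n[ or ]-1/n, 0[ (with n.+1 for n), and v the candidate trace
   on that side. *)
Definition one_sided_trace (I : nat -> set R) (u : R * R -> R) (t0 : R)
    (h v : R -> R) : Prop :=
  [/\ measurable_fun `[t0, +oo[ v,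
      [bounded v t | t in `[t0, +oo[] &
      forall T : R, t0 < T ->
        (fun n => \int[mu]_(t in `[t0, T])
                    esssup_abs_on (I n) (fun y => u (t, h t + y) - v t)%R)%E
          @ \oo --> 0%E].

(* um t = u(t, h(t)-) and up t = u(t, h(t)+) for t >= t0 *)
Definition strong_traces (u : R * R -> R) (t0 : R) (h um up : R -> R) : Prop :=
  one_sided_trace (fun n => `](- n.+1%:R^-1)%R, 0%R[%classic) u t0 h um /\
  one_sided_trace (fun n => `]0%R, n.+1%:R^-1%R[%classic) u t0 h up.

Definition strong_trace_property (u : R * R -> R) : Prop :=
  forall h : R -> R, [lipschitz h t | t in `[0, +oo[] ->
    exists um up, strong_traces u 0 h um up.

Definition S_weak (M : R) f eta q (blow : R) (u : R * R -> R) : Prop :=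
  [/\ Linfty_valued M u,
      weak_solution f u,
      entropic eta q u /\
      entropic (kruzkov_entropy (phi_nat f blow))
               (kruzkov_flux f (phi_nat f blow)) u,
      strong_trace_property u &
      exists2 u0, initial_value u u0 &
                  {ae mu, forall x, phi_nat f blow <= u0 x}].

End Defs.

(* Main.v *)
(* The path [h] is a Filippov solution of [h' = V (u (t, h))] for the velocity
   [V u = max (- Lam) (f' uL - D(u)^+ / a2)], where
   [D u = a1 eta(u|uL) - a2 eta(u|uR)]. When [a2 / a1] is small, [D] is negative
   only near [uL], so that [V] is [f' uL] close to [uL] and [- Lam], slower than
   all characteristics, away from it. At almost every time the pair of traces
   [(u-, u+)] satisfies the Rankine-Hugoniot relation with speed [h'], and the
   entropy inequality, while [h'] lies between [V u-] and [V u+]; the claim is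
   then an inequality between real numbers. The Kruzkov entropy at [phi_nat b]
   propagates the lower bound [phi_nat b <= u], thanks to which chords of the
   graph of [f] ending to the right of [b] lie above the graph, as if [f] were
   convex.

   Since [u] has no regularity, [h] is built as a limit of polygons, and the
   three properties of [h'] are obtained at Lebesgue points of the traces, by
   testing the equation and the entropy inequality against products of
   one-variable cut-offs concentrated at [(t, h t)]. *)

Require Import Defs.
From mathcomp Require Import all_boot all_order all_algebra.
From mathcomp Require Import all_classical all_reals all_analysis.
From mathcomp Require Import measurable_realfun ess_sup_inf ring lra.
Import Order.TTheory GRing.Theory Num.Theory.
Import numFieldNormedType.Exports.
Local Open Scope classical_set_scope.
Local Open Scope ring_scope.
Set Implicit Arguments.
Unset Strict Implicit.

(** * Concave-convex fluxes and the velocity field *)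

Section RealCalculus.
Context {R : realType}.
Implicit Types (g dg : R -> R).

(** The expression to be signed is affine in the speed. With equal traces it is [V u * D u] minus a
    difference of relative fluxes, so a slower path helps where [D > 0] and not where [D <= 0].
    There the only gain is the dissipation [f'(uL) eta(u|uR) - q(u;uR)], bounded below by a constant
    near [uL] because [f] is uniformly convex on [[b, M]] and [uL - uR >= s0]. This gain carries the
    factor [a2], so every error has to be a small multiple of [a2], although the first term carries
    the large weight [a1]. The way out is that [V > - Lam] bounds [a1 eta(u|uL)] by a constant times
    [a2]: by coercivity [u] is within a radius [d] of [uL], and all errors become [O(a2 d)]. The
    radius depends on [f], [eta], [M], [b] and [s0] only, and [a*] is of order [d^2]. At a jump the
    Filippov inclusion alone leaves an interval of speeds; the Rankine-Hugoniot relation selects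
    one, and the inclusion serves only to bound it and to force one of the two traces to be near
    [uL]. *)

Lemma is_derive_continuous g dg : (forall x : R, is_derive x (1:R) g (dg x)) ->
  continuous g.
Proof.
move=> gd x; apply/differentiable_continuous; rewrite -derivable1_diffP.
by have [] := gd x.
Qed.

Lemma is_derive_within_continuous g dg (A : set R) :
  (forall x : R, is_derive x (1:R) g (dg x)) -> {within A, continuous g}.
Proof. by move=> gd; apply: continuous_subspaceT; exact: is_derive_continuous gd. Qed.

Lemma mean_value g dg (a b : R) : (forall x : R, is_derive x (1:R) g (dg x)) -> a < b ->
  exists2 c, a < c < b & g b - g a = dg c * (b - a).
Proof.
move=> gd ab; have [//|c cab ->] := MVT ab (fun x _ => gd x).
  exact: is_derive_within_continuous gd.
by exists c => //; rewrite in_itv in cab.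
Qed.

Lemma mean_value_ne g dg (a b : R) : (forall x : R, is_derive x (1:R) g (dg x)) -> a != b ->
  exists2 c, Num.min a b < c < Num.max a b & g b - g a = dg c * (b - a).
Proof.
move=> gd; rewrite neq_lt => /orP[ab|ba].
  by rewrite min_l ?max_r ?ltW//; exact: mean_value.
rewrite min_r ?max_l ?ltW//; have [c ? e] := mean_value gd ba; exists c => //.
by lra.
Qed.

Lemma continuous_itv_bounded g (a b : R) : a <= b -> continuous g ->
  exists2 C, 0 < C & forall x, a <= x <= b -> `|g x| <= C.
Proof.
move=> ab cg; have cn : {within `[a, b], continuous (fun x => `|g x|)}.
  by apply: continuous_subspaceT => x; apply: cvg_norm; exact: cg.
have [c _ cmax] := EVT_max ab cn.
exists (`|g c| + 1); first by rewrite ltr_wpDl.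
by move=> x xab; rewrite ler_wpDr// cmax// in_itv.
Qed.

Lemma continuous_itv_lower g (a b : R) : a <= b -> continuous g ->
  (forall x, a <= x <= b -> 0 < g x) ->
  exists2 c, 0 < c & forall x, a <= x <= b -> c <= g x.
Proof.
move=> ab cg g0; have [c cab cmin] := EVT_min ab (continuous_subspaceT cg).
rewrite in_itv /= in cab.
exists (g c); first exact: g0.
by move=> x xab; rewrite cmin// in_itv.
Qed.

End RealCalculus.

Section ConcaveConvex.
Context {R : realType} (f df ddf : R -> R).
Hypothesis f_d : forall x : R, is_derive x (1:R) f (df x).
Hypothesis df_d : forall x : R, is_derive x (1:R) df (ddf x).
Hypothesis ddf_neg : forall x : R, x < 0 -> ddf x < 0.
Hypothesis ddf_pos : forall x : R, 0 < x -> 0 < ddf x.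

Lemma df_incr x y : 0 <= x -> x < y -> df x < df y.
Proof.
move=> x0 xy; have [c cxy e] := mean_value df_d xy.
by have := @ddf_pos c ltac:(lra); nra.
Qed.

Lemma df_decr x y : x < y -> y <= 0 -> df y < df x.
Proof.
move=> xy y0; have [c cxy e] := mean_value df_d xy.
by have := @ddf_neg c ltac:(lra); nra.
Qed.

Lemma df_ndecr x y : 0 <= x -> x <= y -> df x <= df y.
Proof.
by move=> x0; rewrite le_eqVlt => /predU1P[->//|/(df_incr x0)/ltW].
Qed.

Lemma tangent_point_exists (b : R) : 0 < b -> df x @[x --> -oo] --> +oo ->
  exists v, v != b /\ df v = (f b - f v) / (b - v).
Proof.
(* A zero of [G] is a tangency point. [G 0 > 0] by convexity on [[0, b]]; far to the left [f']
   exceeds the slope of the chord from 0 to [b], and then [G <= 0] since [f'] decreases up to 0. *)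
move=> b0 dfoo; pose G v := f b - f v - df v * (b - v).
have Gd x : is_derive x (1:R) G (- ddf x * (b - x)).
  rewrite /G; apply: is_derive_eq => /=.
  by rewrite /GRing.scale /=; ring.
have G0 : 0 < G 0.
  have [c c0b e] := mean_value f_d b0.
  have h := @df_incr 0 c (lexx _) ltac:(lra).
  have ? : 0 < (df c - df 0) * b by apply: mulr_gt0; lra.
  rewrite /G; lra.
have [v v0 Gv] : exists2 v, v < 0 & G v <= 0.
  have : \forall v \near -oo, ((f b - f 0) / b) <= df v.
    by move/cvgryPge : dfoo; apply.
  move=> [A [_ hA]]; pose v := Num.min (A - 1) (-1).
  have v1 : v <= -1 by rewrite /v ge_min lexx orbT.
  have vA : v < A by rewrite /v gt_min; apply/orP; left; lra.
  have := hA _ vA; rewrite ler_pdivrMr// => dfv.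
  have v0 : v < 0 by lra.
  exists v => //.
  have [c cv e] := mean_value f_d v0.
  have h := @df_decr v c ltac:(lra) ltac:(lra).
  have ? : 0 < (df v - df c) * (0 - v) by apply: mulr_gt0; lra.
  rewrite /G; lra.
have [] := @IVT R G v 0 0 (ltW v0) (is_derive_within_continuous Gd).
  by rewrite min_l ?max_r; lra.
move=> w; rewrite in_itv /= => w0 Gw; exists w; split; first by rewrite lt_eqF//; lra.
have : b - w != 0 by rewrite gt_eqF//; lra.
by move=> bw; apply/eqP; rewrite eq_sym -subr_eq0; apply/eqP; move: Gw; rewrite /G => Gw;
  apply: (mulIf bw); rewrite mul0r mulrBl divfK//; lra.
Qed.

Context (b k : R).
Hypothesis b_gt0 : 0 < b.
Hypothesis kb : k != b.
Hypothesis k_tangent : df k * (b - k) = f b - f k.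

(** On the nonnegative half-line [f'] increases strictly, so no chord inside it is tangent to the
    graph at an endpoint. *)
Lemma tangent_point_lt0 : k < 0.
Proof.
rewrite ltNge; apply/negP => k0; have b0 := b_gt0; have kt := k_tangent.
have [c] := mean_value_ne f_d kb; move: kb; rewrite neq_lt => /orP[h|h].
  rewrite min_l ?max_r ?ltW// => ckb e; have dfkc := @df_incr k c k0 ltac:(lra).
  have ? : 0 < (df c - df k) * (b - k) by apply: mulr_gt0; lra.
  lra.
rewrite min_r ?max_l ?ltW// => ckb e; have dfck := @df_incr c k ltac:(lra) ltac:(lra).
have ? : 0 < (df k - df c) * (k - b) by apply: mulr_gt0; lra.
lra.
Qed.

(** The tangent at [k] meets the graph at [b], and beyond [b] the graph is steeper than this line,
    hence above it at [c]: [G k > 0]. Since [G' = - f'' * (c - v)] is positive for [v < 0], [G] is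
    still positive at [a]. *)
Lemma slope_gt_left (a c s : R) : k <= a -> a < 0 -> b < c ->
  s * (c - a) = f c - f a -> df a < s.
Proof.
move=> ka a0 bc es; pose G v := f c - f v - df v * (c - v).
have k0 := tangent_point_lt0; have b0 := b_gt0; have kt := k_tangent.
have Gd x : is_derive x (1:R) G (- ddf x * (c - x)).
  rewrite /G; apply: is_derive_eq => /=.
  by rewrite /GRing.scale /=; ring.
have Gk : 0 < G k.
  have [x xkb e] := mean_value f_d (lt_trans k0 b_gt0).
  have [y ybc e'] := mean_value f_d bc.
  have dx : df x = df k.
    by apply: (@mulIf _ (b - k)); [rewrite subr_eq0 eq_sym|rewrite k_tangent].
  have x0 : 0 < x.
    rewrite ltNge; apply/negP => x0.
    by have := @df_decr k x ltac:(lra) x0; lra.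
  have h := @df_incr x y (ltW x0) ltac:(lra).
  have ? : 0 < (df y - df x) * (c - b) by apply: mulr_gt0; lra.
  rewrite /G; nra.
have Gka : G k <= G a.
  move: ka; rewrite le_eqVlt => /predU1P[->//|ka].
  have [x xka e] := mean_value Gd ka.
  have h := @ddf_neg x ltac:(lra).
  have ? : 0 < (- ddf x) * (c - x) * (a - k) by rewrite !mulr_gt0//; lra.
  lra.
rewrite -(ltr_pM2r (_ : 0 < c - a)); last lra.
by move: Gk Gka; rewrite /G; lra.
Qed.

(* The lower bound [k <= a] on the states is used only through this lemma: the
   chord of the graph from [k] to [b] is tangent at [k]. *)
Lemma chord_above (a c s x : R) : k <= a -> b < c -> a < x < c ->
  s * (c - a) = f c - f a -> f x < f a + s * (x - a).
Proof.
move=> ka bc /andP[ax xc] es; rewrite ltNge; apply/negP => Hx; have b0 := b_gt0.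
(* A point of the graph on or above the chord gives [y < x < z] with [f' z <= s <= f' y]. This
   contradicts the growth of [f'] once [y > 0]; for [a < 0], [slope_gt_left] excludes [y <= 0]
   because [f'] decreases up to 0. *)
have [y yax ey] := mean_value f_d ax.
have [z zxc ez] := mean_value f_d xc.
have sy : s <= df y by nra.
have zs : df z <= s by nra.
have [a0|a0] := leP 0 a.
  have := @df_incr y z ltac:(lra) ltac:(lra); lra.
have sa := slope_gt_left ka a0 bc es.
have y0 : 0 < y.
  by rewrite ltNge; apply/negP => y0; have := @df_decr a y ltac:(lra) y0; lra.
have := @df_incr y z ltac:(lra) ltac:(lra); lra.
Qed.

End ConcaveConvex.

(** * Signs and quantitative bounds for relative entropies and fluxes *)

Section RelativeEntropy.
Context {R : realType} (f df ddf eta e1 e2 q : R -> R).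
Hypothesis f_d : forall x : R, is_derive x (1:R) f (df x).
Hypothesis eta_d : forall x : R, is_derive x (1:R) eta (e1 x).
Hypothesis e1_d : forall x : R, is_derive x (1:R) e1 (e2 x).
Hypothesis q_d : forall x : R, is_derive x (1:R) q (e1 x * df x).
Hypothesis e2_pos : forall x : R, 0 < e2 x.

(** [rel_entropy] and [rel_flux] with the derivative of [eta] as a parameter, so that the calculus
    below sees only [is_derive] hypotheses. For [e1 := derive1 eta] the two versions are
    convertible. *)
Definition relative_entropy (a b : R) : R := eta a - eta b - e1 b * (a - b).
Definition relative_flux (a b : R) : R := q a - q b - e1 b * (f a - f b).

Lemma e1_incr (x y : R) : x < y -> e1 x < e1 y.
Proof.
move=> xy; have [c cxy e] := mean_value e1_d xy.
have ? : 0 < e2 c * (y - x) by rewrite mulr_gt0 ?e2_pos//; lra.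
lra.
Qed.

(** Taylor's formula of order two, obtained from two mean value steps: the derivative of [F c] at
    [x] is [(e2 y - c) * (x - b)] for some [y] between [b] and [x]. *)
Lemma relative_entropy_bounds (ce Ce a b M : R) :
  (forall x, - M <= x <= M -> ce <= e2 x <= Ce) ->
  - M <= a <= M -> - M <= b <= M ->
  ce / 2 * (a - b) ^+ 2 <= relative_entropy a b <= Ce / 2 * (a - b) ^+ 2.
Proof.
move=> e2b aM bM; have [->|ab] := eqVneq a b.
  by rewrite /relative_entropy; lra.
pose F c x := relative_entropy x b - c / 2 * (x - b) ^+ 2.
have Fd c x : is_derive x (1:R) (F c) (e1 x - e1 b - c * (x - b)).
  rewrite /F /relative_entropy; apply: is_derive_eq => /=.
  by rewrite /GRing.scale /=; field.
have key c : (F c a - F c b) = relative_entropy a b - c / 2 * (a - b) ^+ 2.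
  by rewrite /F /relative_entropy; field.
have loc (x c : R) : Num.min b a < x < Num.max b a ->
    exists2 y, - M <= y <= M &
      (e1 x - e1 b - c * (x - b)) * (a - b) = (e2 y - c) * ((x - b) * (a - b)) /\
      0 <= (x - b) * (a - b).
  move=> xab; have xb : b != x.
    by apply/negP => /eqP bx; move: xab; rewrite bx gt_min lt_max !ltxx /=; lra.
  have [y yxb e] := mean_value_ne e1_d xb.
  have : 0 <= (x - b) * (a - b) /\ - M <= y <= M.
    move: ab yxb xab; rewrite neq_lt => /orP[h|h].
      rewrite (min_r (ltW h)) (max_l (ltW h)) => + /andP[h1 h2].
      rewrite (min_r (ltW h2)) (max_l (ltW h2)) => yy; split; last by lra.
      by rewrite -mulrNN mulr_ge0//; lra.
    rewrite (min_l (ltW h)) (max_r (ltW h)) => + /andP[h1 h2].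
    rewrite (min_l (ltW h1)) (max_r (ltW h1)) => yy; split; last by lra.
    by rewrite mulr_ge0//; lra.
  by move=> [h1 h2]; exists y => //; split => //; rewrite e; ring.
have ba : b != a by rewrite eq_sym.
apply/andP; split; rewrite -subr_ge0.
  rewrite -key; have [x xab ->] := mean_value_ne (Fd ce) ba.
  have [y /e2b/andP[h _] [-> h']] := loc x ce xab.
  by rewrite mulr_ge0// subr_ge0.
rewrite -opprB -key; have [x xab ->] := mean_value_ne (Fd Ce) ba.
have [y /e2b/andP[_ h] [-> h']] := loc x Ce xab.
by rewrite -mulNr mulr_ge0// opprB subr_ge0.
Qed.

(** The derivative in [a] of the left-hand side is [(e1 a - e1 b) * (f' a - s)] and [e1] is
    increasing, so the sign is decided by comparing [s] with a characteristic speed between [a] and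
    [b]. *)
Lemma relative_flux_mean_value (s a b : R) : a != b ->
  exists2 x, Num.min b a < x < Num.max b a &
    exists2 r, 0 <= r & relative_flux a b - s * relative_entropy a b = r * (df x - s).
Proof.
move=> ab; pose F x := relative_flux x b - s * relative_entropy x b.
have Fd x : is_derive x (1:R) F ((e1 x - e1 b) * (df x - s)).
  rewrite /F /relative_flux /relative_entropy; apply: is_derive_eq => /=.
  by rewrite /GRing.scale /=; ring.
have key : F a - F b = relative_flux a b - s * relative_entropy a b by rewrite /F /relative_entropy /relative_flux; ring.
have ba : b != a by rewrite eq_sym.
rewrite -key; have [x xab ->] := mean_value_ne Fd ba.
exists x => //; exists ((e1 x - e1 b) * (a - b)); last by ring.
move: ba xab; rewrite neq_lt => /orP[h|h].
  rewrite (min_l (ltW h)) (max_r (ltW h)) => /andP[h1 h2].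
  by have ? := e1_incr h1; rewrite mulr_ge0//; lra.
rewrite (min_r (ltW h)) (max_l (ltW h)) => /andP[h1 h2].
by have ? := e1_incr h2; rewrite -mulrNN mulr_ge0//; lra.
Qed.

Lemma relative_entropy_ge0 (a b : R) : 0 <= relative_entropy a b.
Proof.
have [->|ab] := eqVneq a b; first by rewrite /relative_entropy; lra.
pose F x := relative_entropy x b.
have Fd x : is_derive x (1:R) F (e1 x - e1 b).
  rewrite /F /relative_entropy; apply: is_derive_eq => /=.
  by rewrite /GRing.scale /=; ring.
have key : F a - F b = relative_entropy a b by rewrite /F /relative_entropy; ring.
have ba : b != a by rewrite eq_sym.
rewrite -key; have [x xab ->] := mean_value_ne Fd ba.
move: ba xab; rewrite neq_lt => /orP[h|h].
  rewrite (min_l (ltW h)) (max_r (ltW h)) => /andP[h1 h2].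
  by have ? := e1_incr h1; rewrite mulr_ge0//; lra.
rewrite (min_r (ltW h)) (max_l (ltW h)) => /andP[h1 h2].
by have ? := e1_incr h2; rewrite -mulrNN mulr_ge0//; lra.
Qed.

Lemma relative_flux_le (s a b : R) :
  (forall x, Num.min b a < x < Num.max b a -> df x <= s) ->
  relative_flux a b <= s * relative_entropy a b.
Proof.
move=> h; have [->|ab] := eqVneq a b; first by rewrite /relative_entropy /relative_flux; lra.
have [x /h dfx [r r0 e]] := relative_flux_mean_value s ab.
have ? : 0 <= r * (s - df x) by rewrite mulr_ge0//; lra.
lra.
Qed.

Lemma relative_flux_ge (s a b : R) :
  (forall x, Num.min b a < x < Num.max b a -> s <= df x) ->
  s * relative_entropy a b <= relative_flux a b.
Proof.
move=> h; have [->|ab] := eqVneq a b; first by rewrite /relative_entropy /relative_flux; lra.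
have [x /h dfx [r r0 e]] := relative_flux_mean_value s ab.
have ? : 0 <= r * (df x - s) by rewrite mulr_ge0//; lra.
lra.
Qed.

(* The constant [27] comes from restricting to the middle third of [[v, p]]. *)
Lemma dissipation_gap (ce cf v p s : R) : 0 <= ce -> 0 <= cf ->
  (forall x, v <= x <= p -> ce <= e2 x) ->
  (forall x y, v <= x -> x <= y -> y <= p -> cf * (y - x) <= df y - df x) ->
  v <= p -> df p <= s ->
  ce * cf * (p - v) ^+ 3 / 27 <= s * relative_entropy p v - relative_flux p v.
Proof.
move=> ce0 cf0 e2b dfb; rewrite le_eqVlt => /predU1P[->|vp] dps.
  by rewrite /relative_entropy /relative_flux; lra.
pose d := (p - v) / 3; have d0 : 0 < d by rewrite /d; lra.
pose F x := s * relative_entropy x v - relative_flux x v.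
have Fd x : is_derive x (1:R) F ((e1 x - e1 v) * (s - df x)).
  rewrite /F /relative_flux /relative_entropy; apply: is_derive_eq => /=.
  by rewrite /GRing.scale /=; ring.
have Fv : F v = 0 by rewrite /F /relative_entropy /relative_flux; ring.
have e1b (x : R) : v < x -> x <= p -> ce * (x - v) <= e1 x - e1 v.
  move=> vx xp; have [c cvx ->] := mean_value e1_d vx.
  by rewrite ler_wpM2r ?e2b//; lra.
have mono (x y : R) : v <= x -> x < y -> y <= p -> F x <= F y.
  move=> vx xy yp; rewrite -subr_ge0; have [c cxy ->] := mean_value Fd xy.
  have h1 := e1b c ltac:(lra) ltac:(lra).
  have h2 := dfb c p ltac:(lra) ltac:(lra) (lexx _).
  rewrite !mulr_ge0//; last lra.
    by apply: le_trans h1; rewrite mulr_ge0//; lra.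
  have : 0 <= cf * (p - c) by rewrite mulr_ge0//; lra.
  lra.
have m1 := mono v (v + d) (lexx _) ltac:(rewrite /d; lra) ltac:(rewrite /d; lra).
have m2 := mono (v + 2 * d) p ltac:(rewrite /d; lra) ltac:(rewrite /d; lra) (lexx _).
have [c cd e] := mean_value Fd (ltac:(lra) : v + d < v + 2 * d).
have h1 := e1b c ltac:(lra) ltac:(rewrite /d in cd *; lra).
have h2 := dfb c p ltac:(lra) ltac:(rewrite /d in cd *; lra) (lexx _).
have h3 : ce * d <= e1 c - e1 v.
  by apply: le_trans h1; rewrite ler_wpM2l//; lra.
have h4 : cf * d <= s - df c.
  have : cf * d <= cf * (p - c) by rewrite ler_wpM2l//; rewrite /d in cd *; lra.
  lra.
have h5 : ce * d * (cf * d) * d <= (e1 c - e1 v) * (s - df c) * (v + 2 * d - (v + d)).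
  rewrite (_ : v + 2 * d - (v + d) = d); last by ring.
  have d0' := ltW d0; apply: ler_wpM2r => //.
  by apply: ler_pM => //; rewrite mulr_ge0.
have -> : ce * cf * (p - v) ^+ 3 / 27 = ce * d * (cf * d) * d by rewrite /d; field.
rewrite -/(F p); lra.
Qed.

(* The left-hand side is an increment of [q - s eta - e1 (f - l)], where [l] is
   the chord through [a] and [c]; its derivative is [- e2 (f - l)]. *)
Lemma entropy_chord (a c s v : R) : s * (c - a) = f c - f a -> a != v ->
  exists2 x, Num.min a v < x < Num.max a v &
  (q v - s * eta v - e1 v * (f v - f a - s * (v - a))) - (q a - s * eta a)
    = - e2 x * (f x - f a - s * (x - a)) * (v - a).
Proof.
move=> es av.
pose Phi x := q x - s * eta x - e1 x * (f x - f a - s * (x - a)).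
have Phid x : is_derive x (1:R) Phi (- e2 x * (f x - f a - s * (x - a))).
  rewrite /Phi; apply: is_derive_eq => /=.
  by rewrite /GRing.scale /=; ring.
have [x xav e] := mean_value_ne Phid av; exists x => //.
by rewrite -e /Phi; ring.
Qed.

End RelativeEntropy.

Section RealOrder.
Context {R : realType}.
Implicit Types x y z : R.

Lemma between_itv lo hi x y z : lo <= x <= hi -> lo <= y <= hi ->
  Num.min y x < z < Num.max y x -> lo <= z <= hi.
Proof.
move=> hx hy; rewrite gt_min lt_max.
by move=> /andP[/orP[h|h] /orP[h'|h']]; lra.
Qed.

Lemma ler_dist_maxr x y z : `|Num.max x y - Num.max x z| <= `|y - z|.
Proof.
wlog yz : y z / y <= z.
  have [yz|/ltW yz] := leP y z; first exact.
  by rewrite distrC (distrC y); exact.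
rewrite distrC (distrC y) !ger0_norm ?subr_ge0//; last first.
  by rewrite ge_max !le_max lexx /= yz orbT.
have h1 : x <= Num.max x y by rewrite le_max lexx.
have h2 : y <= Num.max x y by rewrite le_max lexx orbT.
by rewrite lerBlDr ge_max; apply/andP; split; lra.
Qed.

Lemma ler_dist_minr x y z : `|Num.min x y - Num.min x z| <= `|y - z|.
Proof.
have minE (u v : R) : Num.min u v = - Num.max (- u) (- v) by rewrite oppr_max !opprK.
rewrite !minE opprK addrC; apply: le_trans (ler_dist_maxr _ _ _) _.
by rewrite opprK addrC.
Qed.

Definition clip (M x : R) : R := Num.max (- M) (Num.min M x).

Lemma clip_itv M x : 0 <= M -> - M <= clip M x <= M.
Proof.
by move=> M0; rewrite /clip le_max lexx ge_max ge_min lexx /=; lra.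
Qed.

Lemma clip_id M x : - M <= x <= M -> clip M x = x.
Proof. by move=> /andP[h1 h2]; rewrite /clip min_r// max_r. Qed.

Lemma clip_dist M x y : `|clip M x - clip M y| <= `|x - y|.
Proof. exact: le_trans (ler_dist_maxr _ _ _) (ler_dist_minr _ _ _). Qed.

End RealOrder.

(** * Sign of the dissipation along the velocity field *)

Section VelocityField.
Context {R : realType} (f df ddf eta e1 e2 q : R -> R).
Local Notation relE := (relative_entropy eta e1).
Local Notation relQ := (relative_flux f e1 q).
Hypothesis f_d : forall x : R, is_derive x (1:R) f (df x).
Hypothesis df_d : forall x : R, is_derive x (1:R) df (ddf x).
Hypothesis ddf_neg : forall x : R, x < 0 -> ddf x < 0.
Hypothesis ddf_pos : forall x : R, 0 < x -> 0 < ddf x.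
Hypothesis eta_d : forall x : R, is_derive x (1:R) eta (e1 x).
Hypothesis e1_d : forall x : R, is_derive x (1:R) e1 (e2 x).
Hypothesis e2_pos : forall x : R, 0 < e2 x.
Hypothesis q_d : forall x : R, is_derive x (1:R) q (e1 x * df x).

Context (M b k : R).
Hypothesis M0 : 0 < M.
Hypothesis b0 : 0 < b.
Hypothesis kb : k != b.
Hypothesis ktan : df k * (b - k) = f b - f k.

Context (L Cf cf Ce ce : R).
Hypothesis L0 : 0 < L.
Hypothesis Cf0 : 0 < Cf.
Hypothesis cf0 : 0 < cf.
Hypothesis Ce0 : 0 < Ce.
Hypothesis ce0 : 0 < ce.
Hypothesis dfL : forall x, - M <= x <= M -> - L <= df x <= L.
Hypothesis ddfCf : forall x, - M <= x <= M -> - Cf <= ddf x <= Cf.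
Hypothesis ddfcf : forall x, b <= x <= M -> cf <= ddf x.
Hypothesis e2C : forall x, - M <= x <= M -> ce <= e2 x <= Ce.

Let dfLip (x y : R) : - M <= x -> x <= y -> y <= M ->
  - (Cf * (y - x)) <= df y - df x <= Cf * (y - x).
Proof.
move=> Mx; rewrite le_eqVlt => /predU1P[->|xy] yM; first by lra.
have [c cxy ->] := mean_value df_d xy.
have /andP[h1 h2] := ddfCf (ltac:(lra) : - M <= c <= M).
have xy' : 0 <= y - x by lra.
by rewrite -mulNr !ler_wpM2r.
Qed.

Let dfInc (x y : R) : b <= x -> x <= y -> y <= M -> cf * (y - x) <= df y - df x.
Proof.
move=> bx; rewrite le_eqVlt => /predU1P[->|xy] yM; first by lra.
have [c cxy ->] := mean_value df_d xy.
by have ? := ddfcf (ltac:(lra) : b <= c <= M); rewrite ler_wpM2r//; lra.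
Qed.

Let e1Lip (x y : R) : - M <= x <= M -> - M <= y <= M ->
  `|e1 x - e1 y| <= Ce * (2 * M).
Proof.
have M0' := M0; have Ce0' := Ce0.
move=> xM yM; have [->|xy] := eqVneq y x.
  by rewrite subrr normr0 !mulr_ge0//; lra.
have [c cxy ->] := mean_value_ne e1_d xy; rewrite normrM ler_pM//.
  have /andP[h1 h2] := e2C (between_itv xM yM cxy).
  by rewrite ger0_norm//; apply: le_trans h1; exact: ltW.
by rewrite ler_norml; lra.
Qed.

(** [Ch] bounds the relative entropy on [[- M, M]]; [Lam] is such that [(Lam - L)^2 >= 2 * L * Ch];
    [a2 * C] will bound [a1 * relE u uL] where [velocity u > - Lam]; [c1] is the dissipation
    guaranteed at distance [s0 / 2] above [uR], and [K] a Lipschitz constant for it. The radius [d]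
    keeps the neighbourhood of [uL] away from [uR] ([ds0]), the errors below [c1] ([dc1]), and makes
    [slope_far] true ([dcf]). *)
Context (Ch Lam C c1 K s0 d : R).
Hypothesis ChE : Ch = 2 * Ce * M ^+ 2.
Hypothesis LamE : Lam = L + 1 + 2 * (L * Ch).
Hypothesis CE : C = Ch + Lam + L.
Hypothesis c1E : c1 = ce * cf * (s0 / 2) ^+ 3 / 27.
Hypothesis KE : K = 2 * L * (Ce * (2 * M)).
Hypothesis s00 : 0 < s0.
Hypothesis d0 : 0 < d.
Hypothesis ds0 : d <= s0 / 4.
Hypothesis dc1 : (K + 2 * (Cf * C)) * d <= c1.
Hypothesis dcf : 32 * Cf * d <= cf * s0.

Let Ch0 : 0 < Ch. Proof. by rewrite ChE !mulr_gt0// exprn_gt0. Qed.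
Let LCh0 : 0 < L * Ch. Proof. exact: mulr_gt0. Qed.
Let LLam : L < Lam. Proof. by have h := LCh0; rewrite LamE; lra. Qed.
Let C0 : 0 < C.
Proof. by have h1 := Ch0; have h2 := L0; have h3 := LLam; rewrite CE; lra. Qed.
Let K0 : 0 < K. Proof. by rewrite KE !mulr_gt0. Qed.
Let relECh (x y : R) : - M <= x <= M -> - M <= y <= M -> relE x y <= Ch.
Proof.
move=> xM yM; have /andP[_ h] := relative_entropy_bounds eta_d e1_d e2C xM yM.
apply: le_trans h _; rewrite ChE (_ : 2 * Ce * M ^+ 2 = Ce / 2 * (2 * M) ^+ 2); last by field.
have ? : 0 <= (2 * M - (x - y)) * (2 * M + (x - y)) by rewrite mulr_ge0//; lra.
by rewrite ler_pM2l ?divr_gt0//; lra.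
Qed.

Let gap (v p s : R) : b <= v -> v <= p -> p <= M -> df p <= s ->
  ce * cf * (p - v) ^+ 3 / 27 <= s * relE p v - relQ p v.
Proof.
move=> bv vp pM dps.
have b0' := b0; have M0' := M0.
apply: (dissipation_gap f_d eta_d e1_d q_d) => //; try exact: ltW.
- by move=> x ?; have /andP[] : ce <= e2 x <= Ce by apply: e2C; lra.
- by move=> x y ? ? ?; apply: dfInc => //; lra.
Qed.

Let cube (x : R) : s0 / 2 <= x -> c1 <= ce * cf * x ^+ 3 / 27.
Proof.
move=> sx; have s0' := s00.
rewrite c1E ler_pM2r// ler_pM2l ?mulr_gt0// ler_pXn2r ?nnegrE//; lra.
Qed.

Let gap0 (v p s : R) : b <= v -> v <= p -> p <= M -> df p <= s ->
  relQ p v <= s * relE p v.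
Proof.
move=> bv vp pM dps; rewrite -subr_ge0.
apply: le_trans (gap bv vp pM dps).
by rewrite divr_ge0 ?mulr_ge0 ?exprn_ge0 ?(ltW ce0) ?(ltW cf0)//; lra.
Qed.

Context (a1 a2 uL uR : R).
Hypothesis a10 : 0 < a1.
Hypothesis a20 : 0 < a2.
Hypothesis a12d : a2 * (2 * C / ce) <= a1 * d ^+ 2.
Hypothesis buR : b <= uR.
Hypothesis uRL : uR + s0 <= uL.
Hypothesis uLM : uL <= M.

Let uLI : - M <= uL <= M.
Proof.
have h1 := b0; have h2 := buR; have h3 := uRL; have h4 := s00; have h5 := uLM.
lra.
Qed.

Let uRI : - M <= uR <= M.
Proof.
have h1 := b0; have h2 := buR; have h3 := uRL; have h4 := s00; have h5 := uLM.
lra.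
Qed.

Let D u := a1 * relE u uL - a2 * relE u uR.

(* Equal to [df uL] where [D <= 0], which for small [a2 / a1] forces [u] near
   [uL], and to [- Lam], slower than every characteristic, far from [uL]. *)
Definition velocity u := Num.max (- Lam) (df uL - Num.max 0 (D u) / a2).

Let V_lo u : - Lam <= velocity u. Proof. by rewrite /velocity le_max lexx. Qed.

Let V_hi u : velocity u <= df uL.
Proof.
rewrite /velocity ge_max; apply/andP; split.
  have h1 := LLam; have h2 := dfL uLI; lra.
by rewrite gerBl divr_ge0 ?le_max ?lexx// ltW.
Qed.

Lemma velocity_bounded u : `|velocity u| <= Lam.
Proof.
have h1 := LLam; have h2 := dfL uLI; have h3 := V_hi u; have h4 := V_lo u.
rewrite ler_norml; lra.
Qed.

(** The constant depends on [a1 / a2], which is harmless because it is used only qualitatively; the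
    bound [Lam] is the one that must be uniform. *)
Lemma velocity_lipschitz x y : - M <= x <= M -> - M <= y <= M ->
  `|velocity x - velocity y| <= (a1 + a2) * (Ce * (2 * M)) / a2 * `|x - y|.
Proof.
move=> xM yM; apply: (le_trans (ler_dist_maxr _ _ _)).
have -> : df uL - Num.max 0 (D x) / a2 - (df uL - Num.max 0 (D y) / a2)
   = (Num.max 0 (D y) - Num.max 0 (D x)) / a2 by field; rewrite gt_eqF.
rewrite normrM (ger0_norm (_ : 0 <= a2^-1)) ?invr_ge0 ?(ltW a20)//.
rewrite mulrAC ler_wpM2r ?invr_ge0 ?(ltW a20)//.
rewrite distrC; apply: (le_trans (ler_dist_maxr _ _ _)).
have [->|xy] := eqVneq y x; first by rewrite !subrr normr0 mulr0.
have Dd z : is_derive z (1:R) D (a1 * (e1 z - e1 uL) - a2 * (e1 z - e1 uR)).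
  rewrite /D /relative_entropy; apply: is_derive_eq => /=.
  by rewrite /GRing.scale /=; ring.
have [z zxy ->] := mean_value_ne Dd xy; rewrite normrM ler_wpM2r//.
have zM := between_itv xM yM zxy.
apply: (le_trans (ler_normB _ _)).
rewrite !normrM (gtr0_norm a10) (gtr0_norm a20) mulrDl.
by apply: lerD; rewrite ler_pM2l// e1Lip.
Qed.

(** [velocity u > - Lam] means that [D u < a2 * (Lam + f' uL)]. Adding [a2 * relE u uR <= a2 * Ch]
    gives the first bound, and the quadratic lower bound on the relative entropy turns it into
    [|u - uL| <= d] through [a12d]. *)
Let near_uL u : - M <= u <= M -> - Lam < velocity u ->
  [/\ a1 * relE u uL <= a2 * C, uL - d <= u <= uL + d
    & velocity u = df uL - Num.max 0 (D u) / a2].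
Proof.
move=> uM; rewrite /velocity lt_max ltxx /= => h.
have hE : a1 * relE u uL <= a2 * C.
  have h1 : Num.max 0 (D u) / a2 <= Lam + L by have h1 := dfL uLI; lra.
  move: h1; rewrite ler_pdivrMr// ge_max => /andP[_]; rewrite /D => h1.
  have h2 : a2 * relE u uR <= a2 * Ch by rewrite ler_pM2l// relECh.
  by rewrite CE; lra.
split => //; last by rewrite max_r// ltW.
have /andP[h1 _] := relative_entropy_bounds eta_d e1_d e2C uM uLI.
have h2 : a1 * (ce / 2 * (u - uL) ^+ 2) <= a2 * C.
  by apply: le_trans hE; rewrite ler_pM2l.
have h3 : a1 * (u - uL) ^+ 2 <= a1 * d ^+ 2.
  apply: le_trans a12d.
  have -> : a2 * (2 * C / ce) = 2 * (a2 * C) / ce by field; rewrite gt_eqF.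
  by rewrite ler_pdivlMr//; lra.
rewrite ler_pM2l// in h3.
have h4 : `|u - uL| <= `|d| by rewrite -ler_sqr ?nnegrE// !real_normK ?num_real.
by move: h4; rewrite (gtr0_norm d0) ler_norml; lra.
Qed.

Let near_df u x : - M <= u <= M -> uL - d <= u <= uL + d ->
  Num.min uL u < x < Num.max uL u -> df uL - Cf * d <= df x.
Proof.
move=> uM ud xu; have d0' := d0; have uLI' := uLI.
have xd : uL - d <= x <= uL + d.
  by apply: between_itv xu => //; lra.
have xM := between_itv uM uLI xu.
have hd : 0 <= Cf * d by rewrite mulr_ge0// ltW.
have [h|/ltW h] := leP x uL.
  have h1 := dfLip (ltac:(lra) : - M <= x) h uLM.
  have h2 : Cf * (uL - x) <= Cf * d by rewrite ler_pM2l//; lra.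
  lra.
have h1 : cf * (x - uL) <= df x - df uL.
  by apply: dfInc => //; have s0' := s00; have h1 := uRL; have h2 := buR; lra.
have h2 : 0 <= cf * (x - uL) by rewrite mulr_ge0 ?(ltW cf0)// subr_ge0.
lra.
Qed.

(** At [u = uL] the gap is at least [c1] because [uL - uR >= s0]; over a distance [d] it changes by
    at most [K * d]. *)
Let near_dissipation u : - M <= u <= M -> uL - d <= u <= uL + d ->
  c1 - K * d <= df uL * relE u uR - relQ u uR.
Proof.
move=> uM ud.
pose H x := df uL * relE x uR - relQ x uR.
have Hd x : is_derive x (1:R) H ((e1 x - e1 uR) * (df uL - df x)).
  rewrite /H /relative_flux /relative_entropy; apply: is_derive_eq => /=.
  by rewrite /GRing.scale /=; ring.
have HuL : c1 <= H uL.
  have h1 := s00; have h2 := uRL.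
  apply: le_trans (gap buR _ uLM (lexx _)); last by lra.
  by apply: cube; lra.
have h : `|H u - H uL| <= K * d.
  have [->|pu] := eqVneq u uL; first by rewrite subrr normr0 mulr_ge0// ltW.
  rewrite eq_sym in pu.
  have [x xp ->] := mean_value_ne Hd pu; rewrite normrM KE.
  have xM := between_itv uM uLI xp.
  rewrite ler_pM//; last by rewrite ler_norml; lra.
  rewrite normrM [2 * L * _]mulrC ler_pM ?e1Lip//.
  by rewrite ler_norml; have h1 := dfL uLI; have h2 := dfL xM; lra.
by move: h HuL; rewrite ler_norml /H; lra.
Qed.

Lemma velocity_dissipation u : - M <= u <= M ->
  a1 * (velocity u * relE u uL - relQ u uL) -
  a2 * (velocity u * relE u uR - relQ u uR) <= 0.
Proof.
move=> uM.
have ca2 (x y : R) : x <= y -> a2 * x <= a2 * y by move=> ?; rewrite ler_pM2l.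
have ca1 (x y : R) : x <= y -> a1 * x <= a1 * y by move=> ?; rewrite ler_pM2l.
have DE : D u = a1 * relE u uL - a2 * relE u uR by [].
have E'Ch : relE u uR <= Ch by exact: relECh uRI.
(* At the floor [- Lam], replacing both fluxes by [L] times the entropies leaves [- (Lam - L) * D u
   + 2 * L * a2 * relE u uR], while [D u >= a2 * (Lam - L)]: this is where
   [(Lam - L)^2 >= 2 * L * Ch] is needed. *)
have [Vlo|Vhi] := leP (velocity u) (- Lam).
  have -> : velocity u = - Lam by have h := V_lo u; lra.
  have LL := LLam.
  have hD : a2 * (Lam - L) <= D u.
    move: Vlo; rewrite /velocity ge_max => /andP[_] h.
    have h' : Lam - L <= Num.max 0 (D u) / a2 by have h1 := dfL uLI; lra.
    move: h'; rewrite ler_pdivlMr// mulrC le_max => /orP[h'|//].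
    have h1 : 0 < a2 * (Lam - L) by rewrite mulr_gt0//; lra.
    lra.
  have hQ : - L * relE u uL <= relQ u uL.
    apply: (relative_flux_ge f_d eta_d e1_d q_d e2_pos) => x xp.
    by have /andP[] := dfL (between_itv uM uLI xp).
  have hQ' : relQ u uR <= L * relE u uR.
    apply: (relative_flux_le f_d eta_d e1_d q_d e2_pos) => x xp.
    by have /andP[] := dfL (between_itv uM uRI xp).
  have h3 : (Lam - L) * (a2 * (Lam - L)) <= (Lam - L) * D u by rewrite ler_wpM2l//; lra.
  have h4 : a2 * (L * relE u uR) <= a2 * (L * Ch) by rewrite ler_pM2l// ler_pM2l.
  have h5 : a2 * (2 * L * Ch) <= a2 * ((Lam - L) * (Lam - L)).
    rewrite ler_pM2l// (_ : Lam - L = 1 + 2 * (L * Ch)); last by rewrite LamE; ring.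
    have h0 := LCh0.
    have ? : 0 <= (L * Ch) * (L * Ch) by rewrite mulr_ge0// ltW.
    lra.
  move: (ca1 _ _ hQ) (ca2 _ _ hQ') h3 h4 h5; rewrite DE; lra.
(* Since [W * D u <= f' uL * D u], the speed may be replaced by [f' uL]. The [uL] term then costs at
   most [Cf * d * (a2 * C)] and the [uR] term gains [a2 * (c1 - K * d)]; [dc1] compares the two. *)
have [hE pd ->] := near_uL uM Vhi.
set W := df uL - _.
have hW : W * D u <= df uL * D u.
  rewrite /W; have [D0|D0] := leP (D u) 0; first by rewrite mul0r subr0.
  have ? : 0 <= D u / a2 * D u by rewrite mulr_ge0 ?divr_ge0// ltW.
  lra.
have hQ : (df uL - Cf * d) * relE u uL <= relQ u uL.
  by apply: (relative_flux_ge f_d eta_d e1_d q_d e2_pos) => x; exact: near_df.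
have h1 := ca1 _ _ hQ; have h2 := ca2 _ _ (near_dissipation uM pd); have h3 := ca2 _ _ dc1.
have h4 : Cf * d * (a1 * relE u uL) <= Cf * d * (a2 * C).
  by rewrite ler_wpM2l// mulr_ge0// ltW.
have h5 : 0 <= a2 * (Cf * C * d) by rewrite !mulr_ge0// ltW.
rewrite DE in hW; move: h1 h2 h3 h4 h5 hW; lra.
Qed.

Let chord (x y s z : R) := @chord_above R f df ddf f_d df_d ddf_neg ddf_pos b k b0 kb ktan x y s z.

(** A chord above the graph is less steep than the graph at its right end. For negative [p] the
    comparison starts from 0, where the graph is still below the chord and from which [f']
    increases. *)
Let slope_bounds (p m s : R) : k <= p -> p < m -> b < m ->
  s * (m - p) = f m - f p -> s <= df m /\ (0 <= p -> df p <= s).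
Proof.
move=> kp pm bm es; split; last first.
  move=> p0'; have [x xpm e] := mean_value f_d pm.
  have -> : s = df x by apply: (@mulIf _ (m - p)); [rewrite gt_eqF//; lra|rewrite es].
  by apply: (df_ndecr df_d ddf_pos) => //; lra.
pose x := Num.max p 0; have b0' := b0.
have px : p <= x by rewrite /x le_max lexx.
have x0 : 0 <= x by rewrite /x le_max lexx orbT.
have xm : x < m by rewrite /x gt_max pm; lra.
have h : f x <= f p + s * (x - p).
  move: px; rewrite le_eqVlt => /predU1P[<-|px]; first by lra.
  by apply/ltW/(chord kp bm) => //; rewrite px.
have [y yxm e] := mean_value f_d xm.
have h1 : df y <= df m by apply: (df_ndecr df_d ddf_pos) => //; lra.
have h2 : s * (m - x) <= df y * (m - x) by lra.
by rewrite ler_pM2r in h2; lra.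
Qed.

Let near_df_le (m : R) : - M <= m <= M -> uL - d <= m <= uL + d ->
  df m <= df uL + Cf * d.
Proof.
move=> mM md; have hd : 0 <= Cf * d by rewrite mulr_ge0// ltW.
have s0' := s00; have ds0' := ds0; have buR' := buR; have uRL' := uRL.
have [mu|/ltW mu] := leP m uL.
  have h1 := dfInc (ltac:(lra) : b <= m) mu uLM.
  have h2 : 0 <= cf * (uL - m) by rewrite mulr_ge0 ?(ltW cf0)// subr_ge0.
  lra.
have uLI' := uLI.
have h1 := dfLip (ltac:(lra) : - M <= uL) mu (ltac:(lra) : m <= M).
have h2 : Cf * (m - uL) <= Cf * d by rewrite ler_pM2l//; lra.
lra.
Qed.

(** If [p <= y = uL - s0 / 2], the chord bounds [f y] from above, so the mean slope over [[y, m]] is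
    at least [s], which is close to [f' uL]. But on [[y, z]], of length [s0 / 4], uniform convexity
    keeps [f'] below [f' uL] by [cf * s0 / 4]: a loss of [cf * s0^2 / 16] against errors of at most
    [Cf * d * (5 / 4) * s0], which [dcf] rules out. *)
Let slope_far (m p s : R) : - M <= m <= M -> uL - d <= m <= uL + d ->
  k <= p -> p < m -> s * (m - p) = f m - f p -> df uL - Cf * d < s ->
  uL - s0 / 2 < p.
Proof.
move=> mM md kp pm es sl; have dfm := near_df_le mM md.
rewrite ltNge; apply/negP => py; pose y := uL - s0 / 2; pose z := uL - s0 / 4.
have ez : z = y + s0 / 4 by rewrite /z /y; lra.
have [y0 bz bm ym zm] : [/\ 0 <= y, b <= z <= uL, b < m, y < m & z <= m].
  have s0' := s00; have ds0' := ds0; have buR' := buR; have d0' := d0.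
  have uRL' := uRL; have b0' := b0; rewrite /y /z.
  by split; lra.
have yz : y < z by have s0' := s00; lra.
have fy : f y <= f p + s * (y - p).
  move: py; rewrite -/y le_eqVlt => /predU1P[<-|py]; first by lra.
  by apply/ltW/(chord kp bm) => //; rewrite py.
have fz : f m - f z <= df m * (m - z).
  move: zm; rewrite le_eqVlt => /predU1P[<-|zm]; first by lra.
  have [w /andP[zw wm] ->] := mean_value f_d zm.
  rewrite ler_wpM2r ?subr_ge0 ?(ltW zm)//.
  apply: (df_ndecr df_d ddf_pos); last exact: ltW.
  by apply: le_trans (ltW zw); apply: le_trans (ltW yz).
have fzy : f z - f y <= df z * (s0 / 4).
  have [w /andP[yw wz] ->] := mean_value f_d yz.
  have -> : s0 / 4 = z - y by lra.
  rewrite ler_wpM2r ?subr_ge0 ?(ltW yz)//.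
  apply: (df_ndecr df_d ddf_pos); last exact: ltW.
  exact: le_trans (ltW yw).
have dfz : cf * (s0 / 4) <= df uL - df z.
  have [bz1 bz2] := andP bz.
  rewrite (_ : s0 / 4 = uL - z); last by rewrite /z; lra.
  exact: dfInc.
have h1 : (df uL - Cf * d) * (m - y) < s * (m - y) by rewrite ltr_pM2r// subr_gt0.
have h2 : df m * (m - z) <= (df uL + Cf * d) * (m - z) by rewrite ler_wpM2r// subr_ge0.
have h3 : df z * (s0 / 4) <= (df uL - cf * (s0 / 4)) * (s0 / 4).
  by rewrite ler_pM2r ?divr_gt0//; lra.
have h4 : Cf * d * (2 * (m - z) + s0 / 4) <= Cf * d * (5 / 4 * s0).
  rewrite ler_wpM2l ?mulr_ge0 ?(ltW Cf0) ?(ltW d0)//.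
  by have ds0' := ds0; rewrite /z; lra.
have h5 : 32 * Cf * d * s0 <= cf * s0 * s0 by rewrite ler_pM2r.
have h6 : 0 < cf * s0 * s0 by rewrite !mulr_gt0.
move: fy es h1 h2 h3 h4 h5 h6 fz fzy; rewrite ez; lra.
Qed.

(** The [uR] term always has the good sign: for [p >= uR] because [f' p <= s], for [p < uR] because
    the graph is below the chord. The [uL] term can be bad only if [s] exceeds a characteristic
    speed between [uL] and [m]. Then [s] is close to [f' uL], [slope_far] places [p] more than
    [s0 / 2] above [uR], and the dissipation [c1] available there pays for the error. *)
Let shock_left (m p s : R) : - M <= m <= M -> - M <= p -> k <= p -> p < m ->
  - Lam < velocity m -> s * (m - p) = f m - f p ->
  a1 * (s * relE m uL - relQ m uL) - a2 * (s * relE p uR - relQ p uR) <= 0.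
Proof.
move=> mM Mp kp pm Vm es.
have [hE md _] := near_uL mM Vm.
have s0' := s00; have d0' := d0; have ds0' := ds0; have buR' := buR.
have uRL' := uRL; have b0' := b0; have uLM' := uLM.
have bm : b < m by lra.
have [sm ps] := slope_bounds kp pm bm es.
have B0 : relQ p uR <= s * relE p uR.
  have [puR|puR] := ltP p uR; last by apply: gap0 => //; [lra|apply: ps; lra].
  have [x] := entropy_chord f_d eta_d e1_d q_d es (negbT (lt_eqF puR)).
  rewrite (min_l (ltW puR)) (max_r (ltW puR)) => xp e.
  have h1 := chord kp bm (ltac:(lra) : p < x < m) es.
  have h2 : 0 <= e2 x * (f p + s * (x - p) - f x) * (uR - p).
    by rewrite !mulr_ge0 ?(ltW (e2_pos x))//; lra.
  by rewrite /relative_flux /relative_entropy; lra.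
have [h|] := pselect (forall x, Num.min uL m < x < Num.max uL m -> s <= df x).
  have h1 : a1 * (s * relE m uL) <= a1 * relQ m uL.
    by rewrite ler_pM2l//; exact: (relative_flux_ge f_d eta_d e1_d q_d e2_pos).
  have h2 : a2 * relQ p uR <= a2 * (s * relE p uR) by rewrite ler_pM2l.
  by move: h1 h2; lra.
move=> /existsNP[x /not_implyP[xm /negP]]; rewrite -ltNge => dfxs.
have sl : df uL - Cf * d < s by apply: le_lt_trans dfxs; exact: near_df mM md xm.
have su : s <= df uL + Cf * d by apply: le_trans sm _; exact: near_df_le.
have hQ : (df uL - Cf * d) * relE m uL <= relQ m uL.
  by apply: (relative_flux_ge f_d eta_d e1_d q_d e2_pos) => y; exact: near_df.
have py := slope_far mM md kp pm es sl.
have hc : c1 <= s * relE p uR - relQ p uR.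
  apply: le_trans (gap buR _ _ _); [apply: cube| | |apply: ps]; lra.
have h1 : a2 * c1 <= a2 * (s * relE p uR - relQ p uR) by rewrite ler_pM2l.
have h2 : (s - (df uL - Cf * d)) * (a1 * relE m uL) <= (2 * (Cf * d)) * (a2 * C).
  apply: ler_pM => //; last by lra.
    by rewrite subr_ge0 ltW.
  by rewrite mulr_ge0 ?(ltW a10)//; exact: relative_entropy_ge0 eta_d e1_d e2_pos _ _.
have h3 : a1 * ((df uL - Cf * d) * relE m uL) <= a1 * relQ m uL by rewrite ler_pM2l.
have h4 : a2 * ((K + 2 * (Cf * C)) * d) <= a2 * c1 by rewrite ler_pM2l.
have h5 : 0 <= a2 * (K * d) by rewrite !mulr_ge0// ltW.
move: h1 h2 h3 h4 h5; lra.
Qed.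

(** Here [p] is near [uL], hence above [uR], and the Lax inequalities [f' p <= s <= f' m] together
    with [s <= f' uL] give each of the two terms the right sign. *)
Let shock_right (m p s : R) : m <= M -> - M <= p <= M -> k <= p -> p < m ->
  - Lam < velocity p -> s <= df uL -> s * (m - p) = f m - f p ->
  a1 * (s * relE m uL - relQ m uL) - a2 * (s * relE p uR - relQ p uR) <= 0.
Proof.
move=> mM pM kp pm Vp sL es.
have [_ pd _] := near_uL pM Vp.
have s0' := s00; have d0' := d0; have ds0' := ds0; have buR' := buR.
have uRL' := uRL; have b0' := b0; have uLM' := uLM.
have bm : b < m by lra.
have [sm /(_ ltac:(lra)) ps] := slope_bounds kp pm bm es.
have B0 : relQ p uR <= s * relE p uR by apply: gap0 => //; lra.
have A0 : s * relE m uL <= relQ m uL.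
  apply: (relative_flux_ge f_d eta_d e1_d q_d e2_pos) => x.
  rewrite gt_min lt_max => hx; have [mu|mu] := leP m uL.
    apply: le_trans sm _; apply: (df_ndecr df_d ddf_pos); first by lra.
    by move: hx => /andP[/orP[|] + _]; lra.
  apply: le_trans sL _; apply: (df_ndecr df_d ddf_pos); first by lra.
  by move: hx => /andP[/orP[|] + _]; lra.
have h1 : a1 * (s * relE m uL) <= a1 * relQ m uL by rewrite ler_pM2l.
have h2 : a2 * relQ p uR <= a2 * (s * relE p uR) by rewrite ler_pM2l.
move: h1 h2; lra.
Qed.

(** For [m != p] the speed is a chord slope, so [s >= - L > - Lam], and [s <= max (V m) (V p)]
    forces one of the states to be near [uL]. If [m < p], the right state is then above [b], the
    graph is strictly below the chord, and the entropy inequality fails: only decreasing jumps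
    remain. *)
Lemma shock_dissipation (m p s : R) : - M <= m <= M -> - M <= p <= M ->
  k <= m -> k <= p ->
  Num.min (velocity m) (velocity p) <= s <= Num.max (velocity m) (velocity p) ->
  s * (p - m) = f p - f m -> q p - q m <= s * (eta p - eta m) ->
  a1 * (s * relE m uL - relQ m uL) - a2 * (s * relE p uR - relQ p uR) <= 0.
Proof.
move=> mM pM km kp sV RH ent; have [mp|] := eqVneq m p.
  rewrite {}mp {ent RH m mM km} minxx maxxx in sV *.
  have -> : s = velocity p by apply/eqP; rewrite eq_le andbC.
  exact: velocity_dissipation.
have s0' := s00; have d0' := d0; have ds0' := ds0; have buR' := buR.
have uRL' := uRL; have b0' := b0; have LL := LLam.
move=> mp; have sL : - L <= s.
  have [c cmp e] := mean_value_ne f_d mp.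
  have -> : s = df c.
    apply: (@mulIf _ (p - m)); first by rewrite subr_eq0 eq_sym.
    by rewrite RH.
  by have /andP[] := dfL (between_itv pM mM cmp).
have nearV : - Lam < velocity m \/ - Lam < velocity p.
  apply/orP; rewrite -lt_max; move: sV => /andP[_]; apply: lt_le_trans; lra.
have su : s <= df uL.
  by move: sV => /andP[_ h]; apply: (le_trans h); rewrite ge_max !V_hi.
move: mp; rewrite neq_lt => /orP[mp|pm]; last first.
  have es : s * (m - p) = f m - f p by lra.
  case: nearV => hV; first by apply: shock_left => //; lra.
  by apply: shock_right => //; lra.
have bp : b < p.
  by case: nearV => [/(near_uL mM)|/(near_uL pM)] [_ h _]; lra.
have [x] := entropy_chord f_d eta_d e1_d q_d RH (negbT (lt_eqF mp)).
rewrite (min_l (ltW mp)) (max_r (ltW mp)) => xmp e.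
have h1 := chord km bp xmp RH.
have h2 : 0 < e2 x * (f m + s * (x - m) - f x) * (p - m).
  by rewrite !mulr_gt0//; lra.
have h3 : e1 p * (f p - f m - s * (p - m)) = 0 by rewrite RH subrr mulr0.
by lra.
Qed.

End VelocityField.

Section VelocityFieldExistence.
Context {R : realType}.

Lemma velocity_field (f df ddf eta e1 e2 q : R -> R) (M b bup k s0 : R) :
  (forall x : R, is_derive x (1:R) f (df x)) ->
  (forall x : R, is_derive x (1:R) df (ddf x)) ->
  (forall x : R, x < 0 -> ddf x < 0) ->
  (forall x : R, 0 < x -> 0 < ddf x) ->
  continuous ddf ->
  (forall x : R, is_derive x (1:R) eta (e1 x)) ->
  (forall x : R, is_derive x (1:R) e1 (e2 x)) ->
  (forall x : R, 0 < e2 x) ->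
  continuous e2 ->
  (forall x : R, is_derive x (1:R) q (e1 x * df x)) ->
  0 < M -> 0 < b -> b <= M -> bup <= M -> 0 < s0 ->
  k != b -> df k * (b - k) = f b - f k ->
  exists astar Lam : R, [/\ 0 < astar < 1, 0 < Lam &
  forall a1 a2 : R, 0 < a1 -> 0 < a2 -> a2 / a1 <= astar ->
  forall uL uR : R, b <= uR -> uR + s0 <= uL -> uL <= bup ->
  exists (V : R -> R) (LV : R), [/\ 0 <= LV, forall u, `|V u| <= Lam,
    forall x y, `|V x - V y| <= LV * `|x - y| &
    forall m p s : R, - M <= m <= M -> - M <= p <= M -> k <= m -> k <= p ->
      Num.min (V m) (V p) <= s <= Num.max (V m) (V p) ->
      s * (p - m) = f p - f m -> q p - q m <= s * (eta p - eta m) ->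
      a1 * (s * relative_entropy eta e1 m uL - relative_flux f e1 q m uL) -
      a2 * (s * relative_entropy eta e1 p uR - relative_flux f e1 q p uR) <= 0]].
Proof.
move=> f_d df_d ddf_neg ddf_pos ddf_c eta_d e1_d e2_pos e2_c q_d M0 b0 bM bupM
  s00 kb ktan.
have MM : - M <= M by lra.
have [L L0 dfB] := continuous_itv_bounded MM (is_derive_continuous df_d).
have [Cf Cf0 ddfB] := continuous_itv_bounded MM ddf_c.
have [Ce Ce0 e2B] := continuous_itv_bounded MM e2_c.
have [ce ce0 e2b] := continuous_itv_lower MM e2_c (fun x _ => e2_pos x).
have [cf cf0 ddfb] : exists2 c, 0 < c & forall x, b <= x <= M -> c <= ddf x.
  by apply: continuous_itv_lower => // x bx; apply: ddf_pos; lra.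
pose Ch := 2 * Ce * M ^+ 2.
pose Lam := L + 1 + 2 * (L * Ch).
pose C := Ch + Lam + L.
pose c1 := ce * cf * (s0 / 2) ^+ 3 / 27.
pose K := 2 * L * (Ce * (2 * M)).
have Ch0 : 0 < Ch by rewrite /Ch !mulr_gt0// exprn_gt0.
have LCh0 : 0 < L * Ch by rewrite mulr_gt0.
have Lam0 : L < Lam by rewrite /Lam; lra.
have C0 : 0 < C by rewrite /C; lra.
have c10 : 0 < c1 by rewrite /c1 !mulr_gt0 ?exprn_gt0 ?divr_gt0.
have K0 : 0 < K by rewrite /K !mulr_gt0.
have h1 : 0 < K + 2 * (Cf * C) by rewrite addr_gt0 ?mulr_gt0.
have h2 : 0 < 32 * Cf by rewrite mulr_gt0.
have h3 : 0 < cf * s0 by rewrite mulr_gt0.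
(* The three conditions [ds0], [dc1] and [dcf] solved for [d]; none of them involves [a1], [a2],
   [uL] or [uR]. *)
pose d := Num.min (s0 / 4) (Num.min (c1 / (K + 2 * (Cf * C))) (cf * s0 / (32 * Cf))).
have d0 : 0 < d by rewrite !lt_min; apply/and3P; split; apply: divr_gt0.
have ds0 : d <= s0 / 4 by rewrite ge_min lexx.
have dc1 : (K + 2 * (Cf * C)) * d <= c1.
  by rewrite mulrC -ler_pdivlMr// !ge_min lexx orbT.
have dcf : 32 * Cf * d <= cf * s0.
  by rewrite mulrC -ler_pdivlMr// !ge_min lexx !orbT.
have CCe0 : 0 < 2 * C / ce by rewrite divr_gt0// mulr_gt0.
(* The second entry is [a12d] solved for [a2 / a1]; the first keeps [astar] below 1. *)
exists (Num.min (1 / 2) (d ^+ 2 / (2 * C / ce))), Lam; split.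
- rewrite lt_min gt_min divr_gt0//=; apply/andP; split.
    by apply: divr_gt0 => //; exact: exprn_gt0.
  by apply/orP; left; rewrite ltr_pdivrMr// mul1r ltr1n.
- exact: lt_trans L0 Lam0.
move=> a1 a2 a10 a20 a12 uL uR buR uRL uLb.
have a12d : a2 * (2 * C / ce) <= a1 * d ^+ 2.
  have /(le_trans a12) : Num.min (1 / 2) (d ^+ 2 / (2 * C / ce)) <= d ^+ 2 / (2 * C / ce).
    by rewrite ge_min lexx orbT.
  by rewrite ler_pdivlMr// mulrAC ler_pdivrMr// [d ^+ 2 * _]mulrC.
have dfL x : - M <= x <= M -> - L <= df x <= L by move=> /dfB; rewrite ler_norml.
have ddfCf x : - M <= x <= M -> - Cf <= ddf x <= Cf by move=> /ddfB; rewrite ler_norml.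
have e2C x : - M <= x <= M -> ce <= e2 x <= Ce.
  by move=> xM; rewrite e2b//=; apply: le_trans (e2B _ xM); exact: ler_norm.
have uLM := le_trans uLb bupM.
pose V := velocity df eta e1 Lam a1 a2 uL uR.
have Mc u : - M <= clip M u <= M by apply: clip_itv; exact: ltW.
(* Clipping the argument makes the Lipschitz bound global and changes nothing on [[- M, M]]. *)
exists (V \o clip M), ((a1 + a2) * (Ce * (2 * M)) / a2); split => //=.
- by rewrite divr_ge0 ?(ltW a20)// !mulr_ge0 ?addr_ge0 ?ltW.
- move=> u; exact: (velocity_bounded _ _ M0 b0 L0 Ce0 dfL (erefl Ch) (erefl Lam)
    s00 _ a20 buR uRL uLM).
- move=> x y.
  apply: (le_trans (velocity_lipschitz _ eta_d e1_d M0 b0 Ce0 ce0 e2C _ s00 a10 a20 buR uRL uLM _ _)) => //.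
  rewrite ler_wpM2l ?clip_dist//.
  by rewrite divr_ge0 ?(ltW a20)// !mulr_ge0 ?addr_ge0 ?ltW.
move=> m p s mM pM km kp; rewrite !clip_id// => sV RH ent.
exact: (shock_dissipation f_d df_d ddf_neg ddf_pos eta_d e1_d e2_pos q_d M0 b0 kb
  ktan L0 Cf0 cf0 Ce0 ce0 dfL ddfCf ddfb e2C (erefl Ch) (erefl Lam) (erefl C)
  (erefl c1) (erefl K) s00 d0 ds0 dc1 dcf a10 a20 a12d buR uRL uLM).
Qed.

End VelocityFieldExistence.

(** * Smooth cut-offs and tensor test functions *)

Section SmoothFunctions.
Context {R : realType}.
Implicit Types (f g : R -> R) (n : nat).

(** Stable under sums, products, inverses and composition by induction on [n]; [smooth_tensor] turns
    this one-variable notion into [smooth]. *)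
Fixpoint ndiff n f : Prop :=
  if n is m.+1 then (forall x, derivable f x 1) /\ ndiff m (derive1 f) else True.

Definition smooth1 f := forall n, ndiff n f.

Lemma ndiffS n f : ndiff n.+1 f -> ndiff n f.
Proof.
by elim: n f => [//|n IH] f [df nf]; split => //; exact: IH.
Qed.

Lemma derive1_eq f df : (forall x, is_derive x (1:R) f (df x)) -> (derive1 f) = df.
Proof. by move=> fd; apply/funext => x; rewrite derive1E; have [_ ->] := fd x. Qed.

Lemma is_derive1P f x : derivable f x 1 -> is_derive x (1:R) f ((derive1 f) x).
Proof. by rewrite derive1E => fd; exact: derivableP. Qed.

Lemma ndiff_is_derive n f df : (forall x, is_derive x (1:R) f (df x)) ->
  ndiff n df -> ndiff n.+1 f.
Proof.
move=> fd ndf; split; last by rewrite (derive1_eq fd).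
by move=> x; have [] := fd x.
Qed.

Lemma ndiff_cst n c : ndiff n (fun=> c).
Proof.
elim: n c => [//|n IH] c; apply: (ndiff_is_derive (df := fun=> 0)); exact: IH.
Qed.

Lemma ndiff_id n : ndiff n id.
Proof.
case: n => [//|n]; apply: (ndiff_is_derive (df := fun=> 1)); exact: ndiff_cst.
Qed.

Lemma ndiffD n f g : ndiff n f -> ndiff n g -> ndiff n (fun x => f x + g x).
Proof.
elim: n f g => [//|n IH] f g [fd nf] [gd ng].
apply: (@ndiff_is_derive _ _ (fun x => (derive1 f) x + (derive1 g) x)); last exact: IH.
by move=> x; apply: is_deriveD; exact: is_derive1P.
Qed.

Lemma ndiffM n f g : ndiff n f -> ndiff n g -> ndiff n (fun x => f x * g x).
Proof.
elim: n f g => [//|n IH] f g; move=> hf hg.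
have nf := ndiffS hf; have ng := ndiffS hg.
case: hf hg => fd nf' [gd ng'].
apply: (@ndiff_is_derive _ _ (fun x => f x * (derive1 g) x + g x * (derive1 f) x)).
  by move=> x; apply: is_deriveM; exact: is_derive1P.
by apply: ndiffD; apply: IH.
Qed.

Lemma ndiffN n f : ndiff n f -> ndiff n (fun x => - f x).
Proof.
move=> nf; under eq_fun do rewrite -mulN1r.
by apply: ndiffM => //; exact: ndiff_cst.
Qed.

Lemma ndiffV n f : (forall x, f x != 0) -> ndiff n f -> ndiff n (fun x => (f x)^-1).
Proof.
move=> f0; elim: n => [//|n IH] hf; have nf := ndiffS hf; case: hf => fd nf'.
apply: (@ndiff_is_derive _ _ (fun x => - ((f x)^-1 * (f x)^-1) * (derive1 f) x)).
  move=> x; apply: is_derive_eq; first exact: (is_deriveV (f0 x) (is_derive1P (fd x))).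
  by rewrite /GRing.scale /= -exprVn expr2.
by apply: ndiffM => //; apply: ndiffN; apply: ndiffM; exact: IH.
Qed.

Lemma ndiff_comp n f g : ndiff n f -> ndiff n g -> ndiff n (fun x => f (g x)).
Proof.
elim: n f g => [//|n IH] f g hf hg; have nf := ndiffS hf; have ng := ndiffS hg.
case: hf hg => fd nf' [gd ng'].
apply: (@ndiff_is_derive n (fun x => f (g x)) (fun x => derive1 f (g x) * derive1 g x)).
  by move=> x; exact: (is_derive1_comp (is_derive1P (fd (g x))) (is_derive1P (gd x))).
by apply: ndiffM => //; apply: IH.
Qed.

Lemma ndiff_expR n : ndiff n expR.
Proof. by elim: n => [//|n IH]; exact: (ndiff_is_derive (df := expR)). Qed.

(* The power is there to make the family closed under differentiation. *)
Definition flat n (x : R) := if 0 < x then (x ^+ n)^-1 * expR (- x^-1) else 0.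

Lemma flat_ge0 n x : 0 <= flat n x.
Proof.
rewrite /flat; case: ifPn => // x0.
by rewrite mulr_ge0 ?expR_ge0// invr_ge0 exprn_ge0// ltW.
Qed.

Lemma flat_gt0 n x : 0 < x -> 0 < flat n x.
Proof. by rewrite /flat => x0; rewrite x0 mulr_gt0 ?expR_gt0// invr_gt0 exprn_gt0. Qed.

Lemma flat_le0 n x : x <= 0 -> flat n x = 0.
Proof. by rewrite /flat => x0; rewrite ltNge x0. Qed.

(** One term of the exponential series of [1 / x] suffices. The quadratic bound is what makes the
    derivative at 0 vanish. *)
Lemma flat_sqr_bound n x : `|flat n x| <= (n.+2)`!%:R * x ^+ 2.
Proof.
rewrite ger0_norm ?flat_ge0// /flat; case: ifPn => x0; last first.
  by rewrite mulr_ge0 ?sqr_ge0.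
have h : (x ^- n.+2) / (n.+2)`!%:R <= expR x^-1.
  apply: le_trans (expR_ge1Dxn n.+1 (_ : 0 <= x^-1)); last by rewrite invr_ge0 ltW.
  by rewrite exprVn ler_wpDl.
rewrite ler_pdivrMr ?ltr0n ?fact_gt0// in h.
rewrite expRN ler_pdivrMr ?expR_gt0//.
have -> : (x ^+ n)^-1 = x ^- n.+2 * x ^+ 2.
  by rewrite -addn2 exprD invfM -mulrA mulVf ?mulr1// expf_neq0// gt_eqF.
by rewrite mulrAC ler_pM2r ?exprn_gt0// mulrC.
Qed.

Lemma is_derive_flat n x : is_derive x (1:R) (flat n) (flat n.+2 x - n%:R * flat n.+1 x).
Proof.
have [x0|x0|->] := ltgtP x 0.
- rewrite !flat_le0 ?ltW// mulr0 subr0.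
  apply: (@near_eq_is_derive _ R R (cst 0)).
  by near=> y; rewrite flat_le0//; apply: ltW; near: y; exact: lt_nbhsl.
- apply: (@near_eq_is_derive _ R R (fun y => (y ^+ n)^-1 * expR (- y^-1))).
    near=> y; rewrite /flat ifT//; near: y; exact: lt_nbhsr.
  have xn0 : x != 0 by rewrite gt_eqF.
  have hX : is_derive x (1:R) (fun y => y ^+ n) (n%:R * x ^+ n.-1).
    have -> : (fun y : R => y ^+ n) = (id : R -> R) ^+ n.
      by apply/funext => y; rewrite exprfctE.
    apply: is_derive_eq.
    by rewrite /GRing.scale /= mulr1.
  have hV := @is_deriveV _ (fun y => y ^+ n) x _ 1 (expf_neq0 n xn0) hX.
  have hI : is_derive x (1:R) (fun y => - y^-1) (x ^- 2).
    apply: is_derive_eq; first exact: (is_deriveN (@is_deriveV _ id x _ 1 xn0 (is_derive_id x (1:R)))).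
    by rewrite /GRing.scale /= mulr1 opprK.
  have hE := @is_derive1_comp _ expR (fun y => - y^-1) x _ _ (is_derive_expR (- x^-1)) hI.
  have hM := is_deriveM hV hE.
  apply: (is_derive_eq hM).
  rewrite /GRing.scale /= /flat x0.
  case: n {hX hV hM} => [|m] /=.
    by rewrite !mul0r !mulr0 !addr0 subr0 expr0 invr1 mul1r mulrC.
  have h1 : x ^+ m.+3 = x ^+ m * x ^+ 3 by rewrite -exprD addn3.
  have h2 : x ^+ m.+2 = x ^+ m * x ^+ 2 by rewrite -exprD addn2.
  have h3 : x ^+ m.+1 = x ^+ m * x by rewrite exprSr.
  have xm : x ^+ m != 0 by rewrite expf_neq0.
  by rewrite h1 h2 h3; field; rewrite xm xn0.
- rewrite !flat_le0// mulr0 subr0.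
  apply/is_derive1_caratheodory; exists (fun z => flat n z / z); split.
  + move=> z; rewrite (flat_le0 n (lexx 0)) !subr0.
    have [->|z0] := eqVneq z 0; first by rewrite mulr0 flat_le0.
    by rewrite divfK.
  + apply/cvgrPdist_le => e e0; rewrite invr0 mulr0; near=> z.
    rewrite sub0r normrN.
    have [->|z0] := eqVneq z 0; first by rewrite invr0 mulr0 normr0 ltW.
    rewrite normrM normfV ler_pdivrMr ?normr_gt0//.
    apply: le_trans (flat_sqr_bound _ _) _.
    rewrite -real_normK ?num_real// expr2 mulrA ler_pM2r ?normr_gt0//.
    rewrite -ler_pdivlMl ?ltr0n ?fact_gt0//.
    near: z; apply: (@nbhs0_le _ R); rewrite mulr_gt0// invr_gt0 ltr0n fact_gt0.
  + by rewrite /= invr0 mulr0.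
Unshelve. all: by end_near. Qed.


Lemma ndiff_flat m n : ndiff m (flat n).
Proof.
elim: m n => [//|m IH] n; apply: ndiff_is_derive (is_derive_flat n) _.
apply: ndiffD => //; apply: ndiffN; apply: ndiffM => //; exact: ndiff_cst.
Qed.

(** The standard smooth transition, equal to 0 for [x <= 0] and to 1 for [x >= 1]. *)
Definition step (x : R) := flat 0 x / (flat 0 x + flat 0 (1 - x)).

Lemma step_den_gt0 x : 0 < flat 0 x + flat 0 (1 - x).
Proof.
have [x0|x0] := ltP 0 x; first by rewrite ltr_pwDl ?flat_gt0 ?flat_ge0.
by rewrite ltr_wpDl ?flat_ge0 ?flat_gt0//; lra.
Qed.

Lemma smooth1_step : smooth1 step.
Proof.
move=> n; apply: ndiffM; first exact: ndiff_flat.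
apply: ndiffV; first by move=> x; rewrite gt_eqF ?step_den_gt0.
apply: ndiffD; first exact: ndiff_flat.
apply: (ndiff_comp (ndiff_flat n 0)); apply: ndiffD; first exact: ndiff_cst.
by apply: ndiffN; exact: ndiff_id.
Qed.

Lemma step_le0 x : x <= 0 -> step x = 0.
Proof. by move=> x0; rewrite /step flat_le0// mul0r. Qed.

Lemma step_ge1 x : 1 <= x -> step x = 1.
Proof.
move=> x1; rewrite /step (flat_le0 0 (_ : 1 - x <= 0)) ?addr0; last by lra.
by rewrite divff// gt_eqF// flat_gt0; lra.
Qed.

Lemma step_itv x : 0 <= step x <= 1.
Proof.
rewrite /step divr_ge0 ?flat_ge0 ?(ltW (step_den_gt0 x))//=.
by rewrite ler_pdivrMr ?step_den_gt0// mul1r lerDl flat_ge0.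
Qed.

Lemma is_derive_step x : is_derive x (1:R) step (derive1 step x).
Proof. by apply: is_derive1P; have [] := smooth1_step 1. Qed.

Lemma derive1_step_ge0 x : 0 <= derive1 step x.
Proof.
have hf := is_derive_flat 0 x.
have h1 : is_derive x (1:R) (fun y => flat 0 (1 - y)) (- flat 2 (1 - x)).
  have hg := is_derive_flat 0 (1 - x).
  have hI : is_derive x (1:R) (fun y => 1 - y) (- 1).
    by apply: is_derive_eq; ring.
  by apply: (is_derive_eq (@is_derive1_comp _ (flat 0) _ x _ _ hg hI)); ring.
have hD := is_deriveD hf h1.
have d0 := step_den_gt0 x.
have hV := @is_deriveV _ (fun y => flat 0 y + flat 0 (1 - y)) x _ 1 (lt0r_neq0 d0) hD.
have hM := is_deriveM hf hV.
rewrite derive1E; have [_ ->] := hM; rewrite /GRing.scale /=.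
set a := flat 0 x in d0 *; set b := flat 0 (1 - x) in d0 *.
set A := flat 2 x; set B := flat 2 (1 - x).
have -> : a * (- (a + b) ^- 2 * (A - 0 * flat 1 x - B)) + (a + b)^-1 * (A - 0 * flat 1 x)
   = (b * A + a * B) / (a + b) ^+ 2 by field; rewrite gt_eqF.
by rewrite divr_ge0 ?exprn_ge0 ?(ltW d0)// addr_ge0 ?mulr_ge0 ?flat_ge0.
Qed.

Lemma smooth1_derive1 f : smooth1 f -> smooth1 (derive1 f).
Proof. by move=> fs n; have [] := fs n.+1. Qed.

Lemma smooth1_is_derive f x : smooth1 f -> is_derive x (1:R) f (derive1 f x).
Proof. by move=> fs; apply: is_derive1P; have [] := fs 1. Qed.

Lemma smooth1_continuous f : smooth1 f -> continuous f.
Proof.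
by move=> fs; apply: is_derive_continuous => x; exact: smooth1_is_derive.
Qed.

Lemma derive1_eq0 f (a b x : R) : (forall y, a < y < b -> f y = 0) -> a < x < b ->
  derive1 f x = 0.
Proof.
move=> f0 /andP[ax xb]; rewrite derive1E.
have : is_derive x (1:R) f 0.
  apply: (@near_eq_is_derive _ R R (cst 0)); near=> y.
  by rewrite f0//; apply/andP; split; near: y; [exact: lt_nbhsr|exact: lt_nbhsl].
by case.
Unshelve. all: by end_near. Qed.

(** Being a difference of two translates of one transition, it has for derivative a unit bump on
    [[a, a + w]] minus one on [[b, b + w]]: testing with it compares values at [a] and at [b] even
    when [b - a < w]. *)
Definition plateau (a b w t : R) := step ((t - a) / w) - step ((t - b) / w).

Lemma smooth1_affine f (c d : R) : smooth1 f -> smooth1 (fun t => f (c * t + d)).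
Proof.
move=> fs n; apply: ndiff_comp => //; apply: ndiffD; last exact: ndiff_cst.
by apply: ndiffM; [exact: ndiff_cst|exact: ndiff_id].
Qed.

Lemma smooth1_step_affine a w : smooth1 (fun t => step ((t - a) / w)).
Proof.
have -> : (fun t => step ((t - a) / w)) = (fun t => step (w^-1 * t + - a / w)).
  by apply/funext => t; congr step; rewrite mulrBl mulrC mulNr.
exact: smooth1_affine smooth1_step.
Qed.

Lemma derive1_step_affine a w t :
  derive1 (fun t => step ((t - a) / w)) t = derive1 step ((t - a) / w) / w.
Proof.
have h1 := is_derive_step ((t - a) / w).
have h2 : is_derive t (1:R) (fun t => (t - a) / w) w^-1.
  by apply: is_derive_eq; rewrite /GRing.scale /=; ring.
have := @is_derive1_comp _ step (fun t => (t - a) / w) t _ _ h1 h2.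
by rewrite [LHS]derive1E => -[_ ->].
Qed.

Lemma smooth1_plateau a b w : smooth1 (plateau a b w).
Proof.
by move=> n; apply: ndiffD; [|apply: ndiffN]; exact: smooth1_step_affine.
Qed.

Lemma derive1_plateau a b w t : derive1 (plateau a b w) t =
  derive1 step ((t - a) / w) / w - derive1 step ((t - b) / w) / w.
Proof.
rewrite -!derive1_step_affine [LHS]derive1E.
have h1 := smooth1_is_derive t (smooth1_step_affine a w).
have h2 := smooth1_is_derive t (smooth1_step_affine b w).
by have [_ ->] := is_deriveB h1 h2.
Qed.

Lemma step_nondecreasing x y : x <= y -> step x <= step y.
Proof.
rewrite le_eqVlt => /predU1P[->//|xy]; rewrite -subr_ge0.
have [c _ ->] := mean_value is_derive_step xy.
by rewrite mulr_ge0 ?derive1_step_ge0// subr_ge0 ltW.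
Qed.

Lemma derive1_step_out x : x < 0 \/ 1 < x -> derive1 step x = 0.
Proof.
move=> [x0|x1].
  apply: (@derive1_eq0 _ (x - 1) 0); last by rewrite x0; lra.
  by move=> y y0; rewrite step_le0//; lra.
have h : is_derive x (1:R) step 0; last by rewrite derive1E; case: h.
apply: (@near_eq_is_derive _ R R (cst 1)); near=> y.
by rewrite step_ge1//; apply: ltW; near: y; exact: lt_nbhsr.
Unshelve. all: by end_near. Qed.

Lemma derive1_step_bounded : exists2 C : R, 0 < C & forall x, 0 <= derive1 step x <= C.
Proof.
have cS := smooth1_continuous (smooth1_derive1 smooth1_step).
have [C C0 hC] := continuous_itv_bounded (@ler01 R) cS.
exists C => // x; rewrite derive1_step_ge0 /=.
have [x0|x0] := ltP x 0; first by rewrite derive1_step_out ?ltW//; left.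
have [x1|x1] := ltP 1 x; first by rewrite derive1_step_out ?ltW//; right.
by apply: le_trans (ler_norm _) _; apply: hC; rewrite x0.
Qed.

Section Plateau.
Context (a b w : R).
Hypothesis ab : a <= b.
Hypothesis w0 : 0 < w.

Lemma plateau_itv t : 0 <= plateau a b w t <= 1.
Proof.
have ab' := ab; rewrite /plateau subr_ge0.
have /andP[h1 h2] := step_itv ((t - a) / w).
have /andP[h3 h4] := step_itv ((t - b) / w).
rewrite step_nondecreasing /=; first by lra.
by rewrite ler_pM2r ?invr_gt0//; lra.
Qed.

Lemma plateau1 t : a + w <= t <= b -> plateau a b w t = 1.
Proof.
move=> /andP[h1 h2]; rewrite /plateau step_ge1 ?step_le0 ?subr0//.
  by rewrite ler_pdivrMr// mul0r subr_le0.
by rewrite ler_pdivlMr// mul1r; lra.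
Qed.

Lemma plateau0 t : t <= a \/ b + w <= t -> plateau a b w t = 0.
Proof.
have ab' := ab; move=> [h|h]; rewrite /plateau.
  by rewrite !step_le0 ?subrr// ler_pdivrMr// mul0r; lra.
by have w0' := w0; rewrite !step_ge1 ?subrr// ler_pdivlMr// mul1r; lra.
Qed.

End Plateau.

End SmoothFunctions.

(** * Products of one-variable functions as test functions *)

Section TensorTestFunctions.
Context {R : realType}.
Implicit Types psi chi : R -> R.

Definition tensor psi chi (p : R * R) : R := psi p.1 * chi p.2.

Lemma tensor_differentiable psi chi p : smooth1 psi -> smooth1 chi ->
  differentiable (tensor psi chi) p.
Proof.
move=> ps cs.
have d1 : differentiable (psi \o (fst : R * R -> R)) p.
  apply: differentiable_comp.
    by apply: linear_differentiable => q; exact: cvg_fst.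
  by apply/derivable1_diffP; have [] := ps 1.
have d2 : differentiable (chi \o (snd : R * R -> R)) p.
  apply: differentiable_comp.
    by apply: linear_differentiable => q; exact: cvg_snd.
  by apply/derivable1_diffP; have [] := cs 1.
exact: differentiableM d1 d2.
Qed.

Lemma d_t_tensor psi chi : smooth1 psi -> d_t (tensor psi chi) = tensor (derive1 psi) chi.
Proof.
move=> ps; apply/funext => -[t x]; rewrite /d_t /tensor /=.
have h := is_deriveM (smooth1_is_derive t ps) (is_derive_cst (chi x) t (1:R)).
transitivity ('D_1 (psi * cst (chi x)) t).
  rewrite /derive; set F := (fun h => _); set G := (fun h => _).
  have -> : F = G; last by [].
  rewrite {}/F {}/G; apply/funext => s /=.
  by rewrite /GRing.scale /= !mulr1 !mulr0 !add0r.
by have [_ ->] := h; rewrite /GRing.scale /= mulr0 add0r mulrC.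
Qed.

Lemma d_x_tensor psi chi : smooth1 chi -> d_x (tensor psi chi) = tensor psi (derive1 chi).
Proof.
move=> cs; apply/funext => -[t x]; rewrite /d_x /tensor /=.
have h := is_deriveM (is_derive_cst (psi t) x (1:R)) (smooth1_is_derive x cs).
transitivity ('D_1 (cst (psi t) * chi) x).
  rewrite /derive; set F := (fun h => _); set G := (fun h => _).
  have -> : F = G; last by [].
  rewrite {}/F {}/G; apply/funext => s /=.
  by rewrite /GRing.scale /= !mulr1 !mulr0 !add0r.
by have [_ ->] := h; rewrite /GRing.scale /= mulr0 addr0.
Qed.

Lemma smooth_tensor psi chi : smooth1 psi -> smooth1 chi -> smooth (tensor psi chi).
Proof.
move=> ps cs s; suff [psi' [chi' [-> ps' cs']]] : exists psi' chi',
    [/\ foldr (fun b => if b then d_t else d_x) (tensor psi chi) s = tensor psi' chi',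
      smooth1 psi' & smooth1 chi'].
  by move=> p; exact: tensor_differentiable.
elim: s => [|b s [psi' [chi' [IH ps' cs']]]] /=; first by exists psi, chi.
rewrite IH; case: b.
  exists (derive1 psi'), chi'; split => //; last exact: smooth1_derive1.
  exact: d_t_tensor.
exists psi', (derive1 chi'); split => //; last exact: smooth1_derive1.
exact: d_x_tensor.
Qed.

Lemma test_function_tensor psi chi (a b c d : R) : smooth1 psi -> smooth1 chi ->
  0 < a -> (forall t, t < a \/ b < t -> psi t = 0) ->
  (forall x, x < c \/ d < x -> chi x = 0) -> test_function (tensor psi chi).
Proof.
move=> ps cs a0 psi0 chi0; split; first exact: smooth_tensor.
exists (`[a, b] `*` `[c, d]); split.
- by apply: compact_setX; exact: segment_compact.
- move=> [t x] [/=]; rewrite in_itv /= => /andP[at_ _] _.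
  exact: lt_le_trans at_.
move=> [t x] /=; rewrite !in_itv /= /tensor => h.
have [tb|] := boolP (a <= t <= b); last first.
  rewrite negb_and -!ltNge => h'.
  by rewrite psi0 ?mul0r//; apply/orP.
have [xb|] := boolP (c <= x <= d); first by exfalso; apply: h.
rewrite negb_and -!ltNge => h'.
by rewrite chi0 ?mulr0//; apply/orP.
Qed.

Lemma weak_pairing_tensor A B u psi chi : smooth1 psi -> smooth1 chi ->
  weak_pairing A B u (tensor psi chi) =
  \int[(@lebesgue_measure R \x @lebesgue_measure R)%E]_(p in half_plane)
    (A (u p) * (derive1 psi p.1 * chi p.2) + B (u p) * (psi p.1 * derive1 chi p.2)).
Proof.
by move=> ps cs; rewrite /weak_pairing d_t_tensor ?d_x_tensor.
Qed.

End TensorTestFunctions.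

(** * Bounded measurable functions *)

Section AlmostEverywhere.
Context {d : measure_display} {T : measurableType d} {R : realType}.
Context {m : {measure set T -> \bar R}}.
Implicit Types P Q S : T -> Prop.

Lemma aeS P Q : {ae m, forall x, P x} -> (forall x, P x -> Q x) -> {ae m, forall x, Q x}.
Proof. by move=> /[swap] PQ; apply: (@filterS _ _ (ae_filter_ringOfSetsType m)). Qed.

Lemma ae2S P Q S : {ae m, forall x, P x} -> {ae m, forall x, Q x} ->
  (forall x, P x -> Q x -> S x) -> {ae m, forall x, S x}.
Proof.
move=> hP hQ PQ; have := @filterI _ _ (ae_filter_ringOfSetsType m) _ _ hP hQ.
by move=> /aeS; apply => x [/PQ]; apply.
Qed.

End AlmostEverywhere.

Section BoundedMeasurable.
Context {R : realType}.
Local Notation mu := (@lebesgue_measure R).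
Local Notation mu2 := (@lebesgue_measure R \x @lebesgue_measure R)%E.
Implicit Types (g h : R -> R) (G : R * R -> R) (C a b c d : R).

(** The bound holds on the whole line, so integrability on compact intervals is automatic and the
    constants of compound expressions follow by arithmetic. *)
Definition bmf g C := measurable_fun setT g /\ forall x, `|g x| <= C.

Lemma bmf_ge0 g C : bmf g C -> 0 <= C.
Proof. by move=> [_ /(_ 0)]; apply: le_trans. Qed.

Lemma bmf_cst c : bmf (fun=> c) `|c|.
Proof. by split. Qed.

Lemma bmfD g h C C' : bmf g C -> bmf h C' -> bmf (fun x => g x + h x) (C + C').
Proof.
move=> [mg bg] [mh bh]; split; first exact: measurable_funD.
by move=> x; apply: (le_trans (ler_normD _ _)); exact: lerD.
Qed.

Lemma bmfN g C : bmf g C -> bmf (fun x => - g x) C.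
Proof.
move=> [mg bg]; split; last by move=> x; rewrite normrN.
exact: (measurableT_comp (@oppr_measurable R setT)).
Qed.

Lemma bmfM g h C C' : bmf g C -> bmf h C' -> bmf (fun x => g x * h x) (C * C').
Proof.
move=> [mg bg] [mh bh]; split; first exact: measurable_funM.
by move=> x; rewrite normrM ler_pM.
Qed.

Lemma bmf_norm g C : bmf g C -> bmf (fun x => `|g x|) C.
Proof.
move=> [mg bg]; split; last by move=> x; rewrite normr_id.
exact: (measurableT_comp (@normr_measurable R setT)).
Qed.

Lemma itv_lty a b : (mu `[a, b] < +oo)%E.
Proof. by rewrite lebesgue_measure_itv /=; case: ifPn => _; rewrite ?ltry. Qed.

Lemma bmf_integrable g C a b : bmf g C -> mu.-integrable `[a, b] (EFin \o g).
Proof.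
move=> [mg bg]; apply: measurable_bounded_integrable => //; first exact: itv_lty.
  exact: measurable_funTS.
by exists C; split; [exact: num_real|move=> y Cy x _ /=; apply: le_trans (bg x) (ltW Cy)].
Qed.

Lemma itv_fine_measure a b : a <= b -> fine (mu `[a, b]) = b - a.
Proof.
move=> ab; rewrite lebesgue_measure_itv /= lte_fin.
move: ab; rewrite le_eqVlt => /predU1P[->|ab]; first by rewrite ltxx subrr.
by rewrite ab.
Qed.

Lemma Rint_cst a b c : a <= b -> \int[mu]_(x in `[a, b]) c = c * (b - a).
Proof. by move=> ab; rewrite Rintegral_cst// itv_fine_measure. Qed.

Lemma Rint_ge0_ae g C a b : bmf g C ->
  {ae mu, forall x, a <= x <= b -> 0 <= g x} -> 0 <= \int[mu]_(x in `[a, b]) g x.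
Proof.
move=> bg g0.
have -> : \int[mu]_(x in `[a, b]) g x = \int[mu]_(x in `[a, b]) Num.max 0 (g x).
  congr fine; apply: ae_eq_integral => //.
  - by apply/measurable_EFinP; apply: measurable_funTS; case: bg.
  - apply/measurable_EFinP; apply: measurable_funTS; apply: measurable_maxr => //.
    by case: bg.
  - by apply: (aeS g0) => x gx; rewrite /= in_itv /= => /gx h; rewrite max_r.
by apply: Rintegral_ge0 => x _; rewrite le_max lexx.
Qed.

Lemma Rint_le_ae g h C C' a b : bmf g C -> bmf h C' ->
  {ae mu, forall x, a <= x <= b -> g x <= h x} ->
  \int[mu]_(x in `[a, b]) g x <= \int[mu]_(x in `[a, b]) h x.
Proof.
move=> bg bh gh; have ig := bmf_integrable a b bg; have ih := bmf_integrable a b bh.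
rewrite -subr_ge0 -RintegralB//.
apply: Rint_ge0_ae (bmfD bh (bmfN bg)) _.
by apply: (aeS gh) => x gx /gx; rewrite subr_ge0.
Qed.

Lemma Rint_le g h C C' a b : bmf g C -> bmf h C' ->
  (forall x, a <= x <= b -> g x <= h x) ->
  \int[mu]_(x in `[a, b]) g x <= \int[mu]_(x in `[a, b]) h x.
Proof. by move=> bg bh gh; apply: Rint_le_ae bg bh _; exact: aeW. Qed.

Lemma Rint_abs_le g C a b : a <= b -> bmf g C ->
  `|\int[mu]_(x in `[a, b]) g x| <= C * (b - a).
Proof.
move=> ab bg; rewrite -Rint_cst// ler_norml -mulN1r -RintegralZl//; last first.
  exact: bmf_integrable (bmf_cst C).
have h x : a <= x <= b -> -1 * C <= g x <= C.
  by move=> _; rewrite mulN1r -ler_norml; case: bg.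
apply/andP; split.
  by apply: Rint_le (bmf_cst _) bg _ => x /h /andP[].
by apply: Rint_le bg (bmf_cst _) _ => x /h /andP[].
Qed.

Lemma Rint_split g C a b c : a <= b -> b <= c -> bmf g C ->
  \int[mu]_(x in `[a, c]) g x =
  \int[mu]_(x in `[a, b]) g x + \int[mu]_(x in `[b, c]) g x.
Proof.
move=> ab bc bg; have ig := bmf_integrable a c bg.
rewrite -(@Rintegral_itv_obnd_cbnd _ b); last first.
  apply: integrableS (bmf_integrable b c bg) => //.
  by apply: subset_itv_oc_cc.
rewrite -(Rintegral_itvB ig) //=.
by rewrite addrC subrK.
Qed.

Definition bm2 G C := measurable_fun setT G /\ forall p, `|G p| <= C.

Lemma bm2_section G C t : bm2 G C -> bmf (fun x => G (t, x)) C.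
Proof. by move=> [mG bG]; split => //; exact: measurable_fun_pair2. Qed.

Lemma bm2D G H C C' : bm2 G C -> bm2 H C' -> bm2 (fun x => G x + H x) (C + C').
Proof.
move=> [mg bg] [mh bh]; split; first exact: measurable_funD.
by move=> x; apply: (le_trans (ler_normD _ _)); exact: lerD.
Qed.

Lemma bm2M G H C C' : bm2 G C -> bm2 H C' -> bm2 (fun x => G x * H x) (C * C').
Proof.
move=> [mg bg] [mh bh]; split; first exact: measurable_funM.
by move=> x; rewrite normrM ler_pM.
Qed.

Lemma bm2_fst g C : bmf g C -> bm2 (fun p => g p.1) C.
Proof. by move=> [mg bg]; split => //; exact: measurableT_comp. Qed.

Lemma bm2_snd g C : bmf g C -> bm2 (fun p => g p.2) C.
Proof. by move=> [mg bg]; split => //; exact: measurableT_comp. Qed.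

Lemma bm2_inner G C c d : c <= d -> bm2 G C ->
  bmf (fun t => \int[mu]_(x in `[c, d]) G (t, x)) (C * (d - c)).
Proof.
move=> cd bG; split; last first.
  by move=> t; apply: Rint_abs_le => //; exact: bm2_section.
have [mG bdG] := bG.
(* Adding [C] makes the integrand nonnegative, as the measurability part of Tonelli's theorem
   requires; the constant is subtracted at the end. *)
pose H (p : R * R) : \bar R := ((G p + C) * \1_(`[c, d]%classic) p.2)%:E.
have H0 p : (0 <= H p)%E.
  rewrite lee_fin mulr_ge0//.
  by have := bdG p; rewrite ler_norml; lra.
have mH : measurable_fun setT H.
  apply/measurable_EFinP; apply: measurable_funM; first exact: measurable_funD.
  have mI : measurable_fun setT (\1_(`[c, d]%classic) : R -> R).
    exact: measurable_indic.
  exact: (measurableT_comp mI).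
have mF := measurable_fun_fubini_tonelli_F (m2 := mu) H mH H0.
have FE t : (fubini_F mu H t = (\int[mu]_(x in `[c, d]) (G (t, x) + C))%:E)%E.
  have bGC := bmfD (bm2_section t bG) (bmf_cst C).
  rewrite /Rintegral fineK; last by apply: integrable_fin_num (bmf_integrable c d bGC).
  rewrite /fubini_F [RHS]integral_mkcond; apply: eq_integral => x _.
  by rewrite /H patchE /= indicE; case: (x \in _); rewrite ?mulr1 ?mulr0.
have -> : (fun t => \int[mu]_(x in `[c, d]) G (t, x)) =
    (fun t => fine (fubini_F mu H t) - C * (d - c)).
  apply/funext => t; rewrite FE /= RintegralD//.
  - by rewrite Rint_cst// addrK.
  - exact: bmf_integrable (bm2_section t bG).
  - exact: bmf_integrable (bmf_cst C).
apply: measurable_funB => //.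
exact: (measurableT_comp (@fine_measurable R setT measurableT)).
Qed.

Lemma box_lty a b c d : (mu2 (`[a, b] `*` `[c, d]) < +oo)%E.
Proof.
rewrite product_measure1E// lte_mul_pinfty//; last exact: itv_lty.
by rewrite ge0_fin_numE//; exact: itv_lty.
Qed.

Lemma bm2_integrable G C (D : set (R * R)) : measurable D -> (mu2 D < +oo)%E -> bm2 G C ->
  mu2.-integrable D (EFin \o G).
Proof.
move=> mD Doo [mg bg]; apply: measurable_bounded_integrable => //.
  exact: measurable_funTS.
by exists C; split; [exact: num_real|move=> y Cy x _ /=; apply: le_trans (bg x) (ltW Cy)].
Qed.

Lemma Fubini_box G C a b c d : bm2 G C ->
  \int[mu2]_(p in `[a, b] `*` `[c, d]) G p =
  \int[mu]_(t in `[a, b]) \int[mu]_(x in `[c, d]) G (t, x).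
Proof.
move=> bG; have mD : measurable (`[a, b] `*` `[c, d]) by exact: measurableX.
have iG := bm2_integrable mD (box_lty a b c d) bG.
congr fine; rewrite integral_mkcond.
have iG' : mu2.-integrable setT ((EFin \o G) \_ (`[a, b] `*` `[c, d])).
  by apply/integrable_restrict => //; rewrite setTI.
rewrite -(integral12_prod_meas1 iG') [RHS]integral_mkcond; apply: eq_integral => t _.
rewrite /fubini_F patchE; case: ifPn => ht; last first.
  rewrite integral0_eq// => x _; rewrite patchE ifF//.
  by apply/negP => /set_mem[/= h _]; move/negP: ht; apply; exact/mem_set.
rewrite /Rintegral fineK; last first.
  by apply: integrable_fin_num (bmf_integrable c d (bm2_section t bG)).
rewrite [RHS]integral_mkcond; apply: eq_integral => x _; rewrite !patchE.
by congr (if _ then _ else _); apply/idP/idP => /set_mem h; apply/mem_set;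
  [case: h|split => //; exact: set_mem].
Qed.

Lemma ae_prod (P : R * R -> Prop) : {ae mu2, forall p, P p} ->
  {ae mu, forall t, {ae mu, forall x, P (t, x)}}.
Proof.
move=> [N [mN N0 PN]].
have mX := measurable_fun_xsection mu mN.
have : (\int[mu]_t `|mu (xsection N t)| = 0)%E.
  by rewrite -N0; apply: eq_integral => t _; rewrite gee0_abs.
move/(ae_eq_integral_abs mu measurableT mX).
move=> /aeS; apply => t /(_ I) /= Nt; exists (xsection N t); split => //.
  exact: measurable_xsection.
by move=> x /= Px; apply/xsectionP; exact: PN.
Qed.

End BoundedMeasurable.

(** * Filippov paths *)

Section EulerPath.
Context {R : realType}.
Local Notation mu := (@lebesgue_measure R).

(** The limit is the supremum of the numbers lying below [v n] for [U]-almost every [n]. An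
    ultrafilter yields limits at all times at once, in place of a compactness argument and a
    subsequence. *)
Lemma ultra_limit (U : set_system nat) (v : nat -> R) (C : R) : UltraFilter U ->
  (forall n, `|v n| <= C) ->
  exists L, forall e, 0 < e -> U [set n | `|v n - L| <= e].
Proof.
move=> UU vC; pose S := [set x | U [set n | x <= v n]].
have SC : has_sup S.
  split.
    exists (- C); rewrite /S /=; apply: filterS (filterT) => n _ /=.
    by have := vC n; rewrite ler_norml => /andP[].
  exists C => x; rewrite /S /= => /filter_ex[n /= h].
  by apply: le_trans h _; have := vC n; rewrite ler_norml => /andP[].
exists (sup S) => e e0.
have [x Sx xe] := sup_adherent e0 SC.
have h : U [set n | v n < sup S + e].
  have [h|h] := in_ultra_setVsetC [set n | v n < sup S + e] UU; first exact: h.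
  have /(ub_le_sup SC.2) : S (sup S + e).
    by rewrite /S /=; apply: filterS h => n /=; rewrite leNgt => /negP.
  by rewrite gerDl leNgt e0.
apply: filterS (filterI Sx h) => n [/= h1 h2].
by rewrite ler_norml; apply/andP; split; lra.
Qed.

Context (W : R * R -> R) (Lam : R).
Hypothesis bW : bm2 W Lam.
Context (tbar x0 : R).

Let Lam0 : 0 <= Lam. Proof. by have [_ /(_ (0, 0))] := bW; apply: le_trans. Qed.

Let addKl (x y : R) : x + y - x = y. Proof. by rewrite addrAC subrr add0r. Qed.

Let tau (n : nat) : R := n.+1%:R^-1.

Let tau0 n : 0 < tau n. Proof. by rewrite invr_gt0 ltr0n. Qed.

Let tauE n : n.+1%:R * tau n = 1. Proof. by rewrite divff// pnatr_eq0. Qed.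

Let tk n (j : nat) : R := tbar + j%:R * tau n.

Let tkS n j : tk n j.+1 = tk n j + tau n.
Proof. by rewrite /tk -natr1 mulrDl mul1r addrA. Qed.

Let avg n (y t : R) := \int[mu]_(x in `[y, y + tau n]) W (t, x).

Let bavg n y : bmf (avg n y) (Lam * tau n).
Proof.
have := @bm2_inner _ W Lam y (y + tau n); rewrite addKl; apply => //.
by rewrite lerDl ltW.
Qed.

(** [W] is meaningful only up to null sets, so point values are replaced by means over squares of
    side [tau n]. The factor [n.+1] is the time step divided by the area of the square. *)
Fixpoint euler (n j : nat) : R :=
  if j is i.+1 then
    euler n i + n.+1%:R * \int[mu]_(t in `[tk n i, tk n i.+1]) avg n (euler n i) t
  else x0.

Let euler_step n j : `|euler n j.+1 - euler n j| <= Lam * tau n.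
Proof.
rewrite /= addKl normrM ger0_norm ?ler0n//.
have := Rint_abs_le (_ : tk n j <= tk n j.+1) (bavg n (euler n j)).
rewrite tkS lerDl ltW// addKl => /(_ isT) h.
apply: le_trans (ler_wpM2l (ler0n _ _) h) _.
by rewrite mulrCA tauE mulr1.
Qed.

Let euler_dist n i k : `|euler n (i + k) - euler n i| <= Lam * (k%:R * tau n).
Proof.
elim: k => [|k IH]; first by rewrite addn0 subrr normr0 mul0r mulr0.
rewrite addnS -natr1 mulrDl mul1r mulrDr.
have -> : euler n (i + k).+1 - euler n i =
  (euler n (i + k) - euler n i) + (euler n (i + k).+1 - euler n (i + k)) by ring.
by apply: (le_trans (ler_normD _ _)); apply: lerD => //; exact: euler_step.
Qed.

Let idx n (t : R) : nat := Num.truncn ((t - tbar) * n.+1%:R).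

(** A step function of time, whose lag costs at most [Lam * tau n]. Before [tbar] the index
    truncates to 0 and the value is [x0]. *)
Let hn n t := euler n (idx n t).

Let idx_le n t : tbar <= t -> tk n (idx n t) <= t < tk n (idx n t).+1.
Proof.
move=> tt; have h : 0 <= (t - tbar) * n.+1%:R by rewrite mulr_ge0 ?subr_ge0.
have /andP[h1 h2] := truncn_itv h.
rewrite -(ler_pM2r (tau0 n)) -mulrA tauE mulr1 in h1.
rewrite -(ltr_pM2r (tau0 n)) -mulrA tauE mulr1 in h2.
by rewrite /tk /idx; lra.
Qed.

Let idx_before n t : t <= tbar -> idx n t = 0%N.
Proof.
move=> tt; apply/eqP; rewrite -leqn0 leqNgt truncn_gt0 -ltNge.
by apply: le_lt_trans (@ltr01 R); rewrite mulr_le0_ge0 ?subr_le0 ?ler0n.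
Qed.

Let idx_tk n j : idx n (tk n j) = j.
Proof.
by rewrite /idx /tk addKl -mulrA (mulrC (tau n)) tauE mulr1 natrK.
Qed.

Let idx_mono n s t : s <= t -> (idx n s <= idx n t)%N.
Proof. by move=> st; apply: le_truncn; rewrite ler_wpM2r ?ler0n//; lra. Qed.

Let hn_dist n s t : s <= t -> `|hn n t - hn n s| <= Lam * (t - s + tau n).
Proof.
move=> st; have [tt|tt] := leP t tbar.
  rewrite /hn !idx_before//; last exact: le_trans tt.
  by rewrite subrr normr0 mulr_ge0// addr_ge0 ?subr_ge0 ?(ltW (tau0 n)).
have [k kE] : exists k, idx n t = (idx n s + k)%N.
  by exists (idx n t - idx n s)%N; rewrite subnKC// idx_mono.
rewrite /hn kE; apply: (le_trans (euler_dist _ _ _)); apply: ler_wpM2l => //.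
have /andP[h1 _] := idx_le n (ltW tt); have t0 := tau0 n.
rewrite kE /tk natrD mulrDl in h1.
have [ss|/ltW ss] := leP s tbar.
  rewrite idx_before// in h1; lra.
have /andP[_ h2] := idx_le n ss; rewrite tkS /tk in h2.
lra.
Qed.

(** An increment is a time integral of means of [W] over intervals of length [tau n], so an almost
    everywhere bound of [s * W (t, x)] by [g t] survives both integrations. *)
Let telescope_le s (g : R -> R) C n i k : bmf g C ->
  (forall j, (i <= j < i + k)%N -> {ae mu, forall t, tk n j <= t <= tk n j.+1 ->
     {ae mu, forall x, euler n j <= x <= euler n j + tau n -> s * W (t, x) <= g t}}) ->
  s * (euler n (i + k) - euler n i) <= \int[mu]_(t in `[tk n i, tk n (i + k)]) g t.
Proof.
move=> bg; elim: k => [|k IH] hg.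
  by rewrite addn0 subrr mulr0 set_itv1 Rintegral_set1.
have tkk (j l : nat) : tk n j <= tk n (j + l).
  by rewrite /tk natrD mulrDl addrA lerDl mulr_ge0 ?ler0n ?(ltW (tau0 n)).
rewrite addnS (@Rint_split _ g C _ (tk n (i + k))) //; last by rewrite -addn1.
have -> : s * (euler n (i + k).+1 - euler n i) =
  s * (euler n (i + k) - euler n i) + s * (euler n (i + k).+1 - euler n (i + k)) by ring.
apply: lerD.
  by apply: IH => j /andP[h1 h2]; apply: hg; rewrite h1 addnS ltnS ltnW.
rewrite [euler n (i + k).+1]/= addKl mulrCA -RintegralZl//; last first.
  exact: bmf_integrable (bavg _ _).
rewrite -RintegralZl//; last first.
  exact: bmf_integrable (bmfM (bmf_cst s) (bavg _ _)).
apply: (Rint_le_ae (bmfM (bmf_cst _) (bmfM (bmf_cst s) (bavg _ _))) bg).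
have hik : (i <= i + k < i + k.+1)%N by rewrite leq_addr addnS ltnSn.
apply: (aeS (hg _ hik)) => t ht /ht h.
have -> : g t = n.+1%:R * (g t * (tau n)) by rewrite mulrCA tauE mulr1.
rewrite ler_pM2l ?ltr0n// -RintegralZl//; last first.
  exact: bmf_integrable (bm2_section _ bW).
have -> : g t * tau n = \int[mu]_(x in `[euler n (i + k), euler n (i + k) + tau n]) g t.
  by rewrite Rint_cst ?lerDl ?(ltW (tau0 n))// addKl.
exact: (Rint_le_ae (bmfM (bmf_cst s) (bm2_section _ bW)) (bmf_cst _)).
Qed.

(** The whole steps inside [[a, b]] telescope. What remains is the increment of the step containing
    [a], at most [Lam * tau n], and the integrals of [g] over the two incomplete steps, at most
    [C * tau n] each. *)
Let hn_increment s (g : R -> R) C n a b : `|s| <= 1 -> bmf g C -> tbar <= a -> a <= b ->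
  (forall j, a <= tk n j -> tk n j.+1 <= b ->
    {ae mu, forall t, tk n j <= t <= tk n j.+1 ->
     {ae mu, forall x, euler n j <= x <= euler n j + tau n -> s * W (t, x) <= g t}}) ->
  s * (hn n b - hn n a) <= \int[mu]_(t in `[a, b]) g t + (Lam + 2 * C) * tau n.
Proof.
move=> s1 bg ta ab hg; have C0 := bmf_ge0 bg; have t0 := tau0 n.
have /andP[ja1 ja2] := idx_le n ta; have /andP[jb1 jb2] := idx_le n (le_trans ta ab).
set ja := idx n a in ja1 ja2; set jb := idx n b in jb1 jb2.
have jab : (ja <= jb)%N by exact: idx_mono.
rewrite tkS in ja2; rewrite tkS in jb2.
have ht : 0 <= Lam * tau n by rewrite mulr_ge0// ltW.
have hC : 0 <= C * tau n by rewrite mulr_ge0// ltW.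
have bnd x y : x <= y -> y - x <= tau n -> `|\int[mu]_(t in `[x, y]) g t| <= C * tau n.
  by move=> xy yx; apply: le_trans (Rint_abs_le xy bg) _; rewrite ler_wpM2l.
rewrite /hn -/ja -/jb; move: jab; rewrite leq_eqVlt => /predU1P[jab|jab].
  rewrite jab subrr mulr0.
  have := bnd a b ab ltac:(rewrite -jab in jb1 jb2; lra).
  by rewrite ler_norml => /andP[h _]; lra.
have [k kE] : exists k, jb = (ja.+1 + k)%N by exists (jb - ja.+1)%N; rewrite subnKC.
have h1 : s * (euler n jb - euler n ja.+1) <= \int[mu]_(t in `[tk n ja.+1, tk n jb]) g t.
  rewrite kE; apply: telescope_le bg _ => j /andP[jlo jhi]; apply: hg.
    apply: le_trans (ltW ja2) _; rewrite -tkS.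
    by rewrite /tk lerD2l ler_pM2r// ler_nat.
  by apply: le_trans jb1; rewrite kE /tk lerD2l ler_pM2r// ler_nat.
have h2 : s * (euler n ja.+1 - euler n ja) <= Lam * tau n.
  apply: le_trans (ler_norm _) _; rewrite normrM -[leRHS]mul1r.
  by apply: ler_pM => //; exact: euler_step.
have ka : a <= tk n ja.+1 by rewrite tkS ltW.
have kb : tk n ja.+1 <= tk n jb by rewrite /tk lerD2l ler_pM2r// ler_nat.
have h3 := bnd _ _ ka ltac:(rewrite tkS; lra).
have h4 := bnd _ _ jb1 ltac:(lra).
rewrite (Rint_split ka (le_trans kb jb1) bg) (Rint_split kb jb1 bg).
move: h3 h4; rewrite !ler_norml => /andP[h3 _] /andP[h4 _].
lra.
Qed.

(* [h] is the limit, along an ultrafilter, of polygons whose slopes are averages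
   of [W] over boxes of size [tau n]. *)
Lemma euler_path : exists h : R -> R,
  [/\ forall s t, `|h t - h s| <= Lam * `|t - s|,
      forall t, t <= tbar -> h t = x0 &
      forall (s : R) (g : R -> R) (C a b d : R), `|s| <= 1 -> bmf g C ->
        tbar <= a -> a <= b -> 0 < d ->
        {ae mu, forall t, a <= t <= b ->
          {ae mu, forall x, h t - d < x < h t + d -> s * W (t, x) <= g t}} ->
        s * (h b - h a) <= \int[mu]_(t in `[a, b]) g t].
Proof.
have [U [UU Uoo]] := ultraFilterLemma (_ : ProperFilter \oo).
have UI A B : U A -> U B -> U (A `&` B) by exact: filterI.
have Uex A : U A -> exists n, A n by exact: filter_ex.
have hb t n : `|hn n t| <= `|x0| + Lam * (`|t - tbar| + 1).
  have -> : hn n t = x0 + (hn n t - x0) by ring.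
  apply: (le_trans (ler_normD _ _)); rewrite lerD2l.
  have tau1 : tau n <= 1 by rewrite invf_le1 ?ltr0n// ler1n.
  have [tt|/ltW tt] := leP t tbar.
    by rewrite /hn idx_before// subrr normr0 mulr_ge0// addr_ge0.
  have := hn_dist n tt; rewrite {2}/hn idx_before// => /le_trans; apply.
  by rewrite ler_wpM2l// ger0_norm ?subr_ge0// lerD2l.
pose P t L := forall e, 0 < e -> U [set n | `|hn n t - L| <= e].
have hex t : exists L, P t L by exact: ultra_limit (hb t).
pose h t := xget 0 [set L | P t L].
have hP t : P t (h t) by rewrite /h; case: xgetP => [L -> //|/(_ _ _)]; have [L PL] := hex t => /(_ L).
have Utau e : 0 < e -> U [set n | tau n <= e].
  move=> e0; apply: Uoo; near=> n; rewrite /= /tau.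
  rewrite -(invrK e) lef_pV2 ?posrE ?ltr0n ?invr_gt0//.
  have h1 : e^-1 <= n%:R by near: n; exact: nbhs_infty_ger.
  by apply: le_trans h1 _; rewrite ler_nat.
have hlip s t : `|h t - h s| <= Lam * `|t - s|.
  wlog st : s t / s <= t.
    have [st|/ltW st] := leP s t; first exact.
    by rewrite distrC (distrC t); exact.
  rewrite [X in _ * X]ger0_norm ?subr_ge0//; apply/ler_addgt0Pr => e e0.
  have e3 : 0 < e / 3 by rewrite divr_gt0.
  have el : 0 < e / 3 / (Lam + 1) by rewrite divr_gt0// ltr_wpDl.
  have /Uex[n /= [[h1 h2] h3]] := UI _ _ (UI _ _ (hP s _ e3) (hP t _ e3)) (Utau _ el).
  have h4 := hn_dist n st.
  have h5 : Lam * tau n <= e / 3.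
    apply: le_trans (_ : (Lam + 1) * tau n <= _); first by rewrite ler_wpM2r ?(ltW (tau0 n))// lerDl.
    by rewrite mulrC -ler_pdivlMr// ltr_wpDl.
  move: h1 h2 h4; rewrite mulrDr !ler_norml; lra.
exists h; split => //.
  move=> t tt; apply/eqP; rewrite -subr_eq0 -normr_eq0 eq_le normr_ge0 andbT.
  apply/ler_addgt0Pr => e e0; rewrite add0r.
  have /Uex[n /=] := hP t _ e0.
  by rewrite /hn idx_before// distrC.
move=> s g C a b d s1 bg ta ab d0 hW; apply/ler_addgt0Pr => e e0.
have C0 := bmf_ge0 bg; have L0 := Lam0.
(* Convergence to [h] is only pointwise, while the squares have to stay within [d] of [h] over all
   of [[a, b]]. A finite grid of mesh [eta], with the common Lipschitz bound, makes it uniform; the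
   mesh is such that the path moves by at most [d / 8] between grid points. *)
pose eta := d / (8 * (Lam + 1)).
have L1 : 0 < Lam + 1 by rewrite ltr_wpDl.
have eta0 : 0 < eta by rewrite divr_gt0// mulr_gt0.
have etaL : (Lam + 1) * eta = d / 8 by rewrite /eta; field; rewrite gt_eqF.
have Leta : Lam * eta <= d / 8 by rewrite -etaL ler_wpM2r ?(ltW eta0)// lerDl.
have eta8 : eta <= d / 8 by rewrite -etaL ler_peMl ?(ltW eta0)// lerDr.
pose m := (Num.truncn ((b - a) / eta)).+1.
have Ugrid : U [set n | forall i, (i < m)%N ->
    `|hn n (a + i%:R * eta) - h (a + i%:R * eta)| <= d / 8].
  elim: m => [|m' IH]; first by apply: filterS filterT.
  have d8 : 0 < d / 8 by rewrite divr_gt0.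
  apply: filterS (UI _ _ IH (hP (a + m'%:R * eta) _ d8)) => n [/= h1 h2] i.
  by rewrite ltnS leq_eqVlt => /predU1P[->//|]; exact: h1.
have e4 : 0 < e / 4 by rewrite divr_gt0.
have LC : 0 < Lam + 2 * C + 1 by rewrite ltr_wpDl ?addr_ge0// mulr_ge0.
have et : 0 < Num.min eta (e / 4 / (Lam + 2 * C + 1)) by rewrite lt_min eta0 divr_gt0.
have /Uex[n /= [[hg [ha hb']]]] :=
  UI _ _ (UI _ _ Ugrid (UI _ _ (hP a _ e4) (hP b _ e4))) (Utau _ et).
rewrite le_min => /andP[te]; rewrite ler_pdivlMr// => te'.
have t0 := tau0 n.
have Lte : Lam * tau n <= d / 8.
  by apply: le_trans Leta; rewrite ler_wpM2l.
have near_h t : a <= t <= b -> `|hn n t - h t| <= d / 2.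
  move=> /andP[at_ tb].
  have h0 : 0 <= (t - a) / eta by rewrite divr_ge0 ?subr_ge0 ?(ltW eta0).
  have /andP[i1 i2] := truncn_itv h0; set i := Num.truncn _ in i1 i2.
  have im : (i < m)%N.
    rewrite ltnS; apply: le_truncn; rewrite ler_wpM2r ?invr_ge0 ?(ltW eta0)//; lra.
  rewrite ler_pdivlMr// in i1; rewrite ltr_pdivrMr// -natr1 mulrDl mul1r in i2.
  have h1 := hg _ im; set p := a + i%:R * eta in h1.
  have pt : p <= t by rewrite /p; lra.
  have tp : t - p <= eta by rewrite /p; lra.
  have h2 := hn_dist n pt; have h3 := hlip p t.
  rewrite [X in _ * X]ger0_norm ?subr_ge0// in h3.
  have h4 : Lam * (t - p) <= d / 8 by apply: le_trans Leta; rewrite ler_wpM2l.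
  by move: h1 h2 h3; rewrite mulrDr !ler_norml; lra.
have := @hn_increment s g C n a b s1 bg ta ab.
have hyp : forall j, a <= tk n j -> tk n j.+1 <= b ->
    {ae mu, forall t, tk n j <= t <= tk n j.+1 ->
     {ae mu, forall x, euler n j <= x <= euler n j + tau n -> s * W (t, x) <= g t}}.
  move=> j aj jb; apply: (aeS hW) => t ht tj.
  have tj' : a <= t <= b by lra.
  apply: (aeS (ht tj')) => x hx xj; apply: hx.
  have h1 := near_h (tk n j) ltac:(rewrite tkS in jb; lra).
  rewrite /hn idx_tk in h1; have h2 := hlip (tk n j) t.
  rewrite tkS in tj; rewrite [X in _ * X]ger0_norm in h2; last by lra.
  have h3 : Lam * (t - tk n j) <= d / 8.
    by apply: le_trans Lte; rewrite ler_wpM2l//; lra.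
  by move: h1 h2; rewrite !ler_norml; lra.
move=> /(_ hyp) h1.
have h2 : (Lam + 2 * C) * tau n <= e / 4.
  by apply: le_trans te'; rewrite mulrC ler_wpM2l ?(ltW t0)// lerDl.
have h3 : s * ((h b - hn n b) - (h a - hn n a)) <= e / 2.
  apply: le_trans (ler_norm _) _; rewrite normrM.
  apply: le_trans (ler_pM _ _ s1 (lexx _)) _ => //; rewrite mul1r.
  by apply: le_trans (ler_normB _ _) _; rewrite !(distrC (h _)); lra.
lra.
Unshelve. all: by end_near.
Qed.

End EulerPath.

(** * Blow-up at a point of the path *)

Section PairingBox.
Context {R : realType}.
Local Notation mu := (@lebesgue_measure R).
Local Notation mu2 := (@lebesgue_measure R \x @lebesgue_measure R)%E.

Definition supported (a b : R) (psi : R -> R) := forall t, t < a \/ b < t -> psi t = 0.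

Lemma supported_derive1 (a b : R) psi : supported a b psi -> supported a b (derive1 psi).
Proof.
move=> h t [ta|bt].
  apply: (@derive1_eq0 _ _ (t - 1) a); last by rewrite ta; lra.
  by move=> y /andP[_ ya]; apply: h; left.
apply: (@derive1_eq0 _ _ b (t + 1)); last by rewrite bt; lra.
by move=> y /andP[ya _]; apply: h; right.
Qed.

Lemma continuous_measurable (g : R -> R) : continuous g -> measurable_fun setT g.
Proof. exact: continuous_measurable_fun. Qed.

Lemma supported_bmf (a b : R) psi : a <= b -> continuous psi -> supported a b psi ->
  exists C, bmf psi C.
Proof.
move=> ab cp sp; have [C C0 hC] := continuous_itv_bounded ab cp.
exists C; split; first exact: continuous_measurable.
move=> t; have [tab|] := boolP (a <= t <= b); first exact: hC.
by rewrite negb_and -!ltNge => /orP h; rewrite sp ?normr0 ?ltW.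
Qed.

Lemma Rintegral_supported (G : R * R -> R) (D E : set (R * R)) :
  measurable D -> measurable E -> E `<=` D -> (forall p, ~ E p -> G p = 0) ->
  \int[mu2]_(p in D) G p = \int[mu2]_(p in E) G p.
Proof.
move=> mD mE ED G0; rewrite Rintegral_mkcond [RHS]Rintegral_mkcond.
apply: eq_Rintegral => p _; rewrite !patchE.
have [pE|pE] := pselect (E p); first by rewrite !ifT ?mem_set//; exact: ED.
by rewrite (G0 _ pE); case: ifP; case: ifP.
Qed.

Lemma measurable_half_plane : measurable (half_plane : set (R * R)).
Proof.
have -> : half_plane = (`]0, +oo[%classic : set R) `*` (setT : set R).
  by apply/seteqP; split => -[t x] /=; rewrite /half_plane /= in_itv /= andbT => //; case.
exact: measurableX.
Qed.

Section Box.
Context (psi chi : R -> R) (a b c d : R).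
Hypothesis ps : smooth1 psi.
Hypothesis cs : smooth1 chi.
Hypothesis a0 : 0 < a.
Hypothesis ab : a <= b.
Hypothesis cd : c <= d.
Hypothesis sp : supported a b psi.
Hypothesis sc : supported c d chi.

Let sp' := supported_derive1 sp.
Let sc' := supported_derive1 sc.
Let cont (g : R -> R) (sg : smooth1 g) : continuous g := smooth1_continuous sg.

Let box_integrand (A B : R -> R) (U : R * R -> R) (p : R * R) :=
  A (U p) * (derive1 psi p.1 * chi p.2) + B (U p) * (psi p.1 * derive1 chi p.2).

Let box_bm2 (A B : R -> R) U CA CB : bm2 (fun p => A (U p)) CA ->
  bm2 (fun p => B (U p)) CB -> exists C, bm2 (box_integrand A B U) C.
Proof.
move=> bA bB; have [C1 b1] := supported_bmf ab (cont ps) sp.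
have [C2 b2] := supported_bmf ab (cont (smooth1_derive1 ps)) sp'.
have [C3 b3] := supported_bmf cd (cont cs) sc.
have [C4 b4] := supported_bmf cd (cont (smooth1_derive1 cs)) sc'.
eexists; exact: (bm2D (bm2M bA (bm2M (bm2_fst b2) (bm2_snd b3)))
  (bm2M bB (bm2M (bm2_fst b1) (bm2_snd b4)))).
Qed.

Let weak_pairing_box2 (A B : R -> R) U : weak_pairing A B U (tensor psi chi) =
  \int[mu2]_(p in `[a, b] `*` `[c, d]) box_integrand A B U p.
Proof.
rewrite weak_pairing_tensor// -/(box_integrand A B U).
rewrite (@Rintegral_supported _ _ (`[a, b] `*` `[c, d])) //.
- exact: measurable_half_plane.
- exact: measurableX.
- by move=> [t x] [/=]; rewrite in_itv /= => /andP[h _] _; exact: lt_le_trans h.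
move=> [t x] /=; rewrite !in_itv /= => h; rewrite /box_integrand /=.
have [tb|] := boolP (a <= t <= b); last first.
  by rewrite negb_and -!ltNge => /orP h'; rewrite sp// sp'// !mul0r !mulr0 addr0.
have [xb|] := boolP (c <= x <= d); first by exfalso; apply: h.
by rewrite negb_and -!ltNge => /orP h'; rewrite sc// sc'// !mulr0 addr0.
Qed.

Lemma weak_pairing_box (A B : R -> R) U CA CB :
  bm2 (fun p => A (U p)) CA -> bm2 (fun p => B (U p)) CB ->
  weak_pairing A B U (tensor psi chi) = \int[mu]_(t in `[a, b])
   (derive1 psi t * (\int[mu]_(x in `[c, d]) (A (U (t, x)) * chi x)) +
    psi t * (\int[mu]_(x in `[c, d]) (B (U (t, x)) * derive1 chi x))).
Proof.
move=> bA bB; have [C bG] := box_bm2 bA bB.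
rewrite weak_pairing_box2 (Fubini_box _ _ _ _ bG).
have [C3 b3] := supported_bmf cd (cont cs) sc.
have [C4 b4] := supported_bmf cd (cont (smooth1_derive1 cs)) sc'.
apply: eq_Rintegral => t _; rewrite /box_integrand /=.
have bA' := bmfM (bm2_section t bA) b3.
have bB' := bmfM (bm2_section t bB) b4.
rewrite -!RintegralZl//; try exact: (bmf_integrable _ _ bA'); try exact: (bmf_integrable _ _ bB').
rewrite -RintegralD//.
- by apply: eq_Rintegral => x _; ring.
- exact: bmf_integrable (bmfM (bmf_cst _) bA').
- exact: bmf_integrable (bmfM (bmf_cst _) bB').
Qed.

Lemma weak_pairing_lin (A B A' B' : R -> R) U CA CB CA' CB' (r s : R) :
  bm2 (fun p => A (U p)) CA -> bm2 (fun p => B (U p)) CB ->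
  bm2 (fun p => A' (U p)) CA' -> bm2 (fun p => B' (U p)) CB' ->
  weak_pairing (fun v => r * A v + s * A' v) (fun v => r * B v + s * B' v) U (tensor psi chi)
  = r * weak_pairing A B U (tensor psi chi) + s * weak_pairing A' B' U (tensor psi chi).
Proof.
move=> bA bB bA' bB'; have [C bG] := box_bm2 bA bB; have [C' bG'] := box_bm2 bA' bB'.
have mD : measurable (`[a, b] `*` `[c, d]) by exact: measurableX.
have iG := bm2_integrable mD (box_lty a b c d) bG.
have iG' := bm2_integrable mD (box_lty a b c d) bG'.
rewrite !weak_pairing_box2 -!RintegralZl// -RintegralD//.
- by apply: eq_Rintegral => p _; rewrite /box_integrand; ring.
- by apply: (bm2_integrable mD (box_lty a b c d) (bm2M (bm2_fst (bmf_cst r)) bG)).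
- by apply: (bm2_integrable mD (box_lty a b c d) (bm2M (bm2_fst (bmf_cst s)) bG')).
Qed.

End Box.

(** The common form of the equation and of the entropy inequalities. The equation enters as two
    inequalities, for [(id, f)] and for its opposite, so that one jump inequality serves for all. *)
Definition tensor_nonneg (A B : R -> R) (U : R * R -> R) :=
  forall psi chi a b c d, smooth1 psi -> smooth1 chi -> 0 < a -> a <= b -> c <= d ->
    supported a b psi -> supported c d chi ->
    (forall t, 0 <= psi t) -> (forall x, 0 <= chi x) ->
    0 <= weak_pairing A B U (tensor psi chi).

End PairingBox.

Section IntegralLemmas.
Context {R : realType}.
Local Notation mu := (@lebesgue_measure R).

Lemma ae_neq (y : R) : {ae mu, forall x, x != y}.
Proof.
exists [set y]; split; [exact: measurable_set1|exact: lebesgue_measure_set1|].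
by move=> x /= /negP; rewrite negbK => /eqP.
Qed.

Lemma smooth1_FTC (F : R -> R) (a b : R) : smooth1 F -> a <= b ->
  \int[mu]_(x in `[a, b]) derive1 F x = F b - F a.
Proof.
move=> sF; rewrite le_eqVlt => /predU1P[->|ab].
  by rewrite subrr set_itv1 Rintegral_set1.
have cF : continuous F by exact: smooth1_continuous.
have cF' := smooth1_continuous (smooth1_derive1 sF).
rewrite /Rintegral (@continuous_FTC2 _ (derive1 F) F)//.
- exact: continuous_subspaceT.
- split; last 2 first.
  + by apply: cvg_at_right_filter; exact: cF.
  + by apply: cvg_at_left_filter; exact: cF.
  by move=> x _; have [] := sF 1.
Qed.

Lemma lipschitz_continuous (g : R -> R) (L : R) :
  (forall s t, `|g s - g t| <= L * `|s - t|) -> continuous g.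
Proof.
move=> gL x; have L0 : 0 <= L.
  by have := gL 1 0; rewrite subr0 normr1 mulr1; apply: le_trans.
apply/cvgrPdist_le => e e0; have L1 : 0 < L + 1 by lra.
near=> y; apply: (le_trans (gL _ _)).
apply: (@le_trans _ _ ((L + 1) * `|x - y|)); first by rewrite ler_wpM2r// lerDl.
rewrite mulrC -ler_pdivlMr//; near: y.
by apply: cvgr_dist_le; [exact: cvg_id|exact: divr_gt0].
Unshelve. all: by end_near. Qed.

Lemma two_sided_integral (G w : R -> R) (CG Cw c d y m p k : R) :
  bmf G CG -> bmf w Cw -> c <= y <= d -> 0 <= k ->
  {ae mu, forall x, c <= x <= d ->
    (y < x -> `|G x - p| <= k) /\ (x < y -> `|G x - m| <= k)} ->
  `|\int[mu]_(x in `[c, d]) (G x * w x) -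
    (m * \int[mu]_(x in `[c, y]) w x + p * \int[mu]_(x in `[y, d]) w x)|
  <= k * Cw * (d - c).
Proof.
move=> bG bw /andP[cy yd] k0 hG.
have bGw := bmfM bG bw; have Cw0 := bmf_ge0 bw.
rewrite (Rint_split cy yd bGw).
have half (r lo hi : R) : lo <= hi ->
   {ae mu, forall x, lo <= x <= hi -> `|G x - r| <= k} ->
   `|\int[mu]_(x in `[lo, hi]) (G x * w x) - r * \int[mu]_(x in `[lo, hi]) w x|
     <= k * Cw * (hi - lo).
  move=> lohi hr; have brw := bmfM (bmf_cst r) bw.
  rewrite -RintegralZl//; last exact: bmf_integrable bw.
  rewrite -RintegralB//; [|exact: bmf_integrable bGw|exact: bmf_integrable brw].
  have bd := bmfD bGw (bmfN brw).
  apply: le_trans (le_normr_Rintegral _ (bmf_integrable _ _ bd)) _ => //.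
  rewrite -Rint_cst//; apply: (Rint_le_ae (bmf_norm bd) (bmf_cst _)).
  apply: (aeS hr) => x hx /hx h.
  by rewrite -mulrBl normrM ler_pM//; case: bw.
have h1 : {ae mu, forall x, c <= x <= y -> `|G x - m| <= k}.
  apply: (ae2S hG (ae_neq y)) => x hx xy cxy.
  have [_] := hx ltac:(lra); apply.
  by rewrite lt_neqAle xy; lra.
have h2 : {ae mu, forall x, y <= x <= d -> `|G x - p| <= k}.
  apply: (ae2S hG (ae_neq y)) => x hx xy cxy.
  have [+ _] := hx ltac:(lra); apply.
  by rewrite lt_neqAle eq_sym xy; lra.
have := half m c y cy h1; have := half p y d yd h2.
set I1 := (\int[mu]_(x in `[c, y]) (G x * w x)).
set I2 := (\int[mu]_(x in `[y, d]) (G x * w x)).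
set J1 := m * _; set J2 := p * _.
rewrite !ler_norml; lra.
Qed.

(** The derivative of the rescaled step is a nonnegative bump of mass 1 on [[a, a + w]]; integrating
    against it evaluates [g] at [a] up to its oscillation. *)
Lemma step_mollify (g : R -> R) (Cg L a w lo hi : R) : bmf g Cg -> 0 < w -> 0 <= L ->
  (forall t, a <= t <= a + w -> `|g t - g a| <= L * w) -> lo <= a -> a + w <= hi ->
  `|\int[mu]_(t in `[lo, hi]) (derive1 (fun t => step ((t - a) / w)) t * g t) - g a|
  <= L * w.
Proof.
move=> bg w0 L0 gL loa ahi.
have sS := smooth1_step_affine a w.
have h1 : \int[mu]_(t in `[lo, hi]) derive1 (fun t => step ((t - a) / w)) t = 1.
  rewrite smooth1_FTC//; last by lra.
  rewrite step_ge1 ?step_le0 ?subr0//.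
    by rewrite ler_pdivrMr// mul0r subr_le0.
  by rewrite ler_pdivlMr// mul1r; lra.
have [CS CS0 hS] := @derive1_step_bounded R.
have bS : bmf (derive1 (fun t => step ((t - a) / w))) (CS / w).
  split; first exact: continuous_measurable (smooth1_continuous (smooth1_derive1 sS)).
  move=> t; rewrite derive1_step_affine; have /andP[h2 h3] := hS ((t - a) / w).
  by rewrite ger0_norm ?divr_ge0 ?(ltW w0)// ler_pM2r ?invr_gt0.
have bSg := bmfM bS bg.
have -> : g a = \int[mu]_(t in `[lo, hi]) (derive1 (fun t => step ((t - a) / w)) t * g a).
  by rewrite RintegralZr ?h1 ?mul1r//; exact: bmf_integrable bS.
have bSa := bmfM bS (bmf_cst (g a)).
rewrite -RintegralB//; [|exact: bmf_integrable bSg|exact: bmf_integrable bSa].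
have bd := bmfD bSg (bmfN bSa).
apply: le_trans (le_normr_Rintegral _ (bmf_integrable _ _ bd)) _ => //.
have bSL := bmfM bS (bmf_cst (L * w)).
apply: (@le_trans _ _ (\int[mu]_(t in `[lo, hi])
    (derive1 (fun t => step ((t - a) / w)) t * (L * w)))); last first.
  by rewrite RintegralZr ?h1 ?mul1r//; exact: bmf_integrable bS.
apply: (Rint_le (bmf_norm bd) bSL) => t tt.
rewrite -mulrBr normrM derive1_step_affine.
have /andP[h2 _] := hS ((t - a) / w).
rewrite (ger0_norm (divr_ge0 h2 (ltW w0))).
have [tw|] := boolP (a <= t <= a + w).
  by rewrite ler_wpM2l ?gL// divr_ge0// ltW.
rewrite negb_and -!ltNge => /orP h; rewrite derive1_step_out ?mul0r//.
case: h => h; [left|right].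
  by rewrite pmulr_llt0 ?invr_gt0// subr_lt0.
by rewrite ltr_pdivlMr// mul1r; lra.
Qed.

End IntegralLemmas.

(** * Jump inequalities from localized test functions *)

Section BlowUp.
Context {R : realType}.
Local Notation mu := (@lebesgue_measure R).

Lemma dist_sub_le (x y u v e : R) : `|x - u| <= e -> `|y - v| <= e ->
  `|x - y - (u - v)| <= 2 * e.
Proof. by rewrite !ler_norml; lra. Qed.

(* Near [t0], [U] is close to its one-sided values [m], [p] along [h], with an
   error [k t] of small mean. *)
Definition blow_up (U : R * R -> R) (h : R -> R) (t0 m p : R) :=
  forall e, 0 < e -> exists d k C, [/\ 0 < d, bmf k C, forall t, 0 <= k t,
    forall r, 0 < r -> r < d -> \int[mu]_(t in `[t0 - r, t0 + r]) k t <= e * r &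
    {ae mu, forall t, t0 - d <= t <= t0 + d -> {ae mu, forall x,
      (h t < x -> x < h t + d -> `|U (t, x) - p| <= k t) /\
      (x < h t -> h t - d < x -> `|U (t, x) - m| <= k t)}}].

Context (A B : R -> R) (U : R * R -> R) (h : R -> R) (M CA CB LA Lam t0 m p : R).
Hypothesis UM : forall q, - M <= U q <= M.
Hypothesis bA : bm2 (fun q => A (U q)) CA.
Hypothesis bB : bm2 (fun q => B (U q)) CB.
Hypothesis LA0 : 0 <= LA.
Hypothesis lipA : forall x y, - M <= x <= M -> - M <= y <= M ->
  `|A x - A y| <= LA * `|x - y|.
Hypothesis lipB : forall x y, - M <= x <= M -> - M <= y <= M ->
  `|B x - B y| <= LA * `|x - y|.
Hypothesis hlip : forall s t, `|h s - h t| <= Lam * `|s - t|.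
Hypothesis Lam0 : 0 <= Lam.
Hypothesis t00 : 0 < t0.
Hypothesis mM : - M <= m <= M.
Hypothesis pM : - M <= p <= M.
Hypothesis hbu : blow_up U h t0 m p.
Hypothesis hpos : tensor_nonneg A B U.

Section JumpAux.
Context (CS th e d : R) (k : R -> R) (C r a b : R).
Hypothesis hCS : forall x, 0 <= derive1 (@step R) x <= CS.
Hypothesis CS0 : 0 < CS.
Hypothesis th01 : 0 < th <= 1.
Hypothesis bk : bmf k C.
Hypothesis k0 : forall t, 0 <= k t.
Hypothesis hk : forall r, 0 < r -> r < d -> \int[mu]_(t in `[t0 - r, t0 + r]) k t <= e * r.
Hypothesis hU : {ae mu, forall t, t0 - d <= t <= t0 + d -> {ae mu, forall x,
      (h t < x -> x < h t + d -> `|U (t, x) - p| <= k t) /\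
      (x < h t -> h t - d < x -> `|U (t, x) - m| <= k t)}}.
Hypothesis r0 : 0 < r.
Hypothesis rd : (4 * Lam + 4) * r < d.
Hypothesis rt : 2 * r < t0.
Hypothesis ra : t0 - r <= a.
Hypothesis ab : a <= b.
Hypothesis br : b <= t0 + r.

(** The test function lives on a window of size comparable to [r]. The flat part of [chi] has
    half-width [D], larger than the displacement [2 * Lam * r] of the path, so that the mass of
    [chi] on either side of [h t] is affine in [h t]. The time cut-offs have width [th * r]. [g] is
    [h - h t0], with time clipped to keep it bounded. *)
Let w := th * r.
Let x0 := h t0.
Let D := 2 * Lam * r + r.
Let c := x0 - D - r.
Let xd := x0 + D + r.
Let chi := plateau c (x0 + D) r.
Let psi := plateau a b w.
Let g t := h (t0 + clip (2 * r) (t - t0)) - x0.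

Let w0 : 0 < w. Proof. by case/andP: th01 => *; rewrite mulr_gt0. Qed.
Let wr : w <= r. Proof. by case/andP: th01 => *; rewrite ger_pMl. Qed.
Let Lr0 : 0 <= Lam * r. Proof. by rewrite mulr_ge0// ltW. Qed.
Let D0 : 0 < D. Proof. by have h1 := Lr0; have h2 := r0; rewrite /D; lra. Qed.
Let cD : c <= x0 + D.
Proof. by have h1 := D0; have h2 := r0; rewrite /c; lra. Qed.
Let cxd : c <= xd.
Proof. by have h1 := D0; have h2 := r0; rewrite /c /xd; lra. Qed.
Let schi : smooth1 chi. Proof. exact: smooth1_plateau. Qed.
Let spsi : smooth1 psi. Proof. exact: smooth1_plateau. Qed.

Let suppchi : supported c xd chi.
Proof.
move=> x hx; apply: plateau0 => //; have h1 := r0; rewrite /xd in hx.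
by case: hx => ?; [left|right]; lra.
Qed.

Let supppsi : supported a (b + w) psi.
Proof.
by move=> x hx; apply: plateau0 => //; case: hx => /ltW ?; [left|right].
Qed.

Let chi01 x : 0 <= chi x <= 1. Proof. exact: plateau_itv. Qed.
Let psi01 x : 0 <= psi x <= 1. Proof. exact: plateau_itv. Qed.

Let a0 : 0 < a.
Proof. by have h1 := rt; have h2 := ra; have h3 := r0; lra. Qed.

Let abw : a <= b + w.
Proof. by have h1 := w0; have h2 := ab; lra. Qed.

Let bchi : bmf chi 1.
Proof.
split; first exact: continuous_measurable (smooth1_continuous schi).
by move=> x; have /andP[h1 h2] := chi01 x; rewrite ger0_norm.
Qed.

Let bpsi : bmf psi 1.
Proof.
split; first exact: continuous_measurable (smooth1_continuous spsi).
by move=> x; have /andP[h1 h2] := psi01 x; rewrite ger0_norm.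
Qed.

Let dplateau (u v z t : R) : 0 < z -> `|derive1 (plateau u v z) t| <= CS / z.
Proof.
move=> z0; rewrite derive1_plateau.
rewrite -mulrBl normrM (ger0_norm (_ : 0 <= z^-1)) ?invr_ge0 ?(ltW z0)//.
rewrite ler_pM2r ?invr_gt0//.
move: (hCS ((t - u) / z)) (hCS ((t - v) / z)).
move: (derive1 _ _) (derive1 _ _) => y1 y2 y1C y2C.
rewrite ler_norml; lra.
Qed.

Let bdchi : bmf (derive1 chi) (CS / r).
Proof.
split; last by move=> t; exact: dplateau.
exact: continuous_measurable (smooth1_continuous (smooth1_derive1 schi)).
Qed.

Let bdpsi : bmf (derive1 psi) (CS / w).
Proof.
split; last by move=> t; exact: dplateau.
exact: continuous_measurable (smooth1_continuous (smooth1_derive1 spsi)).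
Qed.

Let gE t : t0 - 2 * r <= t <= t0 + 2 * r -> g t = h t - x0.
Proof. by move=> tt; rewrite /g clip_id ?subrKC//; lra. Qed.

Let glip s t : `|g s - g t| <= Lam * `|s - t|.
Proof.
have -> : g s - g t = h (t0 + clip (2 * r) (s - t0)) - h (t0 + clip (2 * r) (t - t0)).
  by rewrite /g opprB addrA subrK.
apply: (le_trans (hlip _ _)); rewrite ler_wpM2l//.
rewrite opprD addrACA subrr add0r.
by apply: le_trans (clip_dist _ _ _) _; rewrite opprB addrA subrK.
Qed.

Let gb t : `|g t| <= 2 * Lam * r.
Proof.
have r20 : 0 <= 2 * r by rewrite mulr_ge0// ltW.
apply: le_trans (hlip _ _) _.
rewrite [t0 + _]addrC addrK -mulrA mulrCA ler_wpM2l//.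
by rewrite ler_norml clip_itv.
Qed.

Let bg : bmf g (2 * Lam * r).
Proof. by split => //; apply: continuous_measurable; exact: lipschitz_continuous glip. Qed.

Let window t : a <= t <= b + w -> t0 - 2 * r <= t <= t0 + 2 * r.
Proof.
have h1 := wr; have h2 := ra; have h3 := br; have h4 := r0.
move=> ?; lra.
Qed.

Let gD t : t0 - 2 * r <= t <= t0 + 2 * r -> `|h t - x0| <= 2 * Lam * r.
Proof. by move=> /gE <-. Qed.

Let X0 := \int[mu]_(x in `[c, x0]) chi x.
Let X1 := \int[mu]_(x in `[x0, xd]) chi x.

Let cx0 : c <= x0. Proof. by have h1 := D0; have h2 := r0; rewrite /c; lra. Qed.
Let x0d : x0 <= xd. Proof. by have h1 := D0; have h2 := r0; rewrite /xd; lra. Qed.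

Let chi_one (y z : R) : x0 - D <= y -> y <= z -> z <= x0 + D ->
  \int[mu]_(x in `[y, z]) chi x = z - y.
Proof.
move=> yD yz zD; rewrite -[RHS]mul1r -Rint_cst//.
apply: eq_Rintegral => x; rewrite inE /= in_itv /= => yxz.
by apply: plateau1 => //; rewrite /c subrK; lra.
Qed.

Let Xl y : x0 - D <= y <= x0 + D ->
  \int[mu]_(x in `[c, y]) chi x = X0 + (y - x0) /\
  \int[mu]_(x in `[y, xd]) chi x = X1 - (y - x0).
Proof.
have D0' := D0; have r0' := r0.
have cd' : c <= x0 - D by rewrite /c; lra.
have xd' : x0 + D <= xd by rewrite /xd; lra.
have cx0D : x0 <= x0 + D by rewrite lerDl ltW.
have x0Dc : x0 - D <= x0 by rewrite gerBl ltW.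
move=> /andP[y1 y2]; have [yx|/ltW yx] := leP y x0.
  have h1 := Rint_split (le_trans cd' y1) yx bchi.
  have h2 := Rint_split yx x0d bchi.
  have h3 := chi_one y1 yx cx0D.
  rewrite /X0 /X1 h1 h2 h3; split; ring.
have h1 := Rint_split cx0 yx bchi.
have h2 := Rint_split yx (le_trans y2 xd') bchi.
have h3 := chi_one x0Dc yx y2.
rewrite /X0 /X1 h1 h2 h3; split; ring.
Qed.

Let dXl y : x0 - D <= y <= x0 + D ->
  \int[mu]_(x in `[c, y]) derive1 chi x = 1 /\
  \int[mu]_(x in `[y, xd]) derive1 chi x = - 1.
Proof.
have D0' := D0; have r0' := r0; move=> /andP[y1 y2].
have h1 : chi y = 1 by apply: plateau1 => //; rewrite /c; lra.
have h2 : chi c = 0 by apply: plateau0 => //; left.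
have h3 : chi xd = 0 by apply: plateau0 => //; right.
rewrite !smooth1_FTC ?h1 ?h2 ?h3 ?subr0 ?sub0r//.
  by rewrite /xd; lra.
by rewrite /c; lra.
Qed.

Let E := (CS / w * LA + LA * (CS / r)) * (xd - c).
Let K0 := A m * X0 + A p * X1.
(** The time integrand after [U] is replaced by [m] on the left of the path and by [p] on the right.
    [K0] multiplies [psi'], of integral 0, and disappears; [E * k t] bounds the error of the
    replacement. *)
Let rhs t := derive1 psi t * (K0 + (A m - A p) * g t) + psi t * (B m - B p) + E * k t.

Let brhs : exists C', bmf rhs C'.
Proof.
eexists; apply: bmfD; first apply: bmfD.
- by apply: (bmfM bdpsi); apply: (bmfD (bmf_cst _)); exact: (bmfM (bmf_cst _) bg).
- exact: (bmfM bpsi (bmf_cst _)).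
- exact: (bmfM (bmf_cst _) bk).
Qed.

Let lhs t := derive1 psi t * (\int[mu]_(x in `[c, xd]) (A (U (t, x)) * chi x)) +
    psi t * (\int[mu]_(x in `[c, xd]) (B (U (t, x)) * derive1 chi x)).

Let blhs : exists C', bmf lhs C'.
Proof.
have bIA := bm2_inner cxd (bm2M bA (bm2_snd bchi)).
have bIB := bm2_inner cxd (bm2M bB (bm2_snd bdchi)).
by eexists; exact: (bmfD (bmfM bdpsi bIA) (bmfM bpsi bIB)).
Qed.

Let hP : 0 <= \int[mu]_(t in `[a, b + w]) lhs t.
Proof.
rewrite -(weak_pairing_box spsi schi a0 abw cxd supppsi suppchi bA bB).
by apply: (hpos spsi schi a0 abw cxd supppsi suppchi) => t; [case/andP: (psi01 t)|case/andP: (chi01 t)].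
Qed.

Let near_box t : a <= t <= b + w ->
  {ae mu, forall x,
      (h t < x -> x < h t + d -> `|U (t, x) - p| <= k t) /\
      (x < h t -> h t - d < x -> `|U (t, x) - m| <= k t)} ->
  {ae mu, forall x, c <= x <= xd ->
     (h t < x -> `|U (t, x) - p| <= k t) /\ (x < h t -> `|U (t, x) - m| <= k t)}.
Proof.
move=> tab ht; have := gD (window tab); rewrite ler_norml => hD.
have rd' := rd; have r0' := r0; have Lr0' := Lr0.
apply: (aeS ht) => x [h1 h2] cx; rewrite /c /xd /D in cx; split => hx.
  by apply: h1 => //; lra.
by apply: h2 => //; lra.
Qed.

Let key t : a <= t <= b + w ->
  {ae mu, forall x, c <= x <= xd ->
     (h t < x -> `|U (t, x) - p| <= k t) /\ (x < h t -> `|U (t, x) - m| <= k t)} ->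
  lhs t <= rhs t.
Proof.
move=> tab near; have tw := window tab.
have hy : x0 - D <= h t <= x0 + D.
  by have := gD tw; rewrite ler_norml /D; have r0' := r0; lra.
have cyd : c <= h t <= xd by have r0' := r0; rewrite /c /xd; lra.
have nearA : {ae mu, forall x, c <= x <= xd ->
   (h t < x -> `|A (U (t, x)) - A p| <= LA * k t) /\
   (x < h t -> `|A (U (t, x)) - A m| <= LA * k t)}.
  apply: (aeS near) => x hx cx; have [h1 h2] := hx cx; split => hx'.
    by apply: (le_trans (lipA _ _)) => //; rewrite ler_wpM2l// h1.
  by apply: (le_trans (lipA _ _)) => //; rewrite ler_wpM2l// h2.
have nearB : {ae mu, forall x, c <= x <= xd ->
   (h t < x -> `|B (U (t, x)) - B p| <= LA * k t) /\
   (x < h t -> `|B (U (t, x)) - B m| <= LA * k t)}.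
  apply: (aeS near) => x hx cx; have [h1 h2] := hx cx; split => hx'.
    by apply: (le_trans (lipB _ _)) => //; rewrite ler_wpM2l// h1.
  by apply: (le_trans (lipB _ _)) => //; rewrite ler_wpM2l// h2.
have Lk0 : 0 <= LA * k t by rewrite mulr_ge0.
have iA := two_sided_integral (bm2_section t bA) bchi cyd Lk0 nearA.
have iB := two_sided_integral (bm2_section t bB) bdchi cyd Lk0 nearB.
have [e1 e2] := Xl hy; have [e3 e4] := dXl hy.
rewrite e1 e2 in iA; rewrite e3 e4 in iB.
rewrite /lhs.
set IA := \int[mu]_(x in _) (A _ * _) in iA *.
set IB := \int[mu]_(x in _) (B _ * _) in iB *.
have -> : rhs t = derive1 psi t * (A m * (X0 + (h t - x0)) + A p * (X1 - (h t - x0))) +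
    psi t * (B m * 1 + B p * - 1) + E * k t.
  by rewrite /rhs gE// /K0; ring.
set YA := A m * _ + _ in iA *; set YB := B m * 1 + _ in iB *.
have h1 : derive1 psi t * (IA - YA) <= CS / w * (LA * k t * 1 * (xd - c)).
  apply: le_trans (ler_norm _) _; rewrite normrM ler_pM//.
  by case: bdpsi.
have h2 : psi t * (IB - YB) <= 1 * (LA * k t * (CS / r) * (xd - c)).
  apply: le_trans (ler_norm _) _; rewrite normrM ler_pM//.
  by case: bpsi.
have -> : E * k t = CS / w * (LA * k t * 1 * (xd - c)) +
    1 * (LA * k t * (CS / r) * (xd - c)) by rewrite /E; ring.
lra.
Qed.

Let irhs : \int[mu]_(t in `[a, b + w]) rhs t =
  K0 * \int[mu]_(t in `[a, b + w]) derive1 psi t +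
  (A m - A p) * \int[mu]_(t in `[a, b + w]) (derive1 psi t * g t) +
  (B m - B p) * \int[mu]_(t in `[a, b + w]) psi t +
  E * \int[mu]_(t in `[a, b + w]) k t.
Proof.
have bpg := bmfM bdpsi bg.
have b1 := bmfM (bmf_cst K0) bdpsi.
have b2 := bmfM (bmf_cst (A m - A p)) bpg.
have b3 := bmfM (bmf_cst (B m - B p)) bpsi.
have b4 := bmfM (bmf_cst E) bk.
rewrite -!RintegralZl//; try exact: bmf_integrable bdpsi; try exact: bmf_integrable bpg;
  try exact: bmf_integrable bpsi; try exact: bmf_integrable bk.
rewrite -RintegralD//; [|exact: bmf_integrable b1|exact: bmf_integrable b2].
rewrite -RintegralD//; [|exact: bmf_integrable (bmfD b1 b2)|exact: bmf_integrable b3].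
rewrite -RintegralD//; [|exact: bmf_integrable (bmfD (bmfD b1 b2) b3)|exact: bmf_integrable b4].
by apply: eq_Rintegral => t _; rewrite /rhs; ring.
Qed.

Let i1 : \int[mu]_(t in `[a, b + w]) derive1 psi t = 0.
Proof.
rewrite smooth1_FTC// {1}/psi plateau0//; last by right.
by rewrite /psi plateau0 ?subrr//; left.
Qed.

Let i2 : `|\int[mu]_(t in `[a, b + w]) (derive1 psi t * g t) - (g a - g b)| <= 2 * (Lam * w).
Proof.
have glw (u t : R) : u <= t <= u + w -> `|g t - g u| <= Lam * w.
  move=> /andP[ut tu]; apply: (le_trans (glip _ _)).
  by rewrite ler_wpM2l// ger0_norm ?subr_ge0// lerBlDl.
have abw' : a + w <= b + w by rewrite lerD2r.
have m1 := step_mollify bg w0 Lam0 (glw a) (lexx a) abw'.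
have m2 := step_mollify bg w0 Lam0 (glw b) ab (lexx (b + w)).
have bst u : bmf (derive1 (fun t => step ((t - u) / w))) (CS / w).
  split; first exact: continuous_measurable (smooth1_continuous
    (smooth1_derive1 (smooth1_step_affine u w))).
  move=> t; rewrite derive1_step_affine; have /andP[h2 h3] := hCS ((t - u) / w).
  by rewrite ger0_norm ?divr_ge0 ?(ltW w0)// ler_pM2r ?invr_gt0.
have -> : \int[mu]_(t in `[a, b + w]) (derive1 psi t * g t) =
   \int[mu]_(t in `[a, b + w]) (derive1 (fun t => step ((t - a) / w)) t * g t) -
   \int[mu]_(t in `[a, b + w]) (derive1 (fun t => step ((t - b) / w)) t * g t).
  rewrite -RintegralB//; [|exact: bmf_integrable (bmfM (bst a) bg)
    |exact: bmf_integrable (bmfM (bst b) bg)].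
  apply: eq_Rintegral => t _.
  by rewrite derive1_plateau !derive1_step_affine mulrBl.
exact: dist_sub_le m1 m2.
Qed.

Let gab : g a - g b = h a - h b.
Proof.
have -> : g a = h a - x0 by apply: gE; apply: window; rewrite lexx.
have -> : g b = h b - x0 by apply: gE; apply: window; rewrite ab lerDl ltW.
by rewrite opprB addrA subrK.
Qed.

Let i3 : `|\int[mu]_(t in `[a, b + w]) psi t - (b - a)| <= w.
Proof.
have w0' := w0; have ab' := ab.
have up : \int[mu]_(t in `[a, b + w]) psi t <= b + w - a.
  rewrite -[leRHS]mul1r -Rint_cst//; apply: (Rint_le bpsi (bmf_cst _)) => t _.
  by case/andP: (psi01 t).
have lo : b - a - w <= \int[mu]_(t in `[a, b + w]) psi t.
  have pos (u v : R) : 0 <= \int[mu]_(t in `[u, v]) psi t.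
    by apply: Rintegral_ge0 => t _; case/andP: (psi01 t).
  have [h1|h1] := leP (a + w) b; last first.
    by apply: le_trans (pos a (b + w)); lra.
  rewrite (@Rint_split _ psi 1 a (a + w) (b + w))//; [|lra|lra].
  rewrite (@Rint_split _ psi 1 (a + w) b (b + w))//; last by lra.
  have h2 : \int[mu]_(t in `[a + w, b]) psi t = b - (a + w).
    rewrite -[RHS]mul1r -Rint_cst//; apply: eq_Rintegral => t.
    by rewrite inE /= in_itv /= => tt; exact: plateau1.
  rewrite h2; move: (pos a (a + w)) (pos b (b + w)).
  by move: (Rintegral _ _ _) (Rintegral _ _ _) => I1 I2 *; lra.
move: up lo; move: (Rintegral _ _ _) => I1 *.
by rewrite ler_norml; lra.
Qed.

Let i4 : \int[mu]_(t in `[a, b + w]) k t <= 2 * e * r.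
Proof.
have r0' := r0; have Lr0' := Lr0; have rd' := rd; have ra' := ra; have br' := br.
have ab' := ab; have wr' := wr; have w0' := w0.
have r2 : 0 < 2 * r by lra.
have r2d : 2 * r < d by lra.
have := hk r2 r2d.
rewrite (@Rint_split _ k C _ a)//; [|lra|lra].
rewrite (@Rint_split _ k C a (b + w))//; last by lra.
have pos (u v : R) : 0 <= \int[mu]_(t in `[u, v]) k t by apply: Rintegral_ge0.
move: (pos (t0 - 2 * r) a) (pos (b + w) (t0 + 2 * r)).
move: (Rintegral _ _ _) (Rintegral _ _ _) (Rintegral _ _ _) => I1 I2 I3 *; lra.
Qed.

(** [psi'] is a bump at [a] minus a bump at [b] and [psi] is nearly the indicator of [[a, b]], so
    the integral of [rhs] is the jump expression with two errors: one of order [th * r] from the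
    width of the cut-offs, one of order [e * r] from [k], whose constant grows like [1 / th]. *)
Lemma jump_inequality_aux :
  0 <= (A p - A m) * (h b - h a) - (B p - B m) * (b - a) +
    (2 * Lam * `|A p - A m| + `|B p - B m|) * (th * r) +
    (CS / th * LA + LA * CS) * (4 * Lam + 4) * (2 * e * r).
Proof.
have [C1 b1] := blhs; have [C2 b2] := brhs.
have hle : \int[mu]_(t in `[a, b + w]) lhs t <= \int[mu]_(t in `[a, b + w]) rhs t.
  apply: (Rint_le_ae b1 b2); apply: (aeS hU) => t ht tab.
  apply: key => //; apply: near_box => //; apply: ht.
  have := window tab; have r0' := r0; have rd' := rd; have Lr0' := Lr0; lra.
have := le_trans hP hle; rewrite irhs i1 mulr0 add0r => hP'.
have E0 : 0 <= E.
  apply: mulr_ge0; last by rewrite subr_ge0.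
  by apply: addr_ge0; rewrite mulr_ge0 ?divr_ge0 ?(ltW CS0) ?(ltW w0) ?(ltW r0).
have h4 := ler_wpM2l E0 i4.
have th0 : 0 < th by case/andP: th01.
have EE : E * (2 * e * r) = (CS / th * LA + LA * CS) * (4 * Lam + 4) * (2 * e * r).
  rewrite /E /w (_ : xd - c = (4 * Lam + 4) * r); last by rewrite /xd /c /D; ring.
  by field; rewrite !gt_eqF.
have h5 : (A m - A p) * (\int[mu]_(t in `[a, b + w]) (derive1 psi t * g t) - (g a - g b))
    <= `|A p - A m| * (2 * (Lam * w)).
  apply: le_trans (ler_norm _) _; rewrite normrM (distrC (A m)).
  by rewrite ler_wpM2l// i2.
have h6 : (B m - B p) * (\int[mu]_(t in `[a, b + w]) psi t - (b - a)) <= `|B p - B m| * w.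
  apply: le_trans (ler_norm _) _; rewrite normrM (distrC (B m)).
  by rewrite ler_wpM2l// i3.
move: hP' h4 h5 h6; rewrite EE gab /w.
move: (\int[mu]_(t in _) (derive1 psi t * g t)) => I1.
move: (\int[mu]_(t in _) psi t) => I2.
move: (\int[mu]_(t in _) k t) => I3.
move: (_ * (2 * e * r)) => I4.
move: (`|A p - A m|) (`|B p - B m|) => I5 I6 *; lra.
Qed.

End JumpAux.

Lemma jump_inequality e : 0 < e -> exists2 d, 0 < d & forall r a b, 0 < r -> r < d ->
  t0 - r <= a -> a <= b -> b <= t0 + r ->
  - (e * r) <= (A p - A m) * (h b - h a) - (B p - B m) * (b - a).
Proof.
move=> e0; have [CS CS0 hCS] := @derive1_step_bounded R.
pose K1 := 2 * Lam * `|A p - A m| + `|B p - B m| + 1.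
have K10 : 0 < K1 by rewrite ltr_wpDl ?addr_ge0 ?mulr_ge0.
(* The width comes first and takes half of the error; the tolerance [e'] for the traces comes
   second, because its coefficient [K2] contains [1 / th]. *)
pose th := Num.min 1 (e / 2 / K1).
have th0 : 0 < th by rewrite lt_min ltr01 !divr_gt0.
have th1 : 0 < th <= 1 by rewrite th0 ge_min lexx.
have thK : K1 * th <= e / 2 by rewrite mulrC -ler_pdivlMr// ge_min lexx orbT.
pose K2 := (CS / th * LA + LA * CS) * (4 * Lam + 4) * 2 + 1.
have K20 : 0 < K2.
  rewrite ltr_wpDl//; apply: mulr_ge0 => //.
  apply: mulr_ge0; last by rewrite addr_ge0 ?mulr_ge0.
  apply: addr_ge0; apply: mulr_ge0 => //; last exact: ltW.
  by rewrite divr_ge0 ?(ltW th0) ?(ltW CS0).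
pose e' := e / 2 / K2.
have e'0 : 0 < e' by rewrite !divr_gt0.
have eK : K2 * e' = e / 2 by rewrite /e'; field; rewrite gt_eqF.
have [d [k [C [d0 bk k0 hk hU]]]] := hbu e'0.
have L40 : 0 < 4 * Lam + 4 by rewrite ltr_wpDl ?mulr_ge0.
exists (Num.min (d / (4 * Lam + 4)) (t0 / 2)); first by rewrite lt_min !divr_gt0.
move=> r a b r0; rewrite lt_min => /andP[rd rt] ra ab br.
rewrite ltr_pdivlMr// mulrC in rd; rewrite ltr_pdivlMr// mulrC in rt.
have h1 := jump_inequality_aux hCS CS0 th1 bk k0 hk hU r0 rd rt ra ab br.
have h2 : K1 * th * r <= e / 2 * r by rewrite ler_wpM2r// ltW.
have h3 : K2 * e' * r = e / 2 * r by rewrite eK.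
have h4 : 0 <= th * r by rewrite mulr_ge0// ltW.
have h5 : 0 <= e' * r by rewrite mulr_ge0// ltW.
move: h1 h2 h3 h4 h5; rewrite /K1 /K2.
move: (`|A p - A m|) (`|B p - B m|) => I5 I6 *; lra.
Qed.

End BlowUp.

(** * Derivative of the path at a blow-up point *)

Section PointConclusion.
Context {R : realType}.
Local Notation mu := (@lebesgue_measure R).

(* Integrated form of the differential inclusion of [h'] into the Filippov hull
   of [W (t, h)]; upper and lower bounds are the cases [s = 1] and [s = -1]. *)
Definition filippov (W : R * R -> R) (tbar : R) (h : R -> R) :=
  forall (s : R) (g : R -> R) (C a b d : R), `|s| <= 1 -> bmf g C ->
    tbar <= a -> a <= b -> 0 < d ->
    {ae mu, forall t, a <= t <= b ->
      {ae mu, forall x, h t - d < x < h t + d -> s * W (t, x) <= g t}} ->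
    s * (h b - h a) <= \int[mu]_(t in `[a, b]) g t.

Lemma is_derive_two_sided (h : R -> R) (t0 s : R) :
  (forall e, 0 < e -> exists2 d, 0 < d & forall r, 0 < r -> r < d ->
     `|h (t0 + r) - h t0 - s * r| <= e * r /\ `|h t0 - h (t0 - r) - s * r| <= e * r) ->
  is_derive t0 (1:R) h s.
Proof.
move=> hs; suff hc : (fun y => y^-1 *: (h (y *: (1:R) + t0) - h t0)) @ 0^' --> s.
  by split; [apply/cvg_ex; exists s|exact: cvg_lim hc].
apply/cvgrPdist_le => e e0; have [d d0 hd] := hs _ e0.
near=> y; have y0 : y != 0 by near: y; exact: nbhs_dnbhs_neq.
have yd : `|y| < d by near: y; apply: dnbhs0_lt.
have -> : s - y^-1 *: (h (y *: 1 + t0) - h t0) =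
    - (y^-1 * (h (t0 + y) - h t0 - s * y)).
  by rewrite /GRing.scale /= mulr1 (addrC y); field.
rewrite normrN normrM normfV ler_pdivrMl ?normr_gt0// [leRHS]mulrC.
move: y0; rewrite neq_lt => /orP[y0|y0]; last first.
  rewrite (gtr0_norm y0) in yd *.
  by have [h1 _] := hd _ y0 yd.
rewrite (ltr0_norm y0) in yd *.
have ny0 : 0 < - y by rewrite oppr_gt0.
have [_ h1] := hd _ ny0 yd; rewrite opprK in h1.
by rewrite (_ : h (t0 + y) - h t0 - s * y = - (h t0 - h (t0 + y) - s * - y)) ?normrN//; ring.
Unshelve. all: by end_near. Qed.

Context (f eta q V : R -> R) (U : R * R -> R) (h : R -> R)
  (M CV LV L Lam tbar t0 m p : R).
Hypothesis UM : forall z, - M <= U z <= M.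
Hypothesis mU : measurable_fun setT U.
Hypothesis LV0 : 0 <= LV.
Hypothesis lipV : forall x y, `|V x - V y| <= LV * `|x - y|.
Hypothesis L0 : 0 <= L.
Hypothesis L1 : 1 <= L.
Hypothesis lipf : forall x y, - M <= x <= M -> - M <= y <= M ->
  `|f x - f y| <= L * `|x - y|.
Hypothesis lipeta : forall x y, - M <= x <= M -> - M <= y <= M ->
  `|eta x - eta y| <= L * `|x - y|.
Hypothesis lipq : forall x y, - M <= x <= M -> - M <= y <= M ->
  `|q x - q y| <= L * `|x - y|.
Hypothesis cf : continuous f.
Hypothesis ceta : continuous eta.
Hypothesis cq : continuous q.
Hypothesis hlip : forall s t, `|h s - h t| <= Lam * `|s - t|.
Hypothesis Lam0 : 0 <= Lam.
Hypothesis tbar0 : 0 <= tbar.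
Hypothesis t0t : tbar < t0.
Hypothesis mM : - M <= m <= M.
Hypothesis pM : - M <= p <= M.
Hypothesis hbu : blow_up U h t0 m p.
Hypothesis hfil : filippov (fun z => V (U z)) tbar h.
Hypothesis weak1 : tensor_nonneg id f U.
Hypothesis weak2 : tensor_nonneg (fun v => - v) (fun v => - f v) U.
Hypothesis ent : tensor_nonneg eta q U.

Let M0 : - M <= M. Proof. by case/andP: mM; apply: le_trans. Qed.

Let bmU (A : R -> R) : continuous A -> exists C, bm2 (fun z => A (U z)) C.
Proof.
move=> cA; have [C _ hC] := continuous_itv_bounded M0 cA.
exists C; split; last by move=> z; apply: hC; exact: UM.
by apply: measurableT_comp => //; exact: continuous_measurable.
Qed.

(** On both sides of the path [s * V (U (t, x))] exceeds [W] by at most [LV * k t], and [k] is small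
    in mean; [filippov] integrates this bound. *)
Let increment_bound s W e : `|s| <= 1 -> s * V m <= W -> s * V p <= W -> 0 < e ->
  exists2 d, 0 < d & forall r a b, 0 < r -> r < d ->
    t0 - r <= a -> a <= b -> b <= t0 + r ->
    s * (h b - h a) <= W * (b - a) + e * r.
Proof.
move=> s1 mW pW e0; have LV1 : 0 < LV + 1 by rewrite ltr_wpDl.
have e1 : 0 < e / (LV + 1) by rewrite divr_gt0.
have [d [k [C [d0 bk k0 hk hU]]]] := hbu e1.
have tt0 : 0 < t0 - tbar by rewrite subr_gt0.
exists (Num.min d (t0 - tbar)); first by rewrite lt_min d0.
move=> r a b r0; rewrite lt_min => /andP[rd rt] ra ab br.
have ta : tbar <= a by lra.
have bg := bmfD (bmf_cst W) (bmfM (bmf_cst LV) bk).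
have key (z v : R) (t : R) : s * V v <= W -> `|z - v| <= k t -> s * V z <= W + LV * k t.
  move=> vW zv; have -> : s * V z = s * V v + s * (V z - V v) by ring.
  apply: lerD => //; apply: le_trans (ler_norm _) _; rewrite normrM -[leRHS]mul1r.
  apply: ler_pM => //; apply: le_trans (lipV _ _) _.
  by rewrite ler_wpM2l.
have hyp : {ae mu, forall t, a <= t <= b ->
    {ae mu, forall x, h t - d < x < h t + d -> s * V (U (t, x)) <= W + LV * k t}}.
  apply: (aeS hU) => t ht tab.
  have td : t0 - d <= t <= t0 + d by lra.
  apply: (ae2S (ht td) (ae_neq (h t))) => x [h1 h2] xh xd.
  move: xh; rewrite neq_lt => /orP[xh|xh].
    by apply: key mW _; apply: h2 => //; lra.
  by apply: key pW _; apply: h1 => //; lra.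
apply: le_trans (hfil s1 bg ta ab d0 hyp) _.
have bLk := bmfM (bmf_cst LV) bk.
rewrite RintegralD//; [|exact: bmf_integrable (bmf_cst W)|exact: bmf_integrable bLk].
rewrite Rint_cst// lerD2l RintegralZl//; last exact: bmf_integrable bk.
have h1 : \int[mu]_(t in `[a, b]) k t <= e / (LV + 1) * r.
  apply: le_trans (hk _ r0 rd).
  have arb : a <= t0 + r by lra.
  rewrite (Rint_split ra arb bk) (Rint_split ab br bk).
  have pos (u v : R) : 0 <= \int[mu]_(t in `[u, v]) k t by exact: Rintegral_ge0.
  move: (pos (t0 - r) a) (pos b (t0 + r)).
  by move: (Rintegral _ _ _) (Rintegral _ _ _) (Rintegral _ _ _) => I1 I2 I3 *; lra.
apply: le_trans (ler_wpM2l LV0 h1) _; rewrite mulrA ler_wpM2r ?(ltW r0)//.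
by rewrite mulrCA ler_piMr ?(ltW e0)// ler_pdivrMr// mul1r lerDl.
Qed.

Let jump A B : continuous A -> continuous B -> tensor_nonneg A B U ->
  (forall x y, - M <= x <= M -> - M <= y <= M -> `|A x - A y| <= L * `|x - y|) ->
  (forall x y, - M <= x <= M -> - M <= y <= M -> `|B x - B y| <= L * `|x - y|) ->
  forall e, 0 < e -> exists2 d, 0 < d & forall r a b, 0 < r -> r < d ->
    t0 - r <= a -> a <= b -> b <= t0 + r ->
    - (e * r) <= (A p - A m) * (h b - h a) - (B p - B m) * (b - a).
Proof.
move=> cA cB pos lipA lipB; have [CA bA] := bmU cA; have [CB bB] := bmU cB.
have t00 : 0 < t0 by apply: le_lt_trans t0t.
exact: (jump_inequality UM bA bB L0 lipA lipB hlip Lam0 t00 mM pM hbu pos).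
Qed.

Let lip_id x y : - M <= x <= M -> - M <= y <= M -> `|x - y| <= L * `|x - y|.
Proof. by move=> _ _; rewrite ler_peMl. Qed.

Let rankine_hugoniot e : 0 < e ->
  exists2 d, 0 < d & forall r a b, 0 < r -> r < d ->
    t0 - r <= a -> a <= b -> b <= t0 + r ->
    `|(p - m) * (h b - h a) - (f p - f m) * (b - a)| <= e * r.
Proof.
move=> e0.
have cN (g : R -> R) : continuous g -> continuous (fun v => - g v).
  by move=> cg v; apply: cvgN; exact: cg.
have [d1 d10 h1] := @jump id f (fun x => cvg_id) cf weak1 lip_id lipf e e0.
have [d2 d20 h2] := @jump (fun v => - v) (fun v => - f v) (cN id (fun x => cvg_id))
  (cN f cf) weak2 ltac:(by move=> x y xM yM; rewrite -opprD normrN lip_id)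
  ltac:(by move=> x y xM yM; rewrite -opprD normrN lipf) e e0.
exists (Num.min d1 d2); first by rewrite lt_min d10.
move=> r a b r0; rewrite lt_min => /andP[rd1 rd2] ra ab br.
have := h1 r a b r0 rd1 ra ab br; have := h2 r a b r0 rd2 ra ab br.
by rewrite ler_norml; lra.
Qed.

(** Differentiability is proved here, without Rademacher's theorem: for [p != m] the
    Rankine-Hugoniot estimate determines the increments of [h], and for [p = m] the upper and lower
    velocity bounds coincide. *)
Lemma point_conclusion : exists s, [/\ is_derive t0 (1:R) h s,
  Num.min (V m) (V p) <= s <= Num.max (V m) (V p),
  s * (p - m) = f p - f m & q p - q m <= s * (eta p - eta m)].
Proof.
have upper e : 0 < e -> exists2 d, 0 < d & forall r a b, 0 < r -> r < d ->
    t0 - r <= a -> a <= b -> b <= t0 + r ->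
    h b - h a <= Num.max (V m) (V p) * (b - a) + e * r.
  move=> e0; have n1 : `|1 : R| <= 1 by rewrite normr1.
  have [||d d0 hd] := @increment_bound 1 (Num.max (V m) (V p)) e n1 _ _ e0.
    by rewrite mul1r le_max lexx.
    by rewrite mul1r le_max lexx orbT.
  by exists d => // r a b r0 rd ra ab br; have := hd r a b r0 rd ra ab br; rewrite mul1r.
have lower e : 0 < e -> exists2 d, 0 < d & forall r a b, 0 < r -> r < d ->
    t0 - r <= a -> a <= b -> b <= t0 + r ->
    Num.min (V m) (V p) * (b - a) - e * r <= h b - h a.
  move=> e0; have n1 : `|-1 : R| <= 1 by rewrite normrN normr1.
  have [||d d0 hd] := @increment_bound (-1) (- Num.min (V m) (V p)) e n1 _ _ e0.
    by rewrite mulN1r lerN2 ge_min lexx.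
    by rewrite mulN1r lerN2 ge_min lexx orbT.
  by exists d => // r a b r0 rd ra ab br; have := hd r a b r0 rd ra ab br; lra.
have [s hs] : exists s, (forall e, 0 < e -> exists2 d, 0 < d & forall r a b, 0 < r -> r < d ->
    t0 - r <= a -> a <= b -> b <= t0 + r -> `|h b - h a - s * (b - a)| <= e * r).
  have [pm|pm] := eqVneq p m.
    exists (V m) => e e0; have [d1 d10 h1] := upper e e0; have [d2 d20 h2] := lower e e0.
    exists (Num.min d1 d2); first by rewrite lt_min d10.
    move=> r a b r0; rewrite lt_min => /andP[rd1 rd2] ra ab br.
    have := h1 r a b r0 rd1 ra ab br; have := h2 r a b r0 rd2 ra ab br.
    by rewrite pm minxx maxxx ler_norml; lra.
  have pm0 : 0 < `|p - m| by rewrite normr_gt0 subr_eq0.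
  exists ((f p - f m) / (p - m)) => e e0.
  have e1 : 0 < e * `|p - m| by rewrite mulr_gt0.
  have [d d0 hd] := rankine_hugoniot e1; exists d => // r a b r0 rd ra ab br.
  rewrite -(ler_pM2l pm0) -normrM.
  have -> : (p - m) * (h b - h a - (f p - f m) / (p - m) * (b - a)) =
      (p - m) * (h b - h a) - (f p - f m) * (b - a).
    by field; rewrite subr_eq0.
  by apply: le_trans (hd r a b r0 rd ra ab br) _; rewrite mulrA (mulrC e).
(* Dividing by [r] and letting [r] tend to 0 turns an approximate inequality between increments into
   one for [s]. *)
have lim2 X Y : (forall e, 0 < e -> exists2 d, 0 < d & forall r a b, 0 < r -> r < d ->
    t0 - r <= a -> a <= b -> b <= t0 + r ->
    - (e * r) <= X * (h b - h a) - Y * (b - a)) -> Y <= X * s.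
  move=> hXY; apply/ler_addgt0Pr => e e0.
  have X1 : 0 < `|X| + 1 by rewrite ltr_wpDl.
  have e2 : 0 < e / 2 by rewrite divr_gt0.
  have e3 : 0 < e / 2 / (`|X| + 1) by rewrite divr_gt0.
  have [d1 d10 h1] := hXY _ e2; have [d2 d20 h2] := hs _ e3.
  have r0 : 0 < Num.min d1 d2 / 2 by rewrite divr_gt0// lt_min d10.
  set r := Num.min d1 d2 / 2 in r0.
  have rd : r < Num.min d1 d2 by rewrite /r in r0 *; lra.
  move: rd; rewrite lt_min => /andP[rd1 rd2].
  have := h1 r t0 (t0 + r) r0 rd1 ltac:(lra) ltac:(lra) (lexx _).
  have := h2 r t0 (t0 + r) r0 rd2 ltac:(lra) ltac:(lra) (lexx _).
  rewrite (_ : t0 + r - t0 = r); last by ring.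
  set z := h (t0 + r) - h t0 => h3 h4.
  have h5 : X * (z - s * r) <= e / 2 * r.
    apply: le_trans (ler_norm _) _; rewrite normrM.
    apply: le_trans (ler_wpM2l (normr_ge0 X) h3) _.
    rewrite mulrA ler_wpM2r ?(ltW r0)// mulrCA ler_piMr ?(ltW e2)//.
    by rewrite ler_pdivrMr// mul1r lerDl.
  rewrite -(ler_pM2r r0); lra.
exists s; split.
- apply: is_derive_two_sided => e e0; have [d d0 hd] := hs e e0; exists d => // r r0 rd.
  have := hd r t0 (t0 + r) r0 rd; have := hd r (t0 - r) t0 r0 rd.
  have -> : t0 + r - t0 = r by ring.
  have -> : t0 - (t0 - r) = r by ring.
  by move=> h1 h2; split; [apply: h2|apply: h1]; lra.
- have lim (x y : R) : (forall e, 0 < e -> exists2 r, 0 < r & x * r <= y * r + e * r) ->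
      x <= y.
    move=> hxy; apply/ler_addgt0Pr => e e0; have [r r0] := hxy e e0.
    by rewrite -mulrDl ler_pM2r.
  apply/andP; split; apply: lim => e e0.
    have e2 : 0 < e / 2 by rewrite divr_gt0.
    have [d1 d10 h1] := lower _ e2; have [d2 d20 h2] := hs _ e2.
    have r0 : 0 < Num.min d1 d2 / 2 by rewrite divr_gt0// lt_min d10.
    exists (Num.min d1 d2 / 2) => //; set r := Num.min d1 d2 / 2 in r0 *.
    have rd : r < Num.min d1 d2 by rewrite /r in r0 *; lra.
    move: rd; rewrite lt_min => /andP[rd1 rd2].
    have := h1 r t0 (t0 + r) r0 rd1 ltac:(lra) ltac:(lra) (lexx _).
    have := h2 r t0 (t0 + r) r0 rd2 ltac:(lra) ltac:(lra) (lexx _).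
    by rewrite ler_norml; lra.
  have e2 : 0 < e / 2 by rewrite divr_gt0.
  have [d1 d10 h1] := upper _ e2; have [d2 d20 h2] := hs _ e2.
  have r0 : 0 < Num.min d1 d2 / 2 by rewrite divr_gt0// lt_min d10.
  exists (Num.min d1 d2 / 2) => //; set r := Num.min d1 d2 / 2 in r0 *.
  have rd : r < Num.min d1 d2 by rewrite /r in r0 *; lra.
  move: rd; rewrite lt_min => /andP[rd1 rd2].
  have := h1 r t0 (t0 + r) r0 rd1 ltac:(lra) ltac:(lra) (lexx _).
  have := h2 r t0 (t0 + r) r0 rd2 ltac:(lra) ltac:(lra) (lexx _).
  by rewrite ler_norml; lra.
- apply/eqP; rewrite eq_le; apply/andP; split.
    rewrite -lerN2 -mulrN mulrC; apply: lim2 => e e0.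
    have [d d0 hd] := rankine_hugoniot e0; exists d => // r a b r0 rd ra ab br.
    by have := hd r a b r0 rd ra ab br; rewrite ler_norml; lra.
  rewrite mulrC; apply: lim2 => e e0.
  have [d d0 hd] := rankine_hugoniot e0; exists d => // r a b r0 rd ra ab br.
  by have := hd r a b r0 rd ra ab br; rewrite ler_norml; lra.
- by rewrite mulrC; apply: lim2; exact: jump.
Qed.

End PointConclusion.

(** * Strong traces *)

Section Translation.
Context {R : realType}.
Local Notation mu := (@lebesgue_measure R).

Lemma lebesgue_measure_shift (c : R) (A : set R) : measurable A ->
  mu ((fun y => y + c) @^-1` A) = mu A.
Proof.
move=> mA; have mc : measurable_fun setT ((fun y => y + c) : measurableTypeR R -> measurableTypeR R).
  exact: measurable_funD.
pose nu : {measure set (measurableTypeR R) -> \bar R} :=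
  measure_function_pushforward__canonical__measure_function_Measure mu mc.
rewrite [RHS](@lebesgue_measure_unique R nu)// => X [[a b] _ <-].
rewrite /nu /= /pushforward (_ : _ @^-1` _ = `]a - c, b - c]%classic); last first.
  by apply/seteqP; split => y /=; rewrite !in_itv /= ltrBlDr lerBrDr.
rewrite !lebesgue_measure_itv /= !lte_fin ltrD2r.
by case: ifPn => // _; congr EFin; ring.
Qed.

Lemma ae_shift (P : R -> Prop) (c : R) : {ae mu, forall x, P x} ->
  {ae mu, forall y, P (y + c)}.
Proof.
move=> [N [mN N0 PN]]; exists ((fun y => y + c) @^-1` N); split.
- rewrite -[X in measurable X]setTI; apply: (measurable_funD _ _) => //.
- by rewrite lebesgue_measure_shift.
- by move=> y /= Py; exact: PN.
Qed.

End Translation.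

(** * Measurability in time of the distance to the trace *)

Section EssentialSupremum.
Context {R : realType}.
Local Notation mu := (@lebesgue_measure R).

Lemma esssup_abs_on_ge0 (I : set R) (g : R -> R) : (0 <= esssup_abs_on I g)%E.
Proof.
apply: ess_sup_gee.
  apply: lt_le_trans (le_measure mu _ _ (@subsetT _ `[0, 1]%classic)); rewrite ?inE//.
  by rewrite /= lebesgue_measure_itv /= lte_fin ltr01 oppr0 adde0 lte_fin.
by apply: aeW => y; rewrite patchE; case: ifP => _; rewrite // lee_fin.
Qed.

Context (I : set R) (U : R * R -> R) (h v : R -> R) (M Cv : R).
Hypothesis mI : measurable I.
Hypothesis bU : bm2 U M.
Hypothesis mh : measurable_fun setT h.
Hypothesis bv : bmf v Cv.

Let gap (t y : R) := U (t, h t + y) - v t.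

Definition ess_gap t := fine (esssup_abs_on I (gap t)).

Let gap_le t y : `|gap t y| <= M + Cv.
Proof.
by apply: (le_trans (ler_normB _ _)); apply: lerD; [case: bU|case: bv].
Qed.

Let C0 : 0 <= M + Cv. Proof. exact: le_trans (gap_le 0 0). Qed.

Let esssup_le t c : 0 <= c -> {ae mu, forall y, I y -> `|gap t y| <= c} ->
  (esssup_abs_on I (gap t) <= c%:E)%E.
Proof.
move=> c0 hc; apply/ess_supP; apply: (aeS hc) => y hy; rewrite patchE.
by case: ifPn => [/set_mem/hy|_]; rewrite lee_fin.
Qed.

Let esssup_fin t : esssup_abs_on I (gap t) \is a fin_num.
Proof.
rewrite ge0_fin_numE ?esssup_abs_on_ge0//; apply: le_lt_trans (ltry (M + Cv)).
by apply: esssup_le => //; apply: aeW => y _; exact: gap_le.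
Qed.

Lemma ess_gapE t : (esssup_abs_on I (gap t) = (ess_gap t)%:E)%E.
Proof. by rewrite fineK. Qed.

Lemma ess_gap_ge0 t : 0 <= ess_gap t.
Proof. exact: fine_ge0 (esssup_abs_on_ge0 _ _). Qed.

Lemma ess_gap_le t c : 0 <= c -> {ae mu, forall y, I y -> `|gap t y| <= c} ->
  ess_gap t <= c.
Proof. by move=> c0 hc; rewrite -lee_fin -ess_gapE; exact: esssup_le. Qed.

Lemma ess_gap_ae t : {ae mu, forall y, I y -> `|U (t, h t + y) - v t| <= ess_gap t}.
Proof.
have := ess_sup_ge mu ((fun y => (`|gap t y|)%:E) \_ I).
move=> /aeS; apply => y; rewrite -/(esssup_abs_on I (gap t)) ess_gapE patchE.
by move=> + Iy; rewrite ifT ?mem_set// lee_fin.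
Qed.

(** For [r >= 0], [ess_gap t > r] means that the section at [t] of the set where [|gap| > r] has
    positive measure, and measures of sections depend measurably on [t]. This uses that [U], [h] and
    [v] are Borel everywhere. *)
Lemma ess_gap_bmf : bmf ess_gap (M + Cv).
Proof.
split; last first.
  move=> t; rewrite ger0_norm ?ess_gap_ge0//; apply: ess_gap_le => //.
  by apply: aeW => y _; exact: gap_le.
apply: (measurability _ (RGenOInfty.measurableE R)) => _ [_ [r ->] <-]; rewrite setTI.
have [r0|r0] := ltP r 0.
  rewrite (_ : _ @^-1` _ = setT)//; apply/seteqP; split => // t _ /=.
  by rewrite in_itv /= andbT; apply: lt_le_trans (ess_gap_ge0 t).
pose S := [set z : R * R | I z.2 /\ r < `|gap z.1 z.2|].
have mS : measurable S.
  have -> : S = (setT `*` I) `&` ((fun z => `|gap z.1 z.2|) @^-1` `]r, +oo[).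
    by apply/seteqP; split => z /=; rewrite /S /= in_itv /= andbT; [case|case=> -[]].
  apply: measurableI; first exact: measurableX.
  have mg : measurable_fun setT (fun z : R * R => `|gap z.1 z.2|).
    apply: (measurableT_comp (@normr_measurable R setT)).
    apply: measurable_funB.
      have m1 : measurable_fun setT (h \o (fst : R * R -> R)) by exact: measurableT_comp.
      have m2 : measurable_fun setT (snd : R * R -> R) by exact: measurable_snd.
      have m3 : measurable_fun setT (fst : R * R -> R) by exact: measurable_fst.
      case: bU => mU _; apply: (measurableT_comp mU).
      exact: (measurable_fun_pair m3 (measurable_funD m1 m2)).
    by case: bv => mv _; exact: (measurableT_comp mv).
  by rewrite -[X in measurable X]setTI; apply: mg.
have mX := measurable_fun_xsection mu mS.
have -> : ess_gap @^-1` `]r, +oo[ = setT `&` [set t | (0 < (mu \o xsection S) t)%E].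
  rewrite setTI; apply/seteqP; split => t /=; rewrite in_itv /= andbT.
    move=> rt; rewrite lt_neqAle measure_ge0 andbT eq_sym; apply/negP => /eqP S0.
    move: rt; rewrite ltNge => /negP; apply; apply: ess_gap_le => //.
    exists (xsection S t); split => //; first exact: measurable_xsection.
    move=> y /= /not_implyP[Iy /negP]; rewrite -ltNge => ry.
    by apply/xsectionP; split.
  move=> S0; rewrite ltNge; apply/negP => er.
  have : mu.-negligible (xsection S t).
    have [N [mN N0 hN]] := ess_gap_ae t; exists N; split => // y /xsectionP[/= Iy ry].
    apply: hN => /= /(_ Iy) h1; have := lt_le_trans ry (le_trans h1 er).
    by rewrite ltxx.
  move=> neg; have S0' : mu (xsection S t) = 0%E.
    by apply: measure_negligible => //; exact: measurable_xsection.
  by rewrite /= S0' ltxx in S0.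
exact: emeasurable_fun_o_infty.
Qed.

End EssentialSupremum.

Section TraceBlowUp.
Context {R : realType}.
Local Notation mu := (@lebesgue_measure R).
Local Notation mu2 := (mu \x mu)%E.

Lemma bmf_locally_integrable (g : R -> R) C : bmf g C -> locally_integrable setT g.
Proof.
move=> bg; have [mg gC] := bg; split => //; first exact: openT.
move=> K _ cK; have mK : measurable K.
  by apply: closed_measurable; apply: compact_closed => //; exact: Rhausdorff.
have bn := bmf_norm bg; have [mn _] := bn.
have : (\int[mu]_(x in K) (`|g x|)%:E <= \int[mu]_(x in K) (cst C%:E x))%E.
  apply: ge0_le_integral => //.
  - by apply/measurable_EFinP; exact: measurable_funTS.
  - by move=> x _; rewrite lee_fin.
move/le_lt_trans; apply; rewrite integral_cst// lte_mul_pinfty//.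
  by rewrite lee_fin (bmf_ge0 bg).
exact: compact_finite_measure.
Qed.

Lemma lebesgue_pt_mean (g : R -> R) C t0 : bmf g C -> lebesgue_pt g t0 ->
  forall e, 0 < e -> exists2 d, 0 < d & forall r, 0 < r -> r < d ->
    \int[mu]_(t in `[t0 - r, t0 + r]) `|g t - g t0| <= e * r.
Proof.
move=> bg hg e e0; have e2 : 0 < e / 2 by rewrite divr_gt0.
have bgn := bmf_norm (bmfD bg (bmfN (bmf_cst (g t0)))).
have : \forall r \near 0^'+, (davg g t0 r <= (e / 2)%:E)%E.
  have /fine_cvgP[h1 h2] := hg.
  have /cvgrPdist_le/(_ _ e2) := h2.
  move=> h3; near=> r.
  have h4 : davg g t0 r \is a fin_num by near: r.
  rewrite -(fineK h4) lee_fin.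
  have : `|0 - fine (davg g t0 r)| <= e / 2 by near: r.
  by rewrite sub0r normrN => /(le_trans (ler_norm _)).
move=> [d /= d0 hd]; exists d => // r r0 rd.
have := hd r; rewrite /ball_ /= sub0r normrN gtr0_norm// => /(_ rd r0).
have -> : davg g t0 r =
    ((r *+ 2)^-1 * \int[mu]_(t in `[t0 - r, t0 + r]) `|g t - g t0|)%:E.
  rewrite /davg /iavg lebesgue_measure_ball ?(ltW r0)// inver mulrn_eq0 /= gt_eqF//=.
  rewrite EFinM; congr (_ * _)%E.
  rewrite -Rintegral_itv_obnd_cbnd; last first.
    apply: integrableS (bmf_integrable (t0 - r) (t0 + r) bgn) => //.
    by apply: subset_itv => //; rewrite bnd_simp.
  rewrite -Rintegral_itv_bndo_bndc; last first.
    apply: integrableS (bmf_integrable (t0 - r) (t0 + r) bgn) => //.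
    by apply: subset_itv; rewrite bnd_simp.
  rewrite /Rintegral fineK ?ball_itv//.
  apply: integrable_fin_num => //.
  apply: integrableS (bmf_integrable (t0 - r) (t0 + r) bgn) => //.
  by apply: subset_itv; rewrite bnd_simp.
rewrite lee_fin ler_pdivrMl ?mulrn_wgt0// => /le_trans; apply.
by rewrite -mulr_natr le_eqVlt; apply/orP; left; apply/eqP; field.
Unshelve. all: by end_near. Qed.

(** Let [B] be the set of times where every [ess_gap] exceeds [e]: each integral is at least
    [e * mu B], and the integrals tend to 0, so [B] is null. No subsequence is extracted; countably
    many horizons [i] and thresholds [j] suffice. *)
Lemma trace_gap_ae (I : nat -> set R) (U : R * R -> R) (h v : R -> R) (M Cv t0 : R) :
  (forall n, measurable (I n)) -> bm2 U M -> measurable_fun setT h -> bmf v Cv ->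
  (forall T : R, t0 < T ->
    (fun n => \int[mu]_(t in `[t0, T])
      esssup_abs_on (I n) (fun y => U (t, h t + y) - v t)%R)%E @ \oo --> 0%E) ->
  {ae mu, forall t, t0 <= t -> forall e, 0 < e -> exists n, ess_gap (I n) U h v t <= e}.
Proof.
move=> mI bU mh bv hlim.
pose E n t := ess_gap (I n) U h v t.
have bE n : bmf (E n) (M + Cv) by exact: ess_gap_bmf.
have E0 n t : 0 <= E n t by exact: ess_gap_ge0.
suff key : {ae mu, forall t, forall i j : nat, t0 <= t <= t0 + i.+1%:R ->
    exists n, E n t <= j.+1%:R^-1}.
  apply: (aeS key) => t ht tt e e0.
  have [|n nt] := ht (Num.truncn (t - t0)) (Num.truncn e^-1).
    by rewrite tt /= -lerBlDl ltW// real_truncnS_gt ?num_real.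
  exists n; apply: (le_trans nt); rewrite invf_ple ?posrE//.
  by rewrite ltW// real_truncnS_gt ?num_real.
apply/ae_foralln => i; apply/ae_foralln => j.
set T := t0 + _; set e := j.+1%:R^-1.
have e0 : 0 < e by rewrite invr_gt0.
have tT : t0 < T by rewrite ltrDl.
pose B := `[t0, T] `&` \bigcap_n (E n @^-1` `]e, +oo[).
have mB : measurable B.
  apply: measurableI => //; apply: bigcapT_measurable => n.
  by rewrite -[X in measurable X]setTI; have [mE _] := bE n; exact: mE.
exists B; split => //; last first.
  move=> t /= /not_implyP[tT' /forallNP hn]; split; first by rewrite /= in_itv.
  by move=> n _ /=; rewrite in_itv /= andbT ltNge; apply/negP; exact: hn.
apply/eqP; rewrite eq_le measure_ge0 andbT.
have le_n n : (e%:E * mu B <=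
    \int[mu]_(t in `[t0, T]) esssup_abs_on (I n) (fun y => U (t, h t + y) - v t)%R)%E.
  under eq_integral do rewrite (ess_gapE (I n) h bU bv).
  have mE : measurable_fun setT (E n) by case: (bE n).
  rewrite -integral_cst//; apply: (@le_trans _ _ (\int[mu]_(t in B) (E n t)%:E)%E).
    apply: ge0_le_integral => //.
    - by move=> t _; rewrite lee_fin ltW.
    - by apply/measurable_EFinP; exact: measurable_funTS.
    - by move=> t [_ /(_ n Logic.I)] /=; rewrite in_itv /= andbT lee_fin => /ltW.
  apply: ge0_subset_integral => //.
  - by apply/measurable_EFinP; exact: measurable_funTS.
  - by move=> t _; rewrite lee_fin.
  - by move=> t [].
have : (e%:E * mu B <= 0)%E.
  by apply: (cvge_to_ge (hlim T tT)); apply: nearW => i0; exact: le_n.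
by rewrite pmule_rle0// lte_fin.
Qed.

Lemma ae_exists (I : set R) (P : R -> Prop) : measurable I -> (0 < mu I)%E ->
  {ae mu, forall x, P x} -> exists2 x, I x & P x.
Proof.
move=> mI I0 [N [mN N0 PN]]; apply: contrapT => /forall2NP h.
move: I0; apply/negP; rewrite -leNgt -N0; apply: le_measure; rewrite ?inE//.
by move=> x Ix; apply: PN; case: (h x).
Qed.

(** A small essential gap on an interval of positive measure yields a point where [U] satisfies its
    bounds and is within [e] of [v t]. *)
Lemma trace_itv (I : nat -> set R) (U : R * R -> R) (h v : R -> R) (M Cv t0 a b : R) :
  (forall n, measurable (I n)) -> (forall n, (0 < mu (I n))%E) ->
  bm2 U M -> measurable_fun setT h -> bmf v Cv ->
  (forall T : R, t0 < T ->
    (fun n => \int[mu]_(t in `[t0, T])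
      esssup_abs_on (I n) (fun y => U (t, h t + y) - v t)%R)%E @ \oo --> 0%E) ->
  {ae mu2, forall p, 0 < p.1 -> a <= U p <= b} ->
  {ae mu, forall t, 0 < t -> t0 <= t -> a <= v t <= b}.
Proof.
move=> mI I0 bU mh bv hlim /ae_prod hU.
apply: (ae2S hU (trace_gap_ae mI bU mh bv hlim)) => t ht hg t_gt0 tt.
suff h1 e : 0 < e -> exists2 z, a <= z <= b & `|z - v t| <= e.
  apply/andP; split; apply/ler_addgt0Pr => e /h1[z /andP[az zb]];
    rewrite ler_norml; lra.
move=> e0; have [n ne] := hg tt e e0.
have := ae_shift (h t) ht; move=> /ae2S/(_ (ess_gap_ae (I n) h bU bv t)).
move=> /(_ (fun y => I n y -> exists2 z, a <= z <= b & `|z - v t| <= e)) h2.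
have [|y Iy] := ae_exists (mI n) (I0 n) (h2 _); last exact.
move=> y /(_ t_gt0) + h3 Iy; rewrite addrC => h4.
by exists (U (t, h t + y)) => //; exact: le_trans (h3 Iy) ne.
Qed.

End TraceBlowUp.

Section BlowUpAE.
Context {R : realType}.
Local Notation mu := (@lebesgue_measure R).
Context (U : R * R -> R) (h vm vp : R -> R) (M Cm Cp t0 : R).
Hypothesis bU : bm2 U M.
Hypothesis mh : measurable_fun setT h.
Hypothesis bm : bmf vm Cm.
Hypothesis bp : bmf vp Cp.
Let Im n := `](- n.+1%:R^-1)%R, 0%R[%classic : set R.
Let Ip n := `]0%R, n.+1%:R^-1%R[%classic : set R.
Hypothesis hm : forall T : R, t0 < T ->
  (fun n => \int[mu]_(t in `[t0, T])
    esssup_abs_on (Im n) (fun y => U (t, h t + y) - vm t)%R)%E @ \oo --> 0%E.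
Hypothesis hp : forall T : R, t0 < T ->
  (fun n => \int[mu]_(t in `[t0, T])
    esssup_abs_on (Ip n) (fun y => U (t, h t + y) - vp t)%R)%E @ \oo --> 0%E.

Let mIm n : measurable (Im n). Proof. exact: measurable_itv. Qed.
Let mIp n : measurable (Ip n). Proof. exact: measurable_itv. Qed.

Let Em n := ess_gap (Im n) U h vm.
Let Ep n := ess_gap (Ip n) U h vp.

(** Trace convergence has no rate at a given time, so [n] is fixed first, with [Em n t <= e / 8];
    the Lebesgue point property of [Em n] itself then keeps it small in mean around [t]. The four
    oscillations contribute [4 * (e / 8) * r] and the two values at [t] contribute
    [(e / 4) * (2 * r)], in total [e * r]. *)
Let blow_up_lebesgue_pt t : lebesgue_pt vm t -> lebesgue_pt vp t ->
  (forall n, lebesgue_pt (Em n) t) -> (forall n, lebesgue_pt (Ep n) t) ->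
  (forall e, 0 < e -> exists n, Em n t <= e) ->
  (forall e, 0 < e -> exists n, Ep n t <= e) ->
  blow_up U h t (vm t) (vp t).
Proof.
move=> Lm Lp LEm LEp gm gp e e0.
have arith (x x' y y' v w X Y : R) : x' <= e / 8 -> y' <= e / 8 -> x - x' <= X ->
    y - y' <= Y -> x + y + v + w <= v + w + X + Y + e / 4 by lra.
have e8 : 0 < e / 8 by rewrite divr_gt0.
have [n nE] := gm _ e8; have [n' nE'] := gp _ e8.
have bEm : bmf (Em n) (M + Cm) by exact: (ess_gap_bmf (mIm n) bU mh bm).
have bEp : bmf (Ep n') (M + Cp) by exact: (ess_gap_bmf (mIp n') bU mh bp).
have [d1 d10 h1] := lebesgue_pt_mean bm Lm e8.
have [d2 d20 h2] := lebesgue_pt_mean bp Lp e8.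
have [d3 d30 h3] := lebesgue_pt_mean bEm (LEm n) e8.
have [d4 d40 h4] := lebesgue_pt_mean bEp (LEp n') e8.
pose D (g : R -> R) (s : R) : R := `|g s - g t|.
have bD g C : bmf g C -> bmf (D g) (C + `|g t|).
  by move=> bg; exact: bmf_norm (bmfD bg (bmfN (bmf_cst (g t)))).
pose k (s : R) : R := Em n s + Ep n' s + D vm s + D vp s.
have bk := bmfD (bmfD (bmfD bEm bEp) (bD _ _ bm)) (bD _ _ bp).
have [d [d0 dd1 dd2 [dd3 dd4 dn dn']]] : exists d, [/\ 0 < d, d <= d1, d <= d2 &
    [/\ d <= d3, d <= d4, d <= n.+1%:R^-1 & d <= n'.+1%:R^-1]].
  exists (Num.min (Num.min (Num.min d1 d2) (Num.min d3 d4))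
                  (Num.min n.+1%:R^-1 n'.+1%:R^-1)).
  split; [|by rewrite !ge_min lexx ?orbT..|split; by rewrite !ge_min lexx ?orbT].
  by rewrite !lt_min d10 d20 d30 d40 !invr_gt0 !ltr0n.
exists d, k; eexists; split.
- exact: d0.
- exact: bk.
- move=> s; have g1 : 0 <= Em n s by exact: ess_gap_ge0.
  have g2 : 0 <= Ep n' s by exact: ess_gap_ge0.
  by rewrite /k /D !addr_ge0.
- move=> r r0 rd.
  have I1 := h1 r r0 (lt_le_trans rd dd1); have I2 := h2 r r0 (lt_le_trans rd dd2).
  have I3 := h3 r r0 (lt_le_trans rd dd3); have I4 := h4 r r0 (lt_le_trans rd dd4).
  have bG := bmfD (bmfD (bmfD (bmfD (bD _ _ bm) (bD _ _ bp)) (bD _ _ bEm)) (bD _ _ bEp))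
    (bmf_cst (e / 4)).
  apply: (@le_trans _ _ (\int[mu]_(s in `[t - r, t + r])
      (D vm s + D vp s + D (Em n) s + D (Ep n') s + e / 4))).
    apply: (Rint_le bk bG) => s _.
    exact: arith nE nE' (ler_norm _) (ler_norm _).
  have II g C : bmf g C -> mu.-integrable `[t - r, t + r] (EFin \o g).
    exact: bmf_integrable.
  have bb1 := bmfD (bD _ _ bm) (bD _ _ bp).
  have bb2 := bmfD bb1 (bD _ _ bEm).
  have bb3 := bmfD bb2 (bD _ _ bEp).
  rewrite (RintegralD _ (II _ _ bb3) (II _ _ (bmf_cst (e / 4))))//.
  rewrite (RintegralD _ (II _ _ bb2) (II _ _ (bD _ _ bEp)))//.
  rewrite (RintegralD _ (II _ _ bb1) (II _ _ (bD _ _ bEm)))//.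
  rewrite (RintegralD _ (II _ _ (bD _ _ bm)) (II _ _ (bD _ _ bp)))//.
  rewrite Rint_cst; last by rewrite lerD2l ge0_cp ?ltW.
  move: I1 I2 I3 I4; rewrite /D.
  move: (Rintegral _ _ _) (Rintegral _ _ _) (Rintegral _ _ _) (Rintegral _ _ _).
  move=> ? ? ? ? ? ? ? ?; lra.
- apply: aeW => s _.
  have := ae2S (ae_shift (- h s) (ess_gap_ae (Im n) h bU bm s))
               (ae_shift (- h s) (ess_gap_ae (Ip n') h bU bp s)).
  apply => x hx1 hx2; rewrite addrCA subrr addr0 in hx1 hx2.
  have D0 g : 0 <= D g s by exact: normr_ge0.
  have E1 : 0 <= Em n s by exact: ess_gap_ge0.
  have E2 : 0 <= Ep n' s by exact: ess_gap_ge0.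
  split=> y1 y2.
    have /hx2 : Ip n' (x - h s).
      by rewrite /Ip /= in_itv /= subr_gt0 y1 /= ltrBlDl; apply: (lt_le_trans y2); rewrite lerD2l.
    rewrite -/(Ep n' s) /k => h5.
    have := ler_distD (vp s) (U (s, x)) (vp t); rewrite -/(D vp s).
    move: (D0 vm); lra.
  have /hx1 : Im n (x - h s).
    rewrite /Im /= in_itv /= subr_lt0 y1 andbT ltrBrDl; apply: le_lt_trans y2.
    by rewrite lerD2l lerN2.
  rewrite -/(Em n s) /k => h5.
  have := ler_distD (vm s) (U (s, x)) (vm t); rewrite -/(D vm s).
  move: (D0 vp); lra.
Qed.

Lemma blow_up_ae : {ae mu, forall t, t0 <= t -> blow_up U h t (vm t) (vp t)}.
Proof.
have Lae g C : bmf g C -> {ae mu, forall t, lebesgue_pt g t}.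
  by move=> bg; exact: lebesgue_differentiation (bmf_locally_integrable bg).
have A1 : {ae mu, forall t n, lebesgue_pt (Em n) t}.
  by apply/ae_foralln => n; apply: (Lae _ (M + Cm)); exact: (ess_gap_bmf (mIm n) bU mh bm).
have A2 : {ae mu, forall t n, lebesgue_pt (Ep n) t}.
  by apply/ae_foralln => n; apply: (Lae _ (M + Cp)); exact: (ess_gap_bmf (mIp n) bU mh bp).
have A3 := trace_gap_ae mIm bU mh bm hm.
have A4 := trace_gap_ae mIp bU mh bp hp.
have pairP (P Q : R -> Prop) : {ae mu, forall t, P t} -> {ae mu, forall t, Q t} ->
  {ae mu, forall t, P t /\ Q t} by move=> hP hQ; exact: (ae2S hP hQ).
have := pairP _ _ (pairP _ _ (pairP _ _ (Lae _ _ bm) (Lae _ _ bp)) (pairP _ _ A1 A2))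
  (pairP _ _ A3 A4).
move=> /aeS; apply => t [[[L1 L2] [L3 L4]] [g1 g2]] tt.
by apply: blow_up_lebesgue_pt => // e e0; [exact: g1|exact: g2].
Qed.

End BlowUpAE.

(** * The maximum principle *)

Section MaximumPrinciple.
Context {R : realType}.
Local Notation mu := (@lebesgue_measure R).
Local Notation mu2 := (mu \x mu)%E.

Lemma Rint_setW (g : R -> R) C a b c d : bmf g C -> (forall x, 0 <= g x) ->
  a <= c -> c <= d -> d <= b ->
  \int[mu]_(x in `[c, d]) g x <= \int[mu]_(x in `[a, b]) g x.
Proof.
move=> bg g0 ac cd db.
rewrite (Rint_split ac (le_trans cd db) bg) (Rint_split cd db bg).
have R0 u v : 0 <= \int[mu]_(x in `[u, v]) g x.
  by apply: Rint_ge0_ae bg _; apply: aeW.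
by rewrite addrA addrAC lerDr addr_ge0.
Qed.

(** Constants pair to 0 with the derivatives of a compactly supported function. *)
Lemma tensor_nonneg_shift (A B : R -> R) (U : R * R -> R) CA CB (r s : R) :
  bm2 (fun p => A (U p)) CA -> bm2 (fun p => B (U p)) CB ->
  tensor_nonneg A B U -> tensor_nonneg (fun v => A v + r) (fun v => B v + s) U.
Proof.
move=> bA bB h psi chi a b c d ps cs a0 ab cd sp sc psi0 chi0.
(* [supported] says nothing about the endpoints of its own interval; at those of a wider box [psi]
   and [chi] vanish, and so do the boundary terms. *)
pose a' := a / 2; pose b' := b + 1; pose c' := c - 1; pose d' := d + 1.
have a'0 : 0 < a' by rewrite /a'; lra.
have ab' : a' <= b' by rewrite /a' /b'; lra.
have cd' : c' <= d' by rewrite /c' /d'; lra.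
have sp' : supported a' b' psi.
  by move=> t ht; apply: sp; move: ht; rewrite /a' /b' => -[?|?]; [left|right]; lra.
have sc' : supported c' d' chi.
  by move=> x hx; apply: sc; move: hx; rewrite /c' /d' => -[?|?]; [left|right]; lra.
have bc (z : R) : bm2 (fun p : R * R => (fun=> z) (U p)) `|z| by split.
have -> : (fun v => A v + r) = (fun v => 1 * A v + 1 * (fun=> r) v).
  by apply/funext => v; rewrite !mul1r.
have -> : (fun v => B v + s) = (fun v => 1 * B v + 1 * (fun=> s) v).
  by apply/funext => v; rewrite !mul1r.
rewrite (weak_pairing_lin ps cs a'0 ab' cd' sp' sc' _ _ bA bB (bc r) (bc s)) !mul1r.
rewrite [X in _ + X](_ : _ = 0) ?addr0; first exact: (h _ _ a b c d).
rewrite (weak_pairing_box ps cs a'0 ab' cd' sp' sc' (bc r) (bc s)).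
have [Cc bcc] := supported_bmf cd' (smooth1_continuous (smooth1_derive1 cs)) (supported_derive1 sc').
have [Cp bpp] := supported_bmf ab' (smooth1_continuous (smooth1_derive1 ps)) (supported_derive1 sp').
have chi'0 : \int[mu]_(x in `[c', d']) (s * derive1 chi x) = 0.
  rewrite RintegralZl//; last exact: bmf_integrable bcc.
  rewrite smooth1_FTC// !sc ?subrr ?mulr0//; rewrite /c' /d'; [left|right]; lra.
under eq_Rintegral do rewrite chi'0 mulr0 addr0.
rewrite RintegralZr//; last exact: bmf_integrable bpp.
rewrite smooth1_FTC// !sp ?subrr ?mul0r//; rewrite /a' /b'; [left|right]; lra.
Qed.

(** * Weighted integral estimate *)

Section Estimate.
Context (w Q : R -> R) (U : R * R -> R) (L W CS a r e T c N : R).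
Hypothesis bw : bm2 (fun p => w (U p)) W.
Hypothesis bQ : bm2 (fun p => Q (U p)) (L * W).
Hypothesis w0 : forall p, 0 <= w (U p).
Hypothesis Qw : forall p, `|Q (U p)| <= L * w (U p).
Hypothesis L0 : 0 <= L.
Hypothesis hCS : forall x, 0 <= derive1 (@step R) x <= CS.
Hypothesis CS0 : 0 < CS.
Hypothesis hpos : tensor_nonneg w Q U.
Hypothesis a0 : 0 < a.
Hypothesis a1 : a <= 1.
Hypothesis ac : 3 * a <= c.
Hypothesis cT : c <= T.
Hypothesis N0 : 0 < N.
Hypothesis Nr : N <= r.
Hypothesis he : {ae mu, forall t, a <= t <= 3 * a ->
  \int[mu]_(x in `[- (r + 1), r + 1]) w (U (t, x)) <= e}.

(* A weight with [|rho'| <= rho], so that the flux term is absorbed by the factor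
   [exp (- (L + 1) t)] of [psi]. *)
Let rho (x : R) : R := (1 + x ^+ 2)^-1.
Let theta := plateau (- (r + 1)) r (1:R).
Let chi x := theta x * rho x.
(** It rises over [[a, 2 * a]] and falls over [[T, T + 1]], two different widths, whence no
    [plateau]. *)
Let p (t : R) : R := step ((t - a) / a) - step ((t - T) / 1).
Let psi t := p t * expR (- (L + 1) * t).
Let E0 := CS / (1 + r ^+ 2).

Let r0 : 0 < r. Proof. exact: lt_le_trans N0 Nr. Qed.

Let rho_gt0 x : 0 < rho x.
Proof. by rewrite invr_gt0 ltr_pwDl// sqr_ge0. Qed.

Let den_neq0 (x : R) : 1 + x ^+ 2 != 0.
Proof. by rewrite gt_eqF// ltr_pwDl// sqr_ge0. Qed.

Let rho_le1 x : rho x <= 1.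
Proof. by rewrite invf_le1 ?lerDl ?sqr_ge0// ltr_pwDl// sqr_ge0. Qed.

Let smooth1_rho : smooth1 rho.
Proof.
move=> n; apply: ndiffV => //; apply: ndiffD; first exact: ndiff_cst.
by apply: (@ndiffM _ n id id); exact: ndiff_id.
Qed.

Let smooth1_chi : smooth1 chi.
Proof. by move=> n; apply: ndiffM => //; exact: smooth1_plateau. Qed.

Let smooth1_psi : smooth1 psi.
Proof.
move=> n; apply: ndiffM.
  by apply: ndiffD; [|apply: ndiffN]; exact: smooth1_step_affine.
apply: ndiff_comp; first exact: ndiff_expR.
by apply: ndiffM; [exact: ndiff_cst|exact: ndiff_id].
Qed.

Let theta_itv x : 0 <= theta x <= 1.
Proof. by apply: plateau_itv => //; have := r0; lra. Qed.

Let derive1_rho x : derive1 rho x = - (2 * x * rho x) * rho x.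
Proof.
have h : is_derive x (1:R) (fun y : R => 1 + y ^+ 2) (2 * x).
  by apply: is_derive_eq; rewrite /GRing.scale /=; ring.
have := @is_deriveV _ (fun y : R => 1 + y ^+ 2) x _ _ (den_neq0 x) h.
rewrite derive1E => -[_ ->]; rewrite /rho /GRing.scale /= -exprVn expr2; ring.
Qed.

(** [|rho'| <= rho] because [2 * |x| <= 1 + x^2], and [theta'] lives where [|x| >= r], where [rho]
    is at most [1 / (1 + r^2)]. *)
Let chi'_le x : `|derive1 chi x| <= chi x + E0.
Proof.
have h1 := smooth1_is_derive x (smooth1_plateau (- (r + 1)) r 1).
have h2 := smooth1_is_derive x smooth1_rho.
have -> : derive1 chi x = theta x * derive1 rho x + rho x * derive1 theta x.
  by rewrite [LHS]derive1E; have [_ ->] := is_deriveM h1 h2.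
apply: le_trans (ler_normD _ _) _; apply: lerD.
  rewrite derive1_rho /chi normrM ger0_norm; last by case/andP: (theta_itv x).
  apply: ler_wpM2l; first by case/andP: (theta_itv x).
  rewrite normrM normrN (gtr0_norm (rho_gt0 x)) ler_piMl ?(ltW (rho_gt0 x))//.
  rewrite normrM (gtr0_norm (rho_gt0 x)) /rho ler_pdivrMr ?mul1r; last first.
    by rewrite ltr_pwDl// sqr_ge0.
  rewrite ler_norml; apply/andP; split; have := sqr_ge0 (x + 1); have := sqr_ge0 (x - 1); nra.
rewrite derive1_plateau !divr1 normrM (gtr0_norm (rho_gt0 x)).
have [/andP[x1 x2]|] := boolP (- r < x < r).
  rewrite !derive1_step_out ?subrr ?normr0 ?mulr0 ?divr_ge0 ?(ltW CS0)//.
  - by rewrite addr_ge0// sqr_ge0.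
  - by left; lra.
  - by right; lra.
move=> xr; rewrite /E0 mulrC; apply: ler_pM => //; first exact: ltW.
  have := hCS (x - - (r + 1)); have := hCS (x - r).
  move: (derive1 _ _) (derive1 _ _) => u v /andP[? ?] /andP[? ?].
  by rewrite ler_norml; apply/andP; split; lra.
rewrite lef_pV2 ?posrE ?ltr_pwDl ?sqr_ge0// lerD2l -(real_normK (num_real x)).
rewrite ler_sqr ?nnegrE ?(ltW r0)//; move: xr; rewrite negb_and -!leNgt ler_normr.
by move=> /orP[?|->//]; apply/orP; right; lra.
Qed.

Let J t := \int[mu]_(x in `[- (r + 1), r + 1]) (w (U (t, x)) * chi x).
Let K t := \int[mu]_(x in `[- (r + 1), r + 1]) (Q (U (t, x)) * derive1 chi x).

Let rr : - (r + 1) <= r + 1. Proof. by have := r0; lra. Qed.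

Let supp_chi : supported (- (r + 1)) (r + 1) chi.
Proof.
have h : - (r + 1) <= r by have := r0; lra.
by move=> x hx; rewrite /chi /theta plateau0 ?mul0r//; case: hx => ?; [left|right]; apply: ltW.
Qed.

Let bchi : exists C, bmf chi C.
Proof. exact: supported_bmf rr (smooth1_continuous smooth1_chi) supp_chi. Qed.

Let bchi' : exists C, bmf (derive1 chi) C.
Proof.
exact: supported_bmf rr (smooth1_continuous (smooth1_derive1 smooth1_chi))
  (supported_derive1 supp_chi).
Qed.

Let bJ : exists C, bmf J C.
Proof.
have [C bC] := bchi; have bG := bm2M bw (bm2_snd bC).
by exists (W * C * (r + 1 - - (r + 1))); exact: bm2_inner rr bG.
Qed.

Let bK : exists C, bmf K C.
Proof.
have [C bC] := bchi'; have bG := bm2M bQ (bm2_snd bC).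
by exists (L * W * C * (r + 1 - - (r + 1))); exact: bm2_inner rr bG.
Qed.

Let chi0 x : 0 <= chi x.
Proof. by rewrite mulr_ge0 ?(ltW (rho_gt0 x))//; case/andP: (theta_itv x). Qed.

Let J0 t : 0 <= J t.
Proof.
have [C bC] := bchi.
by apply: Rint_ge0_ae (bmfM (bm2_section t bw) bC) _; apply: aeW => x _; rewrite mulr_ge0.
Qed.

Let E := L * W * E0 * (r + 1 - - (r + 1)).

Let E_ge0 : 0 <= E.
Proof.
have W0 : 0 <= W by case: bw => _ /(_ (0, 0)); exact: le_trans.
have E00 : 0 <= E0 by rewrite divr_ge0 ?(ltW CS0)// addr_ge0// sqr_ge0.
by rewrite mulr_ge0 ?subr_ge0// mulr_ge0// mulr_ge0.
Qed.

Let KJ t : K t <= L * J t + E.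
Proof.
have [C bC] := bchi; have [C' bC'] := bchi'.
have b1 := bmfM (bm2_section t bQ) bC'.
have b2 := bmfM (bm2_section t bw) bC.
have b3 := bmfM (bmf_cst L) b2.
have b4 := bmf_cst (L * W * E0).
rewrite -RintegralZl//; last exact: bmf_integrable b2.
rewrite /E -Rint_cst// -RintegralD//; last 2 first.
  exact: bmf_integrable b3.
  exact: bmf_integrable b4.
apply: Rint_le b1 (bmfD b3 b4) _ => x _.
apply: (le_trans (ler_norm _)); rewrite normrM.
apply: (@le_trans _ _ (L * w (U (t, x)) * (chi x + E0))); first exact: ler_pM.
rewrite mulrDr -mulrA lerD2l -!mulrA ler_wpM2l// ler_wpM2r//.
  by rewrite divr_ge0 ?(ltW CS0)// addr_ge0// sqr_ge0.
by case: bw => _ /(_ (t, x)); exact: le_trans (ler_norm _).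
Qed.

Let aT : a <= T + 1. Proof. by move: a0 ac cT => ? ? ?; lra. Qed.

Let p_itv t : 0 <= p t <= 1.
Proof.
have [_ s1] := andP (step_itv ((t - a) / a)).
have [s2 _] := andP (step_itv ((t - T) / 1)).
apply/andP; split; last by rewrite /p; lra.
rewrite subr_ge0; have [ta|ta] := ltP t a.
  rewrite (@step_le0 _ ((t - T) / 1)); first by case/andP: (step_itv ((t - a) / a)).
  by rewrite divr1; move: a0 ac cT => ? ? ?; lra.
apply: step_nondecreasing; rewrite divr1 ler_pdivlMr//.
by move: a0 ac cT a1 => ? ? ? ?; nra.
Qed.

Let exp_le1 t : 0 <= t -> 0 <= expR (- (L + 1) * t) <= 1.
Proof.
move=> t0; rewrite expR_ge0 /= -[leRHS]expR0 ler_expR mulNr oppr_le0 mulr_ge0//.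
by rewrite addr_ge0.
Qed.

Let psi_itv t : 0 <= t -> 0 <= psi t <= 1.
Proof.
move=> t0; have /andP[p0 p1] := p_itv t; have /andP[e0 e1] := exp_le1 t0.
by rewrite mulr_ge0//= mulr_ile1.
Qed.

Let p' t := derive1 (@step R) ((t - a) / a) / a - derive1 (@step R) ((t - T) / 1) / 1.

Let derive1_psi t : derive1 psi t = p' t * expR (- (L + 1) * t) - (L + 1) * psi t.
Proof.
have h1 : is_derive t (1:R) p (p' t).
  rewrite /p' -!derive1_step_affine.
  exact: is_deriveB (smooth1_is_derive t (smooth1_step_affine a a))
    (smooth1_is_derive t (smooth1_step_affine T 1)).
have h2 : is_derive t (1:R) (fun t => - (L + 1) * t) (- (L + 1)).
  by apply: is_derive_eq; rewrite /GRing.scale /=; ring.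
have h3 := @is_derive1_comp _ expR (fun t => - (L + 1) * t) t _ _ (is_derive_expR _) h2.
rewrite [LHS]derive1E; have [_ ->] := is_deriveM h1 h3.
rewrite /psi /GRing.scale /=; ring.
Qed.

Let supp_psi : supported a (T + 1) psi.
Proof.
move=> t [ta|tT]; rewrite /psi /p.
  rewrite !step_le0 ?subr0 ?mul0r//.
    by rewrite divr1; move: a0 ac cT => ? ? ?; lra.
  by rewrite ler_pdivrMr// mul0r; lra.
rewrite !step_ge1 ?subrr ?mul0r//; first by rewrite divr1; lra.
by rewrite ler_pdivlMr//; move: a0 ac cT => ? ? ?; lra.
Qed.

Let psi0 t : 0 <= psi t.
Proof. by rewrite mulr_ge0 ?expR_ge0//; case/andP: (p_itv t). Qed.

Let G t := derive1 psi t * J t + psi t * K t.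

Let bpsi : exists C, bmf psi C.
Proof. exact: supported_bmf aT (smooth1_continuous smooth1_psi) supp_psi. Qed.

Let bG : exists C, bmf G C.
Proof.
have [C1 b1] := bJ; have [C2 b2] := bK; have [C3 b3] := bpsi.
have [C4 b4] := supported_bmf aT (smooth1_continuous (smooth1_derive1 smooth1_psi))
  (supported_derive1 supp_psi).
by exists (C4 * C1 + C3 * C2); exact: bmfD (bmfM b4 b1) (bmfM b3 b2).
Qed.

Let G_ge0 : 0 <= \int[mu]_(t in `[a, T + 1]) G t.
Proof.
rewrite -(weak_pairing_box smooth1_psi smooth1_chi a0 aT rr supp_psi supp_chi bw bQ).
exact: hpos smooth1_psi smooth1_chi a0 aT rr supp_psi supp_chi psi0 chi0.
Qed.

(** Of the rate [L + 1] in the exponential, [L] absorbs the flux through [KJ] and 1 leaves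
    [- psi t * J t], the quantity to be estimated. *)
Let G_le t : 0 <= t -> G t <= p' t * expR (- (L + 1) * t) * J t - psi t * J t + E.
Proof.
move=> t0; rewrite /G derive1_psi; have := KJ t; have := psi_itv t0; have := E_ge0.
move: (J0 t) L0; move: (J t) (K t) (psi t) (p' t * _) => j k s x j0 l0 e0 /andP[s0 s1] kj.
have : s * k <= s * (L * j + E) by exact: ler_wpM2l.
have : s * E <= E by exact: ler_piMl.
nra.
Qed.

Let G_early t : a <= t <= 3 * a ->
  \int[mu]_(x in `[- (r + 1), r + 1]) w (U (t, x)) <= e -> G t <= CS / a * e + E.
Proof.
move=> /andP[t1 t2] hte; have t0 : 0 <= t by exact: le_trans (ltW a0) t1.
apply: (le_trans (G_le t0)); rewrite lerD2r.
have Je : J t <= e.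
  apply: le_trans hte; have [C bC] := bchi.
  apply: Rint_le (bmfM (bm2_section t bw) bC) (bm2_section t bw) _ => x _.
  by rewrite ler_piMr// mulr_ile1 ?(ltW (rho_gt0 x))//; case/andP: (theta_itv x).
have p'le : p' t <= CS / a.
  rewrite /p' !divr1; have /andP[_ h1] := hCS ((t - a) / a).
  have /andP[h2 _] := hCS (t - T).
  by rewrite lerBlDr ler_wpDr// ler_pM2r// invr_gt0.
have /andP[x0 x1] := exp_le1 t0.
have ca : 0 <= CS / a by rewrite divr_ge0 ?ltW.
apply: (@le_trans _ _ (CS / a * J t)); last exact: ler_wpM2l.
rewrite -[leRHS]subr0; apply: lerB; last by rewrite mulr_ge0.
apply: ler_wpM2r => //; apply: (@le_trans _ _ (CS / a * expR (- (L + 1) * t))).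
  exact: ler_wpM2r.
exact: ler_piMr.
Qed.

Let G_late t : 3 * a <= t -> G t <= E - psi t * J t.
Proof.
move=> ta; have t0 : 0 <= t by move: a0 => ?; lra.
apply: (le_trans (G_le t0)); rewrite -addrA addrC [leRHS]addrC -addrA lerD2l.
rewrite gerDl mulr_le0_ge0// mulr_le0_ge0 ?expR_ge0// /p'.
rewrite (derive1_step_out (_ : _ \/ 1 < (t - a) / a)) ?mul0r ?sub0r; last first.
  by right; rewrite ltr_pdivlMr//; move: a0 => ?; lra.
by rewrite divr1 oppr_le0; case/andP: (hCS ((t - T) / 1)).
Qed.

Let psiJ_ge t : c <= t <= T ->
  expR (- (L + 1) * T) * rho N * \int[mu]_(x in `[- N, N]) w (U (t, x)) <= psi t * J t.
Proof.
move=> /andP[ct tT]; rewrite -mulrA; apply: ler_pM; rewrite ?expR_ge0//.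
- rewrite mulr_ge0 ?(ltW (rho_gt0 N))//.
  by apply: Rint_ge0_ae (bm2_section t bw) _; exact: aeW.
- rewrite /psi /p step_ge1; last first.
    by rewrite ler_pdivlMr//; move: a0 ac => ? ?; lra.
  rewrite step_le0 ?subr0 ?mul1r; last by rewrite divr1; lra.
  by rewrite ler_expR !mulNr lerN2 ler_wpM2l// addr_ge0.
- have [C bC] := bchi.
  have b1 := bmfM (bm2_section t bw) bC.
  rewrite -RintegralZl//; last exact: bmf_integrable (bm2_section t bw).
  apply: (@le_trans _ _ (\int[mu]_(x in `[- N, N]) (w (U (t, x)) * chi x))); last first.
    have [n1 n2 n3] : [/\ - (r + 1) <= - N, - N <= N & N <= r + 1].
      by move: Nr N0 => ? ?; split; lra.
    by apply: Rint_setW b1 _ n1 n2 n3 => x; rewrite mulr_ge0.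
  apply: Rint_le (bmfM (bmf_cst _) (bm2_section t bw)) b1 _ => x /andP[x1 x2].
  have h : - (r + 1) <= r by have := r0; lra.
  rewrite mulrC ler_wpM2l// /chi /theta plateau1 ?mul1r//; last first.
    by move: Nr => ?; apply/andP; split; lra.
  rewrite lef_pV2 ?posrE ?ltr_pwDl ?sqr_ge0// lerD2l -(real_normK (num_real x)).
  rewrite ler_sqr ?nnegrE ?(ltW N0)// ler_norml; exact/andP.
Qed.

(** In the initial layer [[a, 3 * a]] the slope [CS / a] of the cut-off is compensated by the length
    [2 * a], leaving [2 * CS * e]; afterwards the cut-off decreases, with a good sign. The spatial
    cut-off contributes a term of order [1 / r], removed later by letting [r] grow. *)
Lemma weighted_mass_le : expR (- (L + 1) * T) * (1 + N ^+ 2)^-1 *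
    \int[mu]_(t in `[c, T]) \int[mu]_(x in `[- N, N]) w (U (t, x)) <=
  2 * CS * e + (T + 3) * (L * W * (CS / (1 + r ^+ 2)) * (r + 1 - - (r + 1))).
Proof.
rewrite -/(rho N) -/E0 -/E.
have [CG bCG] := bG; have [CJ bCJ] := bJ; have [Cp bCp] := bpsi.
have bpJ := bmfM bCp bCJ.
have h3 : a <= 3 * a by move: a0 => ?; lra.
have h4 : 3 * a <= T + 1 by move: ac cT => ? ?; lra.
have I1 : \int[mu]_(t in `[a, 3 * a]) G t <= (CS / a * e + E) * (3 * a - a).
  rewrite -Rint_cst//; apply: Rint_le_ae bCG (bmf_cst _) _.
  by apply: (aeS he) => t ht1 ht2; apply: G_early => //; exact: ht1.
have I2 : \int[mu]_(t in `[3 * a, T + 1]) G t <=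
    E * (T + 1 - 3 * a) - \int[mu]_(t in `[3 * a, T + 1]) (psi t * J t).
  rewrite -Rint_cst// -RintegralB//; last 2 first.
    exact: bmf_integrable (bmf_cst _).
    exact: bmf_integrable bpJ.
  by apply: Rint_le bCG (bmfD (bmf_cst E) (bmfN bpJ)) _ => t /andP[? _]; exact: G_late.
have NN : - N <= N by move: N0 => ?; lra.
have bS := bm2_inner NN bw.
have I3 : expR (- (L + 1) * T) * rho N *
    \int[mu]_(t in `[c, T]) \int[mu]_(x in `[- N, N]) w (U (t, x)) <=
    \int[mu]_(t in `[3 * a, T + 1]) (psi t * J t).
  rewrite -RintegralZl//; last exact: bmf_integrable bS.
  apply: (@le_trans _ _ (\int[mu]_(t in `[c, T]) (psi t * J t))); last first.
    apply: Rint_setW bpJ _ _ _ _ => //; last by lra.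
    by move=> t; rewrite mulr_ge0.
  exact: Rint_le (bmfM (bmf_cst _) bS) bpJ psiJ_ge.
have := G_ge0; rewrite (Rint_split h3 h4 bCG) => h5.
apply: (le_trans I3).
have h6 : (CS / a * e + E) * (3 * a - a) = 2 * CS * e + E * (2 * a).
  by field; rewrite gt_eqF.
have h7 : 0 <= E * a by rewrite mulr_ge0 ?(ltW a0).
rewrite h6 in I1; move: I1 I2 h5 h7 E_ge0.
move: (Rintegral _ _ _) (Rintegral _ _ _) (Rintegral _ _ _) E => i1 i2 i3 EE.
move=> ? ? ? ? ?; lra.
Qed.

End Estimate.

Lemma ae_eq0_box (G : R * R -> R) C : bm2 G C -> (forall p, 0 <= G p) ->
  (forall c T N, 0 < c -> c <= T -> 0 < N ->
    \int[mu]_(t in `[c, T]) \int[mu]_(x in `[- N, N]) G (t, x) = 0) ->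
  {ae mu2, forall p, 0 < p.1 -> G p = 0}.
Proof.
move=> bG G0 h.
pose D (n : nat) : set (R * R) := `[n.+1%:R^-1, n.+1%:R] `*` `[- n.+1%:R, n.+1%:R].
have : {ae mu2, forall p (n : nat), D n p -> G p = 0}.
  apply/ae_foralln => n.
  have n1 : (n.+1%:R^-1 : R) <= n.+1%:R.
    by rewrite (@le_trans _ _ 1) ?invf_le1 ?ler1n// ltr0n.
  have mD : measurable (D n) by exact: measurableX.
  have iG := bm2_integrable mD (box_lty _ _ _ _) bG.
  have mG := measurable_int _ iG.
  have I0 := h _ _ _ (_ : 0 < n.+1%:R^-1) n1 (_ : 0 < n.+1%:R).
  rewrite invr_gt0 !ltr0n in I0; have {I0} := I0 isT isT.
  rewrite -(Fubini_box _ _ _ _ bG) => I0.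
  have : (\int[mu2]_(p in D n) `|(EFin \o G) p| = 0)%E.
    have Gfin : (\int[mu2]_(p in D n) (EFin \o G) p)%E \is a fin_num.
      exact: integrable_fin_num.
    under eq_integral do rewrite gee0_abs ?lee_fin//.
    by rewrite -(fineK Gfin); congr EFin.
  by move/(ae_eq_integral_abs mu2 mD mG) => /aeS; apply => p hp Dp; have := hp Dp => -[].
move=> /aeS; apply => -[t x] hp /= t0.
apply: (hp (maxn (Num.truncn t^-1) (maxn (Num.truncn t) (Num.truncn `|x|)))).
set n := maxn _ _.
have le_n (z : R) m : (Num.truncn z <= m)%N -> z <= m.+1%:R.
  move=> zm; apply: (le_trans (ltW (real_truncnS_gt (num_real z)))).
  by rewrite ler_nat.
have h1 : t^-1 <= n.+1%:R by apply: le_n; rewrite leq_max leqnn.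
have h2 : t <= n.+1%:R by apply: le_n; rewrite !leq_max leqnn orbT.
have h3 : `|x| <= n.+1%:R by apply: le_n; rewrite !leq_max leqnn !orbT.
split; rewrite /= in_itv /=; last by rewrite -ler_norml.
by rewrite h2 andbT invf_ple ?posrE.
Qed.

Lemma mass_eq0 (w Q : R -> R) (U : R * R -> R) (L W : R) :
  bm2 (fun p => w (U p)) W -> bm2 (fun p => Q (U p)) (L * W) ->
  (forall p, 0 <= w (U p)) -> (forall p, `|Q (U p)| <= L * w (U p)) -> 0 <= L ->
  tensor_nonneg w Q U ->
  (forall r e, 0 < r -> 0 < e -> exists2 d, 0 < d & {ae mu, forall t, 0 < t < d ->
     \int[mu]_(x in `[- r, r]) w (U (t, x)) <= e}) ->
  {ae mu2, forall p, 0 < p.1 -> w (U p) = 0}.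
Proof.
move=> bw bQ w0 Qw L0 hpos hinit; apply: (ae_eq0_box bw w0) => c T N c0 cT N0.
have [CS CS0 hCS] := @derive1_step_bounded R.
have W0 : 0 <= W by case: bw => _ /(_ (0, 0)); exact: le_trans.
set I := Rintegral _ _ _.
have I0 : 0 <= I.
  have NN : - N <= N by lra.
  apply: Rint_ge0_ae (bm2_inner NN bw) _; apply: aeW => t _.
  by apply: Rint_ge0_ae (bm2_section t bw) _; exact: aeW.
apply/eqP; rewrite eq_le I0 andbT.
set ka := expR (- (L + 1) * T) * (1 + N ^+ 2)^-1.
have ka0 : 0 < ka by rewrite mulr_gt0 ?expR_gt0// invr_gt0 ltr_pwDl// sqr_ge0.
rewrite -(pmulr_rle0 _ ka0); apply/ler_addgt0Pr => e e0; rewrite add0r.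
pose B := (T + 3) * (L * W * CS).
have B0 : 0 <= B by rewrite !mulr_ge0// ?(ltW CS0)//; lra.
(* With [8 * B <= e * r] the spatial error, at most [4 * B * r / (1 + r^2)], is below [e / 2]. *)
pose r := 1 + N + 8 * B / e.
have Be0 : 0 <= 8 * B / e by rewrite divr_ge0 ?(ltW e0)// mulr_ge0.
have r1 : 1 <= r by rewrite /r; lra.
have Nr : N <= r by rewrite /r; lra.
have Ber : 8 * B <= e * r.
  have : e * (8 * B / e) = 8 * B by field; rewrite gt_eqF.
  by have := mulr_gt0 e0 N0; rewrite /r !mulrDr; lra.
have e' : 0 < e / (4 * CS) by rewrite divr_gt0// mulr_gt0.
have r1' : 0 < r + 1 by lra.
have [d d0 hd] := hinit (r + 1) _ r1' e'.
(* The entry [d / 4] puts [[a, 3 * a]] inside []0, d[], where the initial value controls the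
   mass. *)
pose a := Num.min 1 (Num.min (c / 3) (d / 4)).
have a0 : 0 < a by rewrite /a !lt_min ltr01 !divr_gt0.
have [a1 ac ad] : [/\ a <= 1, a <= c / 3 & a <= d / 4].
  by split; rewrite /a !ge_min lexx ?orbT.
have ac' : 3 * a <= c by lra.
have he : {ae mu, forall t, a <= t <= 3 * a ->
    \int[mu]_(x in `[- (r + 1), r + 1]) w (U (t, x)) <= e / (4 * CS)}.
  by apply: (aeS hd) => t ht /andP[t1 t2]; apply: ht; apply/andP; split; lra.
apply: (le_trans (weighted_mass_le bw bQ w0 Qw L0 hCS CS0 hpos a0 a1 ac' cT N0 Nr he)).
have -> : 2 * CS * (e / (4 * CS)) = e / 2 by field; rewrite gt_eqF.
have -> : (T + 3) * (L * W * (CS / (1 + r ^+ 2)) * (r + 1 - - (r + 1))) =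
    B * (2 * r + 2) / (1 + r ^+ 2).
  by rewrite /B; field; rewrite gt_eqF// ltr_pwDl// sqr_ge0.
suff : B * (2 * r + 2) / (1 + r ^+ 2) <= e / 2 by lra.
rewrite ler_pdivrMr; last by rewrite ltr_pwDl// sqr_ge0.
have h1 : B * (2 * r + 2) <= B * (4 * r) by rewrite ler_wpM2l//; lra.
have h2 : 8 * B * r <= e * r * r by rewrite ler_wpM2r//; lra.
move: h1 h2; rewrite /B; move: (_ * (L * W * CS)) => b h1 h2; nra.
Qed.

(** Since [|v - k| = 2 * w v + (v - k)] for [w v = (k - v)^+], [w] is up to a constant half the sum
    of the Kruzkov entropy and of [- v]. Its flux is dominated by [L * w] and it vanishes initially,
    so [mass_eq0] applies. *)
Lemma maximum_principle (f : R -> R) (U : R * R -> R) (u0 : R -> R) (M L k : R) :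
  (forall p, - M <= U p <= M) -> measurable_fun setT U -> - M <= k <= M ->
  continuous f -> 0 <= L ->
  (forall x y, - M <= x <= M -> - M <= y <= M -> `|f x - f y| <= L * `|x - y|) ->
  tensor_nonneg (fun v => - v) (fun v => - f v) U ->
  tensor_nonneg (kruzkov_entropy k) (kruzkov_flux f k) U ->
  initial_value U u0 -> {ae mu, forall x, k <= u0 x} ->
  {ae mu2, forall p, 0 < p.1 -> k <= U p}.
Proof.
move=> UM mU kM cf L0 lipf hN hK [mu0 hu0] ku0.
have M0 : 0 <= M by case/andP: kM; lra.
pose w (v : R) := k - Num.min v k; pose Q (v : R) := f k - f (Num.min v k).
have minP v : - M <= v <= M -> - M <= Num.min v k <= M.
  by move=> vM; rewrite minEle; case: ifP.
have mmin : measurable_fun setT (fun p => Num.min (U p) k) by exact: measurable_minr.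
have w0 p : 0 <= w (U p) by rewrite subr_ge0 ge_min lexx orbT.
have bw : bm2 (fun p => w (U p)) (2 * M).
  split; first exact: measurable_funB.
  by move=> p; have := minP _ (UM p); rewrite ger0_norm// /w; move: (Num.min _ _) kM => m; lra.
have Qw p : `|Q (U p)| <= L * w (U p).
  apply: (le_trans (lipf _ _ kM (minP _ (UM p)))).
  by rewrite ger0_norm//; exact: w0.
have bQ : bm2 (fun p => Q (U p)) (L * (2 * M)).
  split.
    apply: measurable_funB => //.
    exact: measurableT_comp (continuous_measurable cf) mmin.
  move=> p; apply: (le_trans (Qw p)); apply: ler_wpM2l => //.
  by case: bw => _ /(_ p); exact: le_trans (ler_norm _).
have [C C0 hC] := @continuous_itv_bounded R f (- M) M ltac:(lra) cf.
have bU0 : bm2 (fun p => U p) M by split => // p; rewrite ler_norml.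
have bf0 : bm2 (fun p => f (U p)) C.
  split; last by move=> p; apply: hC; exact: UM.
  exact: measurableT_comp (continuous_measurable cf) mU.
have bU : bm2 (fun p => - U p) M.
  by case: bU0 => m1 m2; split; [exact: measurableT_comp|move=> p; rewrite normrN].
have bf : bm2 (fun p => - f (U p)) C.
  by case: bf0 => m1 m2; split; [exact: measurableT_comp|move=> p; rewrite normrN].
have wE v : kruzkov_entropy k v = 2 * w v + (v - k).
  rewrite /kruzkov_entropy /w minEle; case: ifPn => vk; last first.
    by rewrite ger0_norm; move: vk; rewrite -ltNge; lra.
  by rewrite ler0_norm; lra.
have QE v : kruzkov_flux f k v = 2 * Q v + (f v - f k).
  rewrite /kruzkov_flux /Q minEle; case: ltgtP => vk.
  - by rewrite ltr0_sg ?subr_lt0//; lra.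
  - by rewrite gtr0_sg ?subr_gt0//; lra.
  - by rewrite vk; lra.
have bcst (c : R) := bm2_fst (bmf_cst c).
have bK1 := bm2D (bm2M (bcst 2) bw) (bm2D bU0 (bcst (- k))).
rewrite [X in bm2 X](_ : _ = fun p => kruzkov_entropy k (U p)) in bK1; last first.
  by apply/funext => p; rewrite wE.
have bK2 := bm2D (bm2M (bcst 2) bQ) (bm2D bf0 (bcst (- f k))).
rewrite [X in bm2 X](_ : _ = fun p => kruzkov_flux f k (U p)) in bK2; last first.
  by apply/funext => p; rewrite QE.
have half0 : (0 : R) <= 2^-1 by rewrite invr_ge0.
pose A v := 2^-1 * kruzkov_entropy k v + 2^-1 * - v.
pose B v := 2^-1 * kruzkov_flux f k v + 2^-1 * - f v.
have hAB : tensor_nonneg A B U.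
  move=> psi chi a b c d ps cs a0 ab cd sp sc psi0 chi0.
  rewrite (weak_pairing_lin ps cs a0 ab cd sp sc _ _ bK1 bK2 bU bf).
  rewrite addr_ge0// mulr_ge0//; first exact: (hK _ _ a b c d).
  exact: (hN _ _ a b c d).
have bA := bm2D (bm2M (bcst 2^-1) bK1) (bm2M (bcst 2^-1) bU).
have bB := bm2D (bm2M (bcst 2^-1) bK2) (bm2M (bcst 2^-1) bf).
have wA : (fun v => A v + 2^-1 * k) = w by apply/funext => v; rewrite /A wE; field.
have QB : (fun v => B v + 2^-1 * f k) = Q by apply/funext => v; rewrite /B QE; field.
have := tensor_nonneg_shift (2^-1 * k) (2^-1 * f k) bA bB hAB; rewrite wA QB => hwQ.
have kw0 : {ae mu2, forall p, 0 < p.1 -> w (U p) = 0}.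
  apply: (mass_eq0 bw bQ w0 Qw L0 hwQ) => r e r0 e0.
  have [d d0 hd] := hu0 r e r0 e0; exists d => //.
  apply: (aeS hd) => t ht /ht hI.
  have iw := bmf_integrable (- r) r (bm2_section t bw).
  rewrite -lee_fin /Rintegral fineK; last exact: integrable_fin_num.
  apply: le_trans hI; apply: ae_ge0_le_integral => //.
  - by move=> x _; rewrite lee_fin.
  - exact: measurable_int iw.
  - apply/measurable_EFinP; apply: measurable_funTS.
    apply: measurableT_comp => //; apply: measurable_funB => //.
    exact: measurable_fun_pair2.
  (* Where [k <= u0 x], a positive value of [w] is at most [|U - u0|]. *)
  - apply: (aeS ku0) => x hx _; rewrite lee_fin.
    have [h0|h0] := leP (w (U (t, x))) 0; first exact: le_trans h0 _.
    have := ler_norm (u0 x - U (t, x)); rewrite distrC; move: h0.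
    by rewrite /w minEle; case: ifP => _ ? ?; lra.
apply: (aeS kw0) => p hp /hp; rewrite /w minEle.
by case: ifPn; [lra|rewrite -ltNge => /ltW].
Qed.

End MaximumPrinciple.

(** * The path of the theorem *)

Section Truncation.
Context {R : realType}.
Local Notation mu := (@lebesgue_measure R).
Local Notation mu2 := (mu \x mu)%E.
Context (M : R) (u : R * R -> R).
Hypothesis M0 : 0 <= M.
Hypothesis uM : Linfty_valued M u.

(* A version of [u] that is Borel and takes its values in [-M, M] everywhere. *)
Definition truncation (p : R * R) : R := clip M ((u \_ half_plane) p).

Lemma truncation_itv p : - M <= truncation p <= M.
Proof. exact: clip_itv. Qed.

Lemma measurable_truncation : measurable_fun setT truncation.
Proof.
have [mu_ _] := uM.
have h := (measurable_restrictT u measurable_half_plane).1 mu_.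
by apply: measurable_maxr => //; exact: measurable_minr.
Qed.

Lemma truncation_ae : {ae mu2, forall p, 0 < p.1 -> truncation p = u p}.
Proof.
have [_ h] := uM; apply: (aeS h) => p hp p0.
by rewrite /truncation patchE ifT ?mem_set// clip_id//; exact: hp.
Qed.

Lemma weak_pairing_truncation (A B psi chi : R -> R) :
  measurable_fun setT A -> measurable_fun setT B -> smooth1 psi -> smooth1 chi ->
  weak_pairing A B truncation (tensor psi chi) = weak_pairing A B u (tensor psi chi).
Proof.
move=> mA mB ps cs; rewrite !weak_pairing_tensor//; congr fine.
have m1 g : smooth1 g -> measurable_fun half_plane (fun p : R * R => g p.1).
  move=> gs; apply: measurable_funTS; apply: measurableT_comp => //.
  exact: continuous_measurable (smooth1_continuous gs).
have m2 g : smooth1 g -> measurable_fun half_plane (fun p : R * R => g p.2).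
  move=> gs; apply: measurable_funTS; apply: measurableT_comp => //.
  exact: continuous_measurable (smooth1_continuous gs).
have mG (V : R * R -> R) : measurable_fun half_plane V ->
    measurable_fun half_plane (fun p => (A (V p) * (derive1 psi p.1 * chi p.2) +
      B (V p) * (psi p.1 * derive1 chi p.2))%:E).
  move=> mV; apply/measurable_EFinP; apply: measurable_funD; apply: measurable_funM.
  - exact: measurableT_comp mA mV.
  - apply: measurable_funM; [exact: m1 (smooth1_derive1 ps)|exact: m2].
  - exact: measurableT_comp mB mV.
  - apply: measurable_funM; [exact: m1|exact: m2 (smooth1_derive1 cs)].
apply: ae_eq_integral.
- exact: measurable_half_plane.
- by apply: mG; apply: measurable_funTS; exact: measurable_truncation.
- by apply: mG; case: uM.
- by apply: (aeS truncation_ae) => p hp p0; rewrite hp.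
Qed.

Lemma entropic_truncation (A B : R -> R) :
  measurable_fun setT A -> measurable_fun setT B -> entropic A B u ->
  tensor_nonneg A B truncation.
Proof.
move=> mA mB hu psi chi a b c d ps cs a0 ab cd sp sc psi0 chi0.
rewrite weak_pairing_truncation//; apply: hu; first exact: test_function_tensor ps cs a0 sp sc.
by move=> p; rewrite mulr_ge0.
Qed.

Lemma weak_solution_truncation (f : R -> R) : continuous f -> weak_solution f u ->
  tensor_nonneg id f truncation /\
  tensor_nonneg (fun v => - v) (fun v => - f v) truncation.
Proof.
move=> cf hu; have mf := continuous_measurable cf.
have key psi chi a b c d : smooth1 psi -> smooth1 chi -> 0 < a -> a <= b -> c <= d ->
    supported a b psi -> supported c d chi ->
    weak_pairing id f truncation (tensor psi chi) = 0.
  move=> ps cs a0 ab cd sp sc; rewrite weak_pairing_truncation//.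
  exact: hu (test_function_tensor ps cs a0 sp sc).
split=> psi chi a b c d ps cs a0 ab cd sp sc psi0 chi0.
  by rewrite (key _ _ a b c d).
have -> : (fun v : R => - v) = (fun v => -1 * id v + 0 * id v).
  by apply/funext => v; rewrite mulN1r mul0r addr0.
have -> : (fun v : R => - f v) = (fun v => -1 * f v + 0 * f v).
  by apply/funext => v; rewrite mulN1r mul0r addr0.
have MM : - M <= M by rewrite ge0_cp.
have [C C0 hC] := continuous_itv_bounded MM cf.
have bU : bm2 (fun p => id (truncation p)) M.
  by split; [exact: measurable_truncation|move=> p; rewrite ler_norml; exact: truncation_itv].
have bf : bm2 (fun p => f (truncation p)) C.
  split; first exact: measurableT_comp mf measurable_truncation.
  by move=> p; apply: hC; exact: truncation_itv.
rewrite (weak_pairing_lin (A := id) (B := f) (A' := id) (B' := f) (U := truncation)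
  ps cs a0 ab cd sp sc _ _ bU bf bU bf).
by rewrite (key _ _ a b c d)// !mulr0 addr0.
Qed.

Lemma initial_value_truncation u0 : initial_value u u0 -> initial_value truncation u0.
Proof.
move=> [mu0 h]; split => // r e r0 e0; have [d d0 hd] := h r e r0 e0; exists d => //.
apply: (ae2S hd (ae_prod truncation_ae)) => t h1 h2 td.
have t0 : 0 < t by case/andP: td.
apply: le_trans (h1 td); rewrite le_eqVlt; apply/orP; left; apply/eqP.
have mt : measurable_fun setT (fun x => `|truncation (t, x) - u0 x|).
  apply: measurableT_comp => //; apply: measurable_funB => //.
  exact: measurable_fun_pair2 measurable_truncation.
have mt' : measurable_fun setT (fun x => `|u (t, x) - u0 x|).
  apply: measurableT_comp => //; apply: measurable_funB => //.
  have -> : (fun x => u (t, x)) = fun x => (u \_ half_plane) (t, x).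
    by apply/funext => x; rewrite patchE ifT// mem_set.
  apply: measurable_fun_pair2.
  by have [mu_ _] := uM; exact: (measurable_restrictT u measurable_half_plane).1 mu_.
apply: ae_eq_integral => //.
- by apply/measurable_EFinP; exact: measurable_funTS.
- by apply/measurable_EFinP; exact: measurable_funTS.
- by apply: (aeS h2) => x hx _; rewrite hx.
Qed.

(* No measurability is required: [t |-> esssup_abs_on ...] need not be Borel. *)
Lemma integral_subset_le (D E : set R) (f g : R -> \bar R) : D `<=` E ->
  (forall t, (0 <= f t)%E) -> (forall t, (0 <= g t)%E) ->
  (forall t, D t -> (f t <= g t)%E) ->
  (\int[mu]_(t in D) f t <= \int[mu]_(t in E) g t)%E.
Proof.
move=> DE f0 g0 fg; rewrite !ge0_integralE//.
apply: le_ereal_sup => _ [s hs <-]; exists s => // t; apply: (le_trans (hs t)).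
rewrite !patchE; case: ifPn => [/set_mem Dt|_]; first by rewrite ifT ?fg ?mem_set//; exact: DE.
by case: ifP.
Qed.

Lemma one_sided_trace_restrict (I : nat -> set R) h v t0 : 0 <= t0 ->
  one_sided_trace I u 0 h v -> one_sided_trace I u t0 h v.
Proof.
move=> t00 [mv bv hv].
have sub : `[t0, +oo[ `<=` `[0:R, +oo[.
  by move=> t /=; rewrite !in_itv /= !andbT; exact: le_trans.
split; first exact: measurable_funS mv.
  have [K [Kr hK]] := bv; exists K; split => // x Kx t tt.
  by apply: hK => //; exact: sub.
move=> T tT; apply: squeeze_cvge (cvg_cst 0%E) (hv T (le_lt_trans t00 tT)).
apply: nearW => n; apply/andP; split.
  by apply: integral_ge0 => t _; exact: esssup_abs_on_ge0.
apply: integral_subset_le => [t|t|t|t _] //; try exact: esssup_abs_on_ge0.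
by rewrite /= !in_itv /= => /andP[h1 ->]; rewrite (le_trans t00).
Qed.

(** The essential supremum formed with [u] need not be measurable in time; the one formed with the
    Borel version is. The two agree off a null set of times, so the second integral is bounded by
    the first. *)
Lemma one_sided_trace_truncation (I : nat -> set R) h v t0 : 0 <= t0 ->
  (forall n, measurable (I n)) -> measurable_fun setT h ->
  one_sided_trace I u 0 h v ->
  exists v' C, [/\ bmf v' C, forall t, 0 <= t -> v' t = v t &
    forall T, t0 < T -> (fun n => \int[mu]_(t in `[t0, T])
      esssup_abs_on (I n) (fun y => truncation (t, h t + y) - v' t)%R)%E @ \oo --> 0%E].
Proof.
move=> t00 mI mh [mv bv hv].
have [C hC] : exists C, forall t, 0 <= t -> `|v t| <= C.
  have [K [Kr hK]] := bv; exists (K + 1) => t tt.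
  by apply: (hK (K + 1)); rewrite ?ltrDl// /= in_itv /= tt.
have C0 : 0 <= C by exact: le_trans (hC 0 (lexx _)).
pose v' := fun t => if t \in `[0, +oo[%classic then v t else 0.
have v'E t : 0 <= t -> v' t = v t.
  by move=> tt; rewrite /v' ifT// mem_set//= in_itv /= tt.
have bv' : bmf v' C.
  split; last first.
    move=> t; rewrite /v'; case: ifPn => [/set_mem|]; last by rewrite normr0.
    by rewrite /= in_itv /= andbT => /hC.
  have := (measurable_restrictT v (measurable_itv `[0, +oo[)).1 mv.
  by congr measurable_fun; apply/funext => t; rewrite /v' patchE.
exists v', C; split => // T tT.
have bU : bm2 truncation M.
  by split; [exact: measurable_truncation|move=> p; rewrite ler_norml; exact: truncation_itv].
apply: squeeze_cvge (cvg_cst 0%E) (hv T (le_lt_trans t00 tT)).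
apply: nearW => n; apply/andP; split.
  by apply: integral_ge0 => t _; exact: esssup_abs_on_ge0.
have [N [mN N0 hN]] := ae_prod truncation_ae.
(* [N] contains the times at which the two functions differ on a non-null set of positions; time 0
   is removed because agreement is known only for [t > 0]. *)
pose D := `[t0, T] `\` (N `|` [set 0]).
have mE : measurable_fun `[t0, T] (fun t =>
    esssup_abs_on (I n) (fun y => truncation (t, h t + y) - v' t)%R).
  apply: (eq_measurable_fun (EFin \o ess_gap (I n) truncation h v')).
    by move=> t _ /=; rewrite (ess_gapE (I n) h bU bv').
  apply/measurable_EFinP; apply: measurable_funTS.
  by have [] := ess_gap_bmf (mI n) bU mh bv'.
have mN0 : measurable (N `|` [set (0:R)]) by exact: measurableU.
rewrite (ge0_negligible_integral mN0)//; last 2 first.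
- by move=> t _; exact: esssup_abs_on_ge0.
- by rewrite measureU0 ?N0//; exact: lebesgue_measure_set1.
apply: integral_subset_le => [t|t|t|t] //; try exact: esssup_abs_on_ge0.
  by move=> [/= +_]; rewrite !in_itv /= => /andP[h1 ->]; rewrite (le_trans t00).
move=> [/= + /not_orP[Nt t_neq0]]; rewrite in_itv /= => /andP[tt _].
have t_ge0 := le_trans t00 tt.
have t_gt0 : 0 < t by rewrite lt_neqAle t_ge0 andbT eq_sym; apply/eqP.
rewrite le_eqVlt; apply/orP; left; apply/eqP; apply: eq_ess_sup.
have ht : {ae mu, forall x, 0 < (t, x).1 -> truncation (t, x) = u (t, x)}.
  by apply: contrapT => h0; apply: Nt; exact: hN.
apply: (aeS (ae_shift (h t) ht)) => y hy; rewrite !patchE; case: ifP => // _.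
by rewrite v'E// (addrC (h t)) hy.
Qed.

End Truncation.

(** * Consequences of the hypotheses on the flux and on the shock *)

Section ProblemData.
Context {R : realType}.

Lemma class_C_is_derive n (g : R -> R) k : class_C n g -> (k < n)%N ->
  forall x : R, is_derive x (1:R) (derive1n k g) (derive1n k.+1 g x).
Proof. by move=> [dg _] kn x; rewrite derive1nS; apply: is_derive1P; exact: dg. Qed.

Lemma class_C_continuous n (g : R -> R) k : class_C n g -> (k < n)%N ->
  continuous (derive1n k g).
Proof. by move=> hg kn; exact: is_derive_continuous (class_C_is_derive hg kn). Qed.

Lemma C1_lipschitz_itv (g dg : R -> R) (M : R) : 0 <= M ->
  (forall x : R, is_derive x (1:R) g (dg x)) -> continuous dg ->
  exists2 L, 0 < L & forall x y, - M <= x <= M -> - M <= y <= M ->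
    `|g x - g y| <= L * `|x - y|.
Proof.
move=> M0 gd cdg; have MM : - M <= M by rewrite ge0_cp.
have [C C0 hC] := continuous_itv_bounded MM cdg; exists C => // x y xM yM.
have [->|xy] := eqVneq x y; first by rewrite !subrr normr0 mulr0.
have [c hc e] := mean_value_ne gd xy.
rewrite distrC e normrM (distrC y) ler_wpM2r//; apply: hC.
have [m1 m2] : - M <= Num.min x y /\ Num.max x y <= M.
  by case/andP: xM => ? ?; case/andP: yM => ? ?; rewrite le_min ge_max; split; apply/andP.
by case/andP: hc => c1 c2; rewrite (le_trans m1 (ltW c1)) (le_trans (ltW c2) m2).
Qed.

Lemma lipschitz_itv_oo (h : R -> R) (L t0 : R) :
  (forall s t, `|h s - h t| <= L * `|s - t|) -> [lipschitz h t | t in `[t0, +oo[].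
Proof.
move=> hL; exists L; split; first exact: num_real.
move=> K LK [s t] _ /=; apply: (le_trans (hL s t)).
by rewrite ler_wpM2r// ltW.
Qed.

Lemma kruzkov_measurable (f : R -> R) (k : R) : measurable_fun setT f ->
  measurable_fun setT (kruzkov_entropy k) /\ measurable_fun setT (kruzkov_flux f k).
Proof.
move=> mf; split.
  by apply: measurableT_comp => //; exact: measurable_funB.
have -> : kruzkov_flux f k = fun v => f (Num.max v k) - f (Num.min v k).
  apply/funext => v; rewrite /kruzkov_flux maxElt minElt; case: ltgtP => vk.
  - by rewrite ltr0_sg ?subr_lt0//; ring.
  - by rewrite gtr0_sg ?subr_gt0// mul1r.
  - by rewrite vk !subrr mulr0.
by apply: measurable_funB; apply: measurableT_comp => //;
  [exact: measurable_maxr|exact: measurable_minr].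
Qed.

Section OleinikOrder.
Context (f df ddf : R -> R).
Hypothesis f_d : forall x : R, is_derive x (1:R) f (df x).
Hypothesis df_d : forall x : R, is_derive x (1:R) df (ddf x).
Hypothesis ddf_pos : forall x : R, 0 < x -> 0 < ddf x.

(** For [uL < uR], strict convexity on the positive half-line puts the slope from [uL] to the
    midpoint strictly below the slope to [uR], against Oleinik's condition. *)
Lemma oleinik_shock_decreasing (uL uR : R) : 0 < uL -> oleinik_shock f uL uR -> uR < uL.
Proof.
move=> uL0 [uLR hO]; rewrite ltNge le_eqVlt (negbTE uLR) /=; apply/negP => lt_LR.
pose x := (uL + uR) / 2.
have Lx : uL < x by rewrite /x; lra.
have xR : x < uR by rewrite /x; lra.
have := hO x; rewrite min_l ?max_r ?(ltW lt_LR)// Lx xR => /(_ isT).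
have [c /andP[c1 c2] e1] := mean_value f_d Lx.
have [d /andP[d1 d2] e2] := mean_value f_d xR.
have cd : df c < df d.
  by apply: (df_incr df_d ddf_pos) => //; lra.
have -> : f uR - f uL = df c * (x - uL) + df d * (uR - x) by rewrite -e1 -e2; ring.
rewrite e1 mulfK ?subr_eq0 ?gt_eqF// ler_pdivrMr ?subr_gt0// => h.
have : 0 < (df d - df c) * (uR - x) by rewrite mulr_gt0 ?subr_gt0.
lra.
Qed.

End OleinikOrder.

Lemma concave_convex_derivatives (f : R -> R) : concave_convex_flux f ->
  [/\ forall x : R, is_derive x (1:R) f (derive1 f x),
      forall x : R, is_derive x (1:R) (derive1 f) (derive1n 2 f x),
      forall x : R, x < 0 -> derive1n 2 f x < 0,
      forall x : R, 0 < x -> 0 < derive1n 2 f x &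
      continuous (derive1n 2 f)].
Proof.
move=> [cf sgn _ _ _]; split.
- exact: (class_C_is_derive (k := 0) cf).
- exact: (class_C_is_derive (k := 1) cf).
- by move=> x x0; have := sgn x; rewrite nmulr_rgt0// => -> //; rewrite lt_eqF.
- by move=> x x0; have := sgn x; rewrite pmulr_rgt0// => -> //; rewrite gt_eqF.
- exact: (class_C_continuous (k := 2) cf).
Qed.

Lemma phi_natP (f : R -> R) (b : R) : concave_convex_flux f -> 0 < b ->
  phi_nat f b != b /\
  derive1 f (phi_nat f b) * (b - phi_nat f b) = f b - f (phi_nat f b).
Proof.
move=> hf b0; have [f_d df_d ddf_neg ddf_pos _] := concave_convex_derivatives hf.
have [_ _ _ _ foo] := hf.
have := tangent_point_exists f_d df_d ddf_neg ddf_pos b0 foo.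
have b_neq0 : (b == 0) = false by rewrite gt_eqF.
rewrite /phi_nat b_neq0 => hex; have [kb ->] := xgetPex 0 hex.
by split => //; rewrite divfK// subr_eq0 eq_sym.
Qed.

End ProblemData.

Unset Implicit Arguments.
Set Strict Implicit.

Theorem corollary1p2 (R : realType) (M : R) (f eta q : R -> R)
    (M_gt0 : 0 < M)
    (f_flux : concave_convex_flux f)
    (eta_q : convex_entropy_pair f eta q)
    (blow bup : R) (blow_gt0 : 0 < blow) (blow_bup : blow < bup)
    (b_state : `[blow, bup] `<=` `[- M, M])
    (s0 : R) (s0_gt0 : 0 < s0) :
  exists astar lambda1 : R, 0 < astar < 1 /\
  forall a1 a2 : R, 0 < a1 -> 0 < a2 -> a2 / a1 <= astar ->
  forall uL uR : R, oleinik_shock f uL uR ->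
    blow <= uL <= bup -> blow <= uR <= bup -> s0 <= `|uL - uR| ->
  forall u : R * R -> R, S_weak M f eta q blow u ->
  forall tbar x0 : R, 0 <= tbar ->
  exists h um up : R -> R,
    [/\ [lipschitz h t | t in `[tbar, +oo[],
        h tbar = x0,
        strong_traces u tbar h um up &
        {ae @lebesgue_measure R, forall t, tbar <= t ->
          [/\ derivable h t 1,
              `|derive1 h t| <= lambda1 &
              a1 * (derive1 h t * rel_entropy eta (um t) uL
                    - rel_flux f eta q (um t) uL)
              - a2 * (derive1 h t * rel_entropy eta (up t) uR
                      - rel_flux f eta q (up t) uR) <= 0]}].
Proof.
have [f_d df_d ddf_neg ddf_pos ddf_c] := concave_convex_derivatives f_flux.
have [ce e2_pos q_d] := eta_q; have M0 := ltW M_gt0.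
have e_d : forall x : R, is_derive x (1:R) eta (derive1 eta x).
  exact: (class_C_is_derive (k := 0) ce).
have e1_d : forall x : R, is_derive x (1:R) (derive1 eta) (derive1n 2 eta x).
  exact: (class_C_is_derive (k := 1) ce).
have e2_c : continuous (derive1n 2 eta) by exact: (class_C_continuous (k := 2) ce).
have df_c : continuous (derive1 f) by exact: (is_derive_continuous df_d).
have f_c : continuous f by exact: (is_derive_continuous f_d).
have e_c : continuous eta by exact: (is_derive_continuous e_d).
have e1_c : continuous (derive1 eta) by exact: (is_derive_continuous e1_d).
have q_c : continuous q by exact: (is_derive_continuous q_d).
have [bM bupM] : blow <= M /\ bup <= M.
  have h z : blow <= z <= bup -> z <= M.
    by have := b_state z; rewrite /= !in_itv /= => + hz => /(_ hz)/andP[].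
  by split; apply: h; rewrite lexx (ltW blow_bup).
have [kb ktan] := phi_natP f_flux blow_gt0.
have [astar [Lam [astar01 Lam0 hV]]] := velocity_field f_d df_d ddf_neg ddf_pos ddf_c
  e_d e1_d e2_pos e2_c q_d M_gt0 blow_gt0 bM bupM s0_gt0 kb ktan.
exists astar, Lam; split => // a1 a2 a10 a20 a12 uL uR shock /andP[bL Lb] /andP[bR Rb] sLR
  u [uM weak [ent kru] strong [u0 hu0 ku0]] tbar x0 tbar0.
have RL : uR < uL.
  exact: oleinik_shock_decreasing f_d df_d ddf_pos _ _ (lt_le_trans blow_gt0 bL) shock.
have RL' : uR + s0 <= uL.
  by move: sLR; rewrite gtr0_norm ?subr_gt0// lerBrDl.
have [V [LV [LV0 V_le V_lip V_ineq]]] := hV a1 a2 a10 a20 a12 uL uR bR RL' Lb.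
pose U := truncation M u; set k := phi_nat f blow in kb ktan ent kru ku0 V_ineq *.
have UM p : - M <= U p <= M by exact: truncation_itv.
have mU : measurable_fun setT U := measurable_truncation uM.
have bU : bm2 U M by split => // p; rewrite ler_norml.
have bW : bm2 (fun p => V (U p)) Lam.
  split; last by move=> p; exact: V_le.
  exact: measurableT_comp (continuous_measurable (lipschitz_continuous V_lip)) mU.
have [h [h_lip0 h_x0 h_fil]] := euler_path bW tbar x0.
have h_lip s t : `|h s - h t| <= Lam * `|s - t| by exact: h_lip0.
have h_m : measurable_fun setT h := continuous_measurable (lipschitz_continuous h_lip).
(* [h] is constant before [tbar], hence Lipschitz on all of [[0, +oo[], where the trace property is
   stated. *)
have [um [up [trm trp]]] := strong h (lipschitz_itv_oo 0 h_lip).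
exists h, um, up; split; [exact: (lipschitz_itv_oo tbar h_lip)|exact: h_x0| |].
  by split; exact: one_sided_trace_restrict.
have [vm [Cm [bm vmE limm]]] := one_sided_trace_truncation M0 uM tbar0
  (fun n => measurable_itv _) h_m trm.
have [vp [Cp [bp vpE limp]]] := one_sided_trace_truncation M0 uM tbar0
  (fun n => measurable_itv _) h_m trp.
have hbu := blow_up_ae bU h_m bm bp limm limp.
have [weak1 weak2] := weak_solution_truncation M0 uM f_c weak.
have entU := entropic_truncation uM (continuous_measurable e_c) (continuous_measurable q_c) ent.
have [mk1 mk2] := kruzkov_measurable k (continuous_measurable f_c).
have kruU := entropic_truncation uM mk1 mk2 kru.
have Uk : {ae (@lebesgue_measure R \x @lebesgue_measure R)%E, forall p, 0 < p.1 -> k <= U p}.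
  (* [k] may lie below [- M], so [f] is controlled on an interval that contains both [k] and the
     values of [U]. *)
  pose M' := M + `|k|.
  have M'0 : 0 <= M' by rewrite addr_ge0.
  have [L L0 hL] := C1_lipschitz_itv M'0 f_d df_c.
  apply: (maximum_principle (M := M') _ mU _ f_c (ltW L0) hL weak2 kruU
    (initial_value_truncation uM hu0) ku0).
    move=> p; have := UM p; have := normr_ge0 k; rewrite /M'.
    by move: `|k| => c ? /andP[? ?]; apply/andP; split; lra.
  by rewrite -ler_norml /M' lerDr.
have Uk' : {ae (@lebesgue_measure R \x @lebesgue_measure R)%E, forall p,
    0 < p.1 -> Num.max k (- M) <= U p <= M}.
  by apply: (aeS Uk) => p hp /hp kp; rewrite ge_max kp UM.
have mup n : (0 < lebesgue_measure (`](- n.+1%:R^-1)%R, 0%R[%classic : set R))%E.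
  rewrite lebesgue_measure_itv /= lte_fin oppr_lt0 invr_gt0 ltr0n.
  by rewrite -EFinB lte_fin sub0r opprK invr_gt0 ltr0n.
have mup' n : (0 < lebesgue_measure (`]0%R, (n.+1%:R^-1)%R[%classic : set R))%E.
  by rewrite lebesgue_measure_itv /= lte_fin invr_gt0 ltr0n -EFinB lte_fin subr0 invr_gt0 ltr0n.
have vmM := trace_itv (fun n => measurable_itv _) mup bU h_m bm limm Uk'.
have vpM := trace_itv (fun n => measurable_itv _) mup' bU h_m bp limp Uk'.
have [Lf Lf0 f_lip] := C1_lipschitz_itv M0 f_d df_c.
have [Le Le0 e_lip] := C1_lipschitz_itv M0 e_d e1_c.
have q1_c : continuous (fun x => derive1 eta x * derive1 f x).
  by move=> x; apply: cvgM; [exact: e1_c|exact: df_c].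
have [Lq Lq0 q_lip] := C1_lipschitz_itv M0 q_d q1_c.
pose L := 1 + Lf + Le + Lq.
have L1 : 1 <= L by rewrite /L; lra.
have L_ge0 : 0 <= L by exact: le_trans L1.
have lipW (g : R -> R) L' : L' <= L ->
    (forall x y, - M <= x <= M -> - M <= y <= M -> `|g x - g y| <= L' * `|x - y|) ->
    forall x y, - M <= x <= M -> - M <= y <= M -> `|g x - g y| <= L * `|x - y|.
  by move=> LL hg x y xM yM; apply: (le_trans (hg x y xM yM)); rewrite ler_wpM2r.
have {}f_lip := lipW f Lf ltac:(rewrite /L; lra) f_lip.
have {}e_lip := lipW eta Le ltac:(rewrite /L; lra) e_lip.
have {}q_lip := lipW q Lq ltac:(rewrite /L; lra) q_lip.
(* Time [tbar] is discarded: the argument at [t] uses times on both sides, and [h] follows the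
   velocity field only from [tbar] on. *)
apply: (ae2S (ae2S vmM vpM _) (ae2S hbu (ae_neq tbar) _)) => [t h1 h2|t h1 h2|t].
- exact: conj h1 h2.
- exact: conj h1 h2.
move=> [vm1 vp1] [bl tneq] tt.
have {}tneq : tbar < t by rewrite lt_neqAle eq_sym tneq.
have t0 : 0 < t by exact: le_lt_trans tneq.
have {vm1}/andP := vm1 t0 tt; rewrite ge_max => -[/andP[km mM1] mM2].
have {vp1}/andP := vp1 t0 tt; rewrite ge_max => -[/andP[kp pM1] pM2].
have mM : - M <= vm t <= M by rewrite mM1.
have pM : - M <= vp t <= M by rewrite pM1.
have [s [hs smin RH es]] := point_conclusion UM mU LV0 V_lip L_ge0 L1 f_lip e_lip q_lip
  f_c e_c q_c h_lip (ltW Lam0) tbar0 tneq mM pM (bl tt) h_fil weak1 weak2 entU.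
have := V_ineq _ _ _ mM pM km kp smin RH es.
rewrite -vmE ?(ltW t0)// -vpE ?(ltW t0)//.
have [dh dhs] := hs; rewrite derive1E dhs; split => //.
have /andP[s1 s2] := smin.
have := V_le (vm t); have := V_le (vp t); rewrite !ler_norml => /andP[? ?] /andP[? ?].
apply/andP; split.
  by apply: le_trans s1; rewrite le_min; apply/andP.
by apply: (le_trans s2); rewrite ge_max; apply/andP.
Qed.
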